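(* There is a polynomial-time online algorithm for Online Stochastic Matching with Timeouts whose expected total profit is, on every instance, at least $0.245$ times the expected profit of an optimal online algorithm.
   Context: Online Stochastic Matching with Timeouts. The input consists of: - a complete bipartite graph $G=(A\cup B,A\times B)$, where $A$ is a set of items and $B$ a set of buyer types; - for each edge $ab$, a probability $p_{ab}\in(0,1]$ and a profit $w_{ab}\ge 0$; - for each buyer type $b$, a positive integer timeout $t_b$ (items have unbounded timeouts); - a number $n$ of rounds, and a probability distribution on $B$ in which every probability is an integer multiple of $1/n$. The process runs for $n$ rounds. In each round a buyer's type $b$ is sampled independently from the distribution, with repetitions allowed. The online algorithm then chooses at most $t_b$ items that are still unmatched and probes the corresponding edges one at a time, in an order it chooses. - Each probed edge $ab$ exists independently with probability $p_{ab}$. - If a probed edge exists, the item $a$ is matched to this buyer, profit $w_{ab}$ is gained, and this buyer stops probing. - Otherwise the algorithm continues with the next chosen item. Each item can be matched at most once. The goal is to maximize the expected total profit, and this is compared to an optimal online algorithm. *)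

(* Defs.v *)
From mathcomp Require Import all_boot all_order all_algebra.
Set Implicit Arguments. Unset Strict Implicit. Unset Printing Implicit Defensive.
Import Order.TTheory GRing.Theory Num.Theory.
Local Open Scope ring_scope.

(* Instances (rational data, so that they can be given as input to a   *)
(* machine).                                                           *)
Record instance := Instance {
  nA : nat;
  nB : nat;
  prob : 'I_nA -> 'I_nB -> rat;
  wt : 'I_nA -> 'I_nB -> rat;
  tout : 'I_nB -> nat;
  nr : nat;
  cnt : 'I_nB -> nat                     (* Pr[type b] = cnt b / n *)
}.

Definition valid_instance (I : instance) : Prop :=
  [/\ forall (a : 'I_(nA I)) (b : 'I_(nB I)), 0 < prob a b <= 1,
      forall (a : 'I_(nA I)) (b : 'I_(nB I)), 0 <= wt a b,
      forall b : 'I_(nB I), (0 < tout b)%N,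
      (0 < nr I)%N &
      (\sum_(b < nB I) cnt b)%N = nr I].

Section Process.
Variable I : instance.
Local Notation item := 'I_(nA I).
Local Notation buyer := 'I_(nB I).

(* a round of history: buyer type, executed probe list, matched item (if any) *)
Definition round := (buyer * seq item * option item)%type.
Definition history := seq round.

Definition matched (h : history) : seq item :=
  flatten [seq (if r.2 is Some a then [:: a] else [::]) | r <- h].

Definition exec_list (h : history) (b : buyer) (s : seq item) : seq item :=
  take (tout b) (undup [seq a <- s | a \notin matched h]).

Fixpoint probe_val (b : buyer) (s : seq item) (F : option item -> rat) : rat :=
  match s with
  | [::] => F None
  | a :: s' => prob a b * F (Some a) + (1 - prob a b) * probe_val b s' F
  end.

(* A (randomized) online algorithm in behavioural form: given the whole
   observed history and the current buyer type, a finitely supported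
   distribution over probe lists. *)
Definition rpolicy := history -> buyer -> seq (rat * seq item).

Definition valid_rpolicy (pol : rpolicy) : Prop :=
  forall h b, all (fun d => 0 <= d.1) (pol h b) /\ \sum_(d <- pol h b) d.1 = 1.

Fixpoint value_from (pol : rpolicy) (k : nat) (h : history) : rat :=
  match k with
  | 0 => 0
  | k'.+1 =>
      \sum_(b < nB I) ((cnt b)%:R / (nr I)%:R) *
        \sum_(d <- pol h b) d.1 *
          (let s := exec_list h b d.2 in
           probe_val b s (fun o =>
             (if o is Some a then wt a b else 0) + value_from pol k' (rcons h (b, s, o))))
  end.

Definition value (pol : rpolicy) : rat := value_from pol (nr I) [::].

End Process.

Inductive sym := B0 | B1 | Sep | Blank.
Definition sym_eqb (x y : sym) : bool :=
  match x, y with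
  | B0, B0 | B1, B1 | Sep, Sep | Blank, Blank => true | _, _ => false end.

Inductive dir := Lm | Rm | Sm.
Definition dir_int (d : dir) : int := match d with Lm => -1 | Rm => 1 | Sm => 0 end.

(* states 'I_(nq+2); start state ord0, halting state ord_max *)
Record TM := MkTM {
  nq : nat;
  delta : 'I_nq.+2 -> sym -> 'I_nq.+2 * sym * dir
}.

Definition config (M : TM) := ('I_(nq M).+2 * int * (int -> sym))%type.

Definition init_config (M : TM) (inp : seq sym) : config M :=
  (ord0, 0%:Z, fun z : int => if z is Posz m then nth Blank inp m else Blank).

Definition step (M : TM) (c : config M) : config M :=
  let: (q, hd, tp) := c in
  if q == ord_max then c else
  let: (q', s', d) := delta q (tp hd) in
  (q', hd + dir_int d, fun z => if z == hd then s' else tp z).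

Definition run (M : TM) (T : nat) (inp : seq sym) : config M :=
  iter T (step (M := M)) (init_config M inp).

Definition halts_within (M : TM) (T : nat) (inp : seq sym) : Prop :=
  (run M T inp).1.1 = ord_max.

Fixpoint take_nonblank (s : seq sym) : seq sym :=
  match s with
  | [::] => [::]
  | Blank :: _ => [::]
  | x :: s' => x :: take_nonblank s'
  end.

Definition tm_output (M : TM) (T : nat) (inp : seq sym) : seq sym :=
  let: (_, _, tp) := run M T inp in
  take_nonblank [seq tp (Posz i) | i <- iota 0 (T + size inp)].

Fixpoint bin_aux (fuel n : nat) : seq sym :=
  match fuel with
  | 0 => [::]
  | f.+1 => if n == 0%N then [::] else (if odd n then B1 else B0) :: bin_aux f n./2
  end.
Definition enc_nat (n : nat) : seq sym := bin_aux n n ++ [:: Sep].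
Definition enc_int (z : int) : seq sym :=
  (if z < 0 then B1 else B0) :: enc_nat `|z|%N.
Definition enc_rat (q : rat) : seq sym := enc_int (numq q) ++ enc_int (denq q).
Definition enc_bits (r : seq bool) : seq sym :=
  [seq (if x then B1 else B0) | x <- r] ++ [:: Sep].

Definition enc_instance (I : instance) : seq sym :=
  enc_nat (nA I) ++ enc_nat (nB I) ++ enc_nat (nr I) ++
  flatten [seq enc_rat (prob a b) ++ enc_rat (wt a b)
          | a <- enum 'I_(nA I), b <- enum 'I_(nB I)] ++
  flatten [seq enc_nat (tout b) ++ enc_nat (cnt b) | b <- enum 'I_(nB I)].

Definition enc_round (I : instance) (r : round I) : seq sym :=
  let: (b, s, o) := r in
  enc_nat b ++ enc_nat (size s) ++ flatten (map (fun a : 'I_(nA I) => enc_nat a) s) ++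
  enc_nat (if o is Some a then (a : nat).+1 else 0%N).

Definition enc_history (I : instance) (h : history I) : seq sym :=
  enc_nat (size h) ++ flatten [seq enc_round r | r <- h].

Fixpoint dec_nats (s : seq sym) (acc pw : nat) : seq nat :=
  match s with
  | [::] => [::]
  | Sep :: s' => acc :: dec_nats s' 0 1
  | B1 :: s' => dec_nats s' (acc + pw) (pw * 2)
  | B0 :: s' => dec_nats s' acc (pw * 2)
  | Blank :: s' => dec_nats s' acc pw
  end.

(* Machine input in a round: instance, history so far, current buyer type,
   and the algorithm's (whole) random string. *)
Definition tm_input (I : instance) (h : history I) (b : 'I_(nB I))
    (R : seq bool) : seq sym :=
  enc_instance I ++ enc_history h ++ enc_nat b ++ enc_bits R.

Definition pbound (c k : nat) (I : instance) (m : nat) : nat :=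
  (c * (m + nr I + 1) ^ k)%N.

Definition nrand (c k : nat) (I : instance) : nat :=
  pbound c k I (size (enc_instance I)).

Definition poly_time (M : TM) (c k : nat) : Prop :=
  forall (I : instance) (h : history I) (b : 'I_(nB I)) (R : seq bool),
    halts_within M (pbound c k I (size (tm_input h b R))) (tm_input h b R).

Definition tm_policy (M : TM) (c k : nat) (I : instance) (R : seq bool) : rpolicy I :=
  fun h b =>
    let inp := tm_input h b R in
    [:: (1, pmap (@insub nat (fun x => (x < nA I)%N) 'I_(nA I))
                 (dec_nats (tm_output M (pbound c k I (size inp)) inp) 0 1))].

Definition tm_value (M : TM) (c k : nat) (I : instance) : rat :=
  let L := nrand c k I in
  (2%:R ^+ L)^-1 * \sum_(R : L.-tuple bool) value (@tm_policy M c k I R).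

(* Main.v *)
(** The online algorithm is deterministic and avoids solving a linear program.
    Backwards in time it computes opportunity costs [nu a] of the items, one
    round at a time.  Inside a round the items are scanned in a fixed order; a
    buyer [b] carries a price [mu b], initially [0], and the edge [(a, b)] has
    the gain
      [G = max 0 (p (w - nu a - mu b) - mu b / t_b)].
    Then [mu b] increases by [G] and [nu a] by the average of [G] over [b].
    The algorithm probes the items of positive gain in reverse scanning order.
    An edge uses three resources (the item, the buyer, one of the [t_b]
    probes), and charging [G] to each of them yields, for [V = sum_a nu a], that
    the algorithm earns at least [V] and no online algorithm more than [4 V].

    Gains are rounded down to multiples of [1 / S]; the scale [S] is so large
    that the rounding costs less than the gap between [1/4] and [0.245].

    The Turing machine keeps finitely many stacks on its tape, separated by
    blanks, so that a push or a pop is one sweep over the tape.  Arithmetic on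
    binary words is programmed with these stacks, and since all numbers have
    polynomially many bits, the number of stack operations is polynomial. *)

Require Import Defs.
From mathcomp Require Import all_boot all_order all_algebra.
From mathcomp Require Import zify ring lra.
From Stdlib Require Import FunctionalExtensionality.
Import Order.TTheory GRing.Theory Num.Theory.
Set Implicit Arguments. Unset Strict Implicit. Unset Printing Implicit Defensive.

(** * Machine fragments and stacks on a tape *)

(* In a stack, [Some b] is a bit and [None] ends a word; in a cell, the outer
   [None] is the blank. *)
Notation stk := (seq (option bool)).
Notation cell := (option (option bool)).

(* A transition leads to another state of the fragment, or leaves the fragment
   with a tag on which the continuation may branch. *)
Record mach := Mach {
  cQ : finType;
  cq0 : cQ;
  ctr : cQ -> cell -> (cQ + cell) * cell * dir }.

Definition mv (d : dir) (s : cell) (l r : seq cell) : option (seq cell * seq cell) :=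
  match d with
  | Rm => Some (s :: l, behead r)
  | Sm => Some (l, s :: behead r)
  | Lm => if l is a :: l' then Some (l', a :: s :: behead r) else None
  end.

Inductive runs (C : mach) :
  nat -> cQ C -> seq cell * seq cell -> cell -> seq cell * seq cell -> Prop :=
| RunsExit q l r x s d z : ctr q (head None r) = (inr x, s, d) ->
    mv d s l r = Some z -> runs 1 q (l, r) x z
| RunsStep q l r q1 s d z1 n x z : ctr q (head None r) = (inl q1, s, d) ->
    mv d s l r = Some z1 -> runs n q1 z1 x z -> runs n.+1 q (l, r) x z.

Definition rn C n z x z' := runs n (cq0 C) z x z'.

Section Bind.
Variables (C : mach) (k : cell -> mach).

Definition bindQ : finType := (cQ C + {x : cell & cQ (k x)})%type.
Definition bind_tr (q : bindQ) (s : cell) : (bindQ + cell) * cell * dir :=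
  match q with
  | inl q => let: (o, s', d) := ctr q s in
      (match o with inl q1 => inl (inl q1)
              | inr x => inl (inr (existT _ x (cq0 (k x)))) end, s', d)
  | inr (existT x q) => let: (o, s', d) := ctr q s in
      (match o with inl q1 => inl (inr (existT _ x q1)) | inr y => inr y end, s', d)
  end.
Definition bind : mach := @Mach bindQ (inl (cq0 C)) bind_tr.

Lemma runs_bind_r x n q z y z' :
  runs (C := k x) n q z y z' -> runs (C := bind) n (inr (existT _ x q)) z y z'.
Proof.
elim=> [{}q l r {}y s d {}z e m|{}q l r q1 s d z1 {}n {}y {}z e m _ IH].
  by apply: (RunsExit (C := bind) (d := d) (s := s)) => //=; rewrite e.
by apply: (RunsStep (C := bind) (d := d) (s := s) _ m IH); rewrite /= e.
Qed.

Lemma runs_bind n m q z x z1 y z2 :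
  runs n q z x z1 -> rn (k x) m z1 y z2 -> runs (C := bind) (n + m) (inl q) z y z2.
Proof.
elim=> [{}q l r {}x s d z' e m1|{}q l r q1 s d z' {}n {}x z'' e m1 _ IH] H.
  rewrite add1n; apply: (RunsStep (C := bind) (d := d) (s := s) _ m1 (runs_bind_r H)).
  by rewrite /= e.
rewrite addSn; apply: (RunsStep (C := bind) (d := d) (s := s) _ m1 (IH H)).
by rewrite /= e.
Qed.

Lemma rn_bind n m z x z1 y z2 :
  rn C n z x z1 -> rn (k x) m z1 y z2 -> rn bind (n + m) z y z2.
Proof. exact: runs_bind. Qed.
End Bind.

Section Loop.
Variables (C : mach) (cont : pred cell).

Definition loop_tr (q : cQ C) (s : cell) : (cQ C + cell) * cell * dir :=
  let: (o, s', d) := ctr q s in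
  (match o with inl q1 => inl q1
           | inr x => if cont x then inl (cq0 C) else inr x end, s', d).
Definition loop : mach := @Mach (cQ C) (cq0 C) loop_tr.

Lemma rn_loop_exit n z x z' : rn C n z x z' -> ~~ cont x -> rn loop n z x z'.
Proof.
rewrite /rn /=; elim=> [q l r {}x s d {}z e m|q l r q1 s d z1 {}n {}x {}z e m _ IH] cx.
  apply: (RunsExit (C := loop) (d := d) (s := s) _ m).
  by rewrite /= /loop_tr e (negbTE cx).
by apply: (RunsStep (C := loop) (d := d) (s := s) _ m (IH cx)); rewrite /= /loop_tr e.
Qed.

Lemma runs_loop_cont n (q : cQ C) z x z1 m y z2 :
  runs n q z x z1 -> cont x -> rn loop m z1 y z2 ->
  runs (C := loop) (n + m) q z y z2.
Proof.
elim=> [{}q l r {}x s d z' e m1|{}q l r q1 s d z' {}n {}x z'' e m1 _ IH] cx H.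
  rewrite add1n; apply: (RunsStep (C := loop) (d := d) (s := s) _ m1 H).
  by rewrite /= /loop_tr e cx.
rewrite addSn; apply: (RunsStep (C := loop) (d := d) (s := s) _ m1 (IH cx H)).
by rewrite /= /loop_tr e.
Qed.

Lemma rn_loop_cont n z x z1 m y z2 :
  rn C n z x z1 -> cont x -> rn loop m z1 y z2 -> rn loop (n + m) z y z2.
Proof. exact: runs_loop_cont. Qed.
End Loop.

Notation "C1 ;; C2" := (bind C1 (fun=> C2)) (at level 61, right associativity).

Definition ret (x : cell) : mach := @Mach unit tt (fun _ s => (inr x, s, Sm)).
Definition rd : mach := @Mach unit tt (fun _ s => (inr s, s, Sm)).
Definition wr (x : cell) : mach := @Mach unit tt (fun _ s => (inr None, x, Sm)).
Definition stepR : mach := @Mach unit tt (fun _ s => (inr None, s, Rm)).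
Definition skipR : mach := @Mach unit tt
  (fun _ s => (if s is None then inr None else inl tt, s, Rm)).
Definition skipL : mach := @Mach bool false
  (fun q s => if q then (if s is None then (inr None, s, Sm) else (inl true, s, Lm))
              else (inl true, s, Lm)).
Definition ins (c : cell) : mach := @Mach cell c
  (fun c s => (if s is None then inr None else inl s, c, Rm)).
Definition del : mach := @Mach (option (option cell)) None
  (fun q s => match q with
    | None => (inl (Some None), s, Rm)
    | Some None => (inl (Some (Some s)), s, Lm)
    | Some (Some c) => (if c is None then inr None else inl None, c, Rm)
    end).
Fixpoint rept (C : mach) n : mach :=
  if n is n'.+1 then C ;; rept C n' else ret None.

Definition blk (w : stk) : seq cell := rcons (map Some w) None.
Definition tape (ws : seq stk) : seq cell := flatten (map blk ws).
Arguments tape : simpl never.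

Lemma size_blk w : size (blk w) = (size w).+1.
Proof. by rewrite size_rcons size_map. Qed.

Lemma tape_cat ws1 ws2 : tape (ws1 ++ ws2) = tape ws1 ++ tape ws2.
Proof. by rewrite /tape map_cat flatten_cat. Qed.

Lemma tape_cons w ws : tape (w :: ws) = blk w ++ tape ws.
Proof. by []. Qed.

Lemma rn_ret x l r : rn (ret x) 1 (l, r) x (l, head None r :: behead r).
Proof. by apply: RunsExit => /=. Qed.

Lemma rn_rd l r : rn rd 1 (l, r) (head None r) (l, head None r :: behead r).
Proof. by apply: RunsExit => /=. Qed.

Lemma rn_wr x l r : rn (wr x) 1 (l, r) None (l, x :: behead r).
Proof. by apply: RunsExit => /=. Qed.

Lemma rn_stepR l r : rn stepR 1 (l, r) None (head None r :: l, behead r).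
Proof. by apply: RunsExit => /=. Qed.

Lemma rn_skipR w l r : rn skipR (size w).+1 (l, blk w ++ r) None (rev (blk w) ++ l, r).
Proof.
rewrite /rn /blk; elim: w l => [|a w IH] l /=.
  by apply: RunsExit.
apply: (RunsStep (C := skipR) (q1 := tt) (s := Some a) (d := Rm)) => //.
by rewrite rev_cons (cat_rcons (Some a)); apply: IH.
Qed.

Lemma rn_skipL w l x r : rn skipL (size w).+2 (rev (map Some w) ++ None :: l, x :: r) None
   (l, None :: map Some w ++ x :: r).
Proof.
have H : forall u y r, runs (C := skipL) (size u).+2 true
   (rev (map Some (belast y u)) ++ None :: l, Some (last y u) :: r) None
   (l, None :: map Some (y :: u) ++ r) .
  move=> u; elim/last_ind: u => [|u z IH] y {}r.
    apply: (RunsStep (C := skipL) (q1 := true) (s := Some y) (d := Lm)) => //=.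
    by apply: RunsExit.
  rewrite last_rcons size_rcons belast_rcons map_cons rev_cons.
  apply: (RunsStep (C := skipL) (q1 := true) (s := Some z) (d := Lm)
     (z1 := (rev (map Some (belast y u)) ++ None :: l, Some (last y u) :: Some z :: r))) => //.
    rewrite -rev_cons -map_cons lastI map_rcons rev_rcons /=; by [].
  by rewrite -rcons_cons map_rcons cat_rcons; apply: IH.
rewrite /rn; case: w => [|y u].
  apply: (RunsStep (C := skipL) (q1 := true) (s := x) (d := Lm)) => //=.
  by apply: RunsExit.
apply: (RunsStep (C := skipL) (q1 := true) (s := x) (d := Lm)
   (z1 := (rev (map Some (belast y u)) ++ None :: l, Some (last y u) :: x :: r))) => //.
  by rewrite lastI map_rcons rev_rcons.
exact: H.
Qed.

Lemma rn_ins c w l r : rn (ins c) (size w).+1 (l, blk w ++ r) None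
   (rev (c :: map Some w) ++ l, r).
Proof.
rewrite /rn /blk; have H : forall c1 l, runs (C := ins c) (size w).+1 c1
    (l, rcons (map Some w) None ++ r) None (rev (c1 :: map Some w) ++ l, r).
  elim: w => [|a w IH] c1 {}l; first by apply: RunsExit.
  apply: (RunsStep (C := ins c) (s := c1) (d := Rm) (q1 := Some a)
    (z1 := (c1 :: l, map Some w ++ None :: r))) => //=; first by rewrite cat_rcons.
  by have := IH (Some a) (c1 :: l); rewrite (rev_cons c1) !cat_rcons.
exact: H.
Qed.

Lemma rn_del x w l r : rn del (3 * (size w).+1) (l, x :: blk w ++ r) None
   (rev (blk w) ++ l, None :: r).
Proof.
rewrite /rn /blk; elim: w x l => [|a w IH] x l /=.
  apply: (RunsStep (C := del) (q1 := Some None) (s := x) (d := Rm)) => //.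
  apply: (RunsStep (C := del) (q1 := Some (Some None)) (s := None) (d := Lm)) => //.
  by apply: RunsExit.
rewrite mulnS.
apply: (RunsStep (C := del) (q1 := Some None) (s := x) (d := Rm)) => //.
apply: (RunsStep (C := del) (q1 := Some (Some (Some a))) (s := Some a) (d := Lm)) => //.
apply: (RunsStep (C := del) (q1 := None) (s := Some a) (d := Rm)) => //=.
by rewrite rev_cons (cat_rcons (Some a)); apply: IH.
Qed.

Definition padr (r : seq cell) := head None r :: behead r.

Lemma padr_blk w r : padr (blk w ++ r) = blk w ++ r.
Proof. by rewrite /padr /blk; case: w. Qed.

Lemma rn_skipsR ws l r :
  exists2 T, T <= size (tape ws) + 1 &
  rn (rept skipR (size ws)) T (l, tape ws ++ r) None (rev (tape ws) ++ l, padr r).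
Proof.
elim: ws l => [|w ws IH] l; first by exists 1 => //; apply: rn_ret.
have [T T1 H] := IH (rev (blk w) ++ l).
exists ((size w).+1 + T); first by rewrite tape_cons size_cat size_blk; lia.
apply: rn_bind; first by rewrite tape_cons -catA; apply: rn_skipR.
by rewrite tape_cons rev_cat -catA.
Qed.

Definition ltape (ws : seq stk) : seq cell :=
  flatten [seq None :: map Some w | w <- ws].

Lemma ltape_rcons ws w : ltape (rcons ws w) = ltape ws ++ None :: map Some w.
Proof. by rewrite /ltape map_rcons flatten_rcons. Qed.

Lemma tape_ltape ws : None :: tape ws = rcons (ltape ws) None.
Proof.
elim: ws => // w ws IH; rewrite tape_cons /blk cat_rcons IH.
by rewrite /ltape /= rcons_cat.
Qed.

Lemma ltape_rcons0 ws : ltape (rcons ws [::]) = None :: tape ws.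
Proof. by rewrite ltape_rcons cats1 -tape_ltape. Qed.

Lemma size_ws_tape ws : size ws <= size (tape ws).
Proof. by elim: ws => // w ws IH; rewrite tape_cons size_cat size_blk /=; lia. Qed.

Lemma rn_skipsL ws l r :
  exists2 T, T <= 2 * size (tape ws) + 1 &
  rn (rept skipL (size ws)) T (rev (ltape ws) ++ l, None :: r) None
    (l, ltape ws ++ None :: r).
Proof.
elim/last_ind: ws r => [|ws w IH] r; first by exists 1 => //; apply: rn_ret.
have [T T1 H] := IH (map Some w ++ None :: r).
exists ((size w).+2 + T).
  by rewrite -cats1 tape_cat size_cat tape_cons size_cat size_blk; lia.
rewrite size_rcons; apply: rn_bind.
  rewrite ltape_rcons rev_cat rev_cons cat_rcons -catA /=; exact: rn_skipL.
by move: H; rewrite ltape_rcons -catA.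
Qed.

Lemma rn_inss ws l r :
  exists2 T, T <= size (tape ws) + 1 &
  rn (rept (ins None) (size ws)) T (l, tape ws ++ r) None
    (rev (ltape ws) ++ l, padr r).
Proof.
elim: ws l => [|w ws IH] l; first by exists 1 => //; apply: rn_ret.
have [T T1 H] := IH (rev (None :: map Some w) ++ l).
exists ((size w).+1 + T); first by rewrite tape_cons size_cat size_blk; lia.
apply: rn_bind; first by rewrite tape_cons -catA; apply: rn_ins.
have -> : ltape (w :: ws) = (None :: map Some w) ++ ltape ws by [].
by rewrite rev_cat -catA.
Qed.

Lemma rn_dels x w ws l r :
  exists2 T, T <= 3 * size (tape (w :: ws)) + 1 &
  rn (rept del (size ws).+1) T (l, x :: tape (w :: ws) ++ r) None
    (rev (tape (w :: ws)) ++ l, None :: r).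
Proof.
elim: ws x w l => [|w' ws IH] x w l.
  exists (3 * (size w).+1 + 1).
    by rewrite tape_cons size_cat size_blk /=; lia.
  apply: rn_bind; first by rewrite tape_cons -catA; apply: rn_del.
  by rewrite tape_cons rev_cat -catA; apply: rn_ret.
have [T T1 H] := IH None w' (rev (blk w) ++ l).
exists (3 * (size w).+1 + T); first by rewrite tape_cons size_cat size_blk; lia.
apply: rn_bind; first by rewrite (tape_cons w (w' :: ws)) -catA; apply: rn_del.
by rewrite (tape_cons w (w' :: ws)) rev_cat -catA.
Qed.

Section Stacks.
Variable K : nat.

Definition push i x : mach :=
  rept skipR i ;; ins (Some x) ;; rept (ins None) (K - i.+1) ;; wr None ;;
  rept skipL K ;; stepR.

Definition pop i : mach :=
  rept skipR i ;; bind rd (fun s =>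
    if s is None then rept skipL i.+1 ;; stepR ;; ret None
    else rept del (K - i) ;; rept skipL K.+1 ;; stepR ;; ret s).

Lemma rn_push pre w post x r :
  size pre + (size post).+1 = K ->
  exists j T, T <= 20 * (size (tape (pre ++ w :: post))).+1 /\
  rn (push (size pre) x) T ([:: None], tape (pre ++ w :: post) ++ nseq r None) None
    ([:: None], tape (pre ++ (x :: w) :: post) ++ nseq j None).
Proof.
move=> eK; set N := nseq r _.
have [T1 lT1 H1] := rn_skipsR pre [:: None] (blk w ++ tape post ++ N).
have [T2 lT2 H2] := rn_inss post (rev (Some x :: map Some w) ++ rev (tape pre) ++ [:: None]) N.
have [T3 lT3 H3] := rn_skipsL (pre ++ (x :: w) :: post) [::] (nseq r.-1 None).
exists r.-1; exists (T1 + ((size w).+1 + (T2 + (1 + (T3 + 1))))); split.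
  have := size_ws_tape (pre ++ w :: post).
  move: lT1 lT2 lT3; rewrite !tape_cat !tape_cons !size_cat !size_blk /= .
  lia.
apply: rn_bind; first by rewrite tape_cat tape_cons -!catA; apply: H1.
apply: rn_bind; first by rewrite padr_blk; apply: rn_ins.
apply: rn_bind; first by rewrite (_ : K - _ = size post); [apply: H2 | lia].
apply: rn_bind; first by apply: rn_wr.
have e1 : rev (ltape post) ++ rev (Some x :: [seq Some i | i <- w]) ++
    rev (tape pre) ++ [:: None] = rev (ltape (pre ++ (x :: w) :: post)) ++ [::].
  rewrite cats0 /ltape map_cat flatten_cat -/(ltape pre) /= -/(ltape post).
  rewrite -!cat_cons !catA -[in RHS]cat_rcons -tape_ltape.
  by rewrite !rev_cat !rev_cons -!cats1 -!catA.
rewrite e1; apply: rn_bind.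
  have -> : None :: behead (padr N) = None :: nseq r.-1 None.
    by rewrite /N; case: (r).
  rewrite -[X in rept _ X](_ : size (pre ++ (x :: w) :: post) = K).
    exact: H3.
  by rewrite size_cat.
rewrite -cat_rcons -tape_ltape; exact: rn_stepR.
Qed.

Lemma rn_pop_nil pre post r :
  size pre + (size post).+1 = K ->
  exists T, T <= 20 * (size (tape (pre ++ [::] :: post))).+1 /\
  rn (pop (size pre)) T ([:: None], tape (pre ++ [::] :: post) ++ nseq r None) None
    ([:: None], tape (pre ++ [::] :: post) ++ nseq r None).
Proof.
move=> eK; set N := nseq r _.
have [T1 lT1 H1] := rn_skipsR pre [:: None] (blk [::] ++ tape post ++ N).
have [T3 lT3 H3] := rn_skipsL (rcons pre [::]) [::] (tape post ++ N).
have e1 : tape (pre ++ [::] :: post) ++ N = tape pre ++ None :: tape post ++ N.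
  by rewrite tape_cat tape_cons -!catA.
have e2 : padr (tape pre ++ None :: tape post ++ N) = tape pre ++ None :: tape post ++ N.
  by case: (tape pre).
exists (T1 + (1 + (T3 + (1 + 1)))); split.
  move: lT1 lT3; rewrite -cats1 !tape_cat !tape_cons !size_cat !size_blk /=.
  lia.
apply: rn_bind; first by rewrite e1; apply: H1.
apply: rn_bind; first by rewrite padr_blk; apply: rn_rd.
apply: rn_bind.
  by move: H3; rewrite size_rcons ltape_rcons0 rev_cons -cats1 -catA; apply.
apply: rn_bind; first exact: rn_stepR.
by rewrite e1 -[X in rn _ _ _ _ (_, X)]e2; apply: rn_ret.
Qed.

Lemma rn_pop_cons pre w post x r :
  size pre + (size post).+1 = K ->
  exists j T, T <= 20 * (size (tape (pre ++ (x :: w) :: post))).+1 /\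
  rn (pop (size pre)) T ([:: None], tape (pre ++ (x :: w) :: post) ++ nseq r None)
    (Some x) ([:: None], tape (pre ++ w :: post) ++ nseq j None).
Proof.
move=> eK; set N := nseq r _.
have [T1 lT1 H1] := rn_skipsR pre [:: None] (blk (x :: w) ++ tape post ++ N).
have [T2 lT2 H2] := rn_dels (Some x) w post (rev (tape pre) ++ [:: None]) N.
have [T3 lT3 H3] := rn_skipsL (rcons (pre ++ w :: post) [::]) [::] N.
exists r.+1; exists (T1 + (1 + (T2 + (T3 + (1 + 1))))); split.
  have := size_ws_tape (pre ++ w :: post).
  move: lT1 lT2 lT3; rewrite -cats1 !tape_cat !tape_cons !size_cat !size_blk /= .
  lia.
apply: rn_bind; first by rewrite tape_cat tape_cons -!catA; apply: H1.
apply: rn_bind; first by rewrite padr_blk; apply: rn_rd.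
apply: rn_bind.
  by move: H2; rewrite (_ : (size post).+1 = K - size pre) ?tape_cons -?catA; [apply | lia].
have e1 : rev (blk w ++ tape post) ++ rev (tape pre) ++ [:: None] =
   rev (ltape (rcons (pre ++ w :: post) [::])) ++ [::].
  rewrite cats0 ltape_rcons0 rev_cons -cats1 tape_cat rev_cat -?catA.
  by rewrite rev_cat tape_cons rev_cat -!catA.
apply: rn_bind.
  rewrite e1 (_ : K.+1 = size (rcons (pre ++ w :: post) [::])); first exact: H3.
  by rewrite size_rcons size_cat eK.
apply: rn_bind; first exact: rn_stepR.
have -> : behead (ltape (rcons (pre ++ w :: post) [::]) ++ None :: N) =
   tape (pre ++ w :: post) ++ None :: N.
  by rewrite ltape_rcons0.
have -> : head None (ltape (rcons (pre ++ w :: post) [::]) ++ None :: N) = None.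
  by rewrite ltape_rcons0.
have e2 : padr (tape (pre ++ w :: post) ++ None :: N) = tape (pre ++ w :: post) ++ None :: N.
  by case: (tape _).
by rewrite -[X in rn _ _ _ _ (_, X)]e2; apply: rn_ret.
Qed.
End Stacks.

Definition nstk : nat := 32.
Definition state := nat -> stk.
Definition upd (T : Type) (s : nat -> T) (i : nat) (v : T) : nat -> T :=
  fun j => if j == i then v else s j.

Definition tapeS (s : state) : seq cell := tape [seq s i | i <- iota 0 nstk].
Definition sz (s : state) : nat := size (tapeS s).

(* [n] counts pushes and pops; each costs one sweep over a tape of length at
   most [sz s + n]. The [nseq]s absorb blanks written beyond the last stack. *)
Definition exec (C : mach) (s : state) (n : nat) (x : cell) (s' : state) : Prop :=
  forall r, exists r' T, [/\ T <= n * (40 * (sz s + n)), sz s' <= sz s + n &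
   rn C T ([:: None], tapeS s ++ nseq r None) x ([:: None], tapeS s' ++ nseq r' None)].

Lemma iota_split i : i < nstk -> iota 0 nstk = iota 0 i ++ i :: iota i.+1 (nstk - i.+1).
Proof.
move=> h; have {1}-> : nstk = i + (nstk - i.+1).+1 by lia.
by rewrite iotaD add0n.
Qed.

Lemma map_upd_out T (s : nat -> T) i v (js : seq nat) :
  i \notin js -> [seq upd s i v j | j <- js] = [seq s j | j <- js].
Proof.
by move=> h; apply/eq_in_map => j hj; rewrite /upd; case: eqP hj h => // -> ->.
Qed.

Lemma tapeS_split s i : i < nstk -> exists pre post,
  [/\ size pre = i, size pre + (size post).+1 = nstk,
   tapeS s = tape (pre ++ s i :: post) &
   forall v, tapeS (upd s i v) = tape (pre ++ v :: post)].
Proof.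
move=> h; exists [seq s j | j <- iota 0 i], [seq s j | j <- iota i.+1 (nstk - i.+1)].
rewrite !size_map !size_iota; split=> //; first lia.
  by rewrite /tapeS (iota_split h) map_cat.
move=> v; rewrite /tapeS (iota_split h) map_cat /= !map_upd_out ?mem_iota //; try lia.
by rewrite /upd eqxx.
Qed.

Lemma exec_push s i v : i < nstk ->
  exec (push nstk i v) s 1 None (upd s i (v :: s i)).
Proof.
move=> h r; have [pre [post [e1 e2 e3 e4]]] := tapeS_split s h.
have [j [T [h1 h2]]] := rn_push (s i) v r e2.
exists j, T; rewrite /sz e4 e3; split.
- by move: h1; lia.
- by rewrite !tape_cat !tape_cons !size_cat !size_blk /=; lia.
- by rewrite -{1}e1.
Qed.

Definition otop (w : stk) : cell := if w is a :: _ then Some a else None.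

Lemma exec_pop s i : i < nstk ->
  exec (pop nstk i) s 1 (otop (s i)) (upd s i (behead (s i))).
Proof.
move=> h r; have [pre [post [e1 e2 e3 e4]]] := tapeS_split s h.
rewrite /sz e4 e3; case: (s i) => [|a w] /=.
  have [T [h1 h2]] := rn_pop_nil r e2.
  by exists r, T; split; [move: h1; lia | lia | rewrite -e1].
have [j [T [h1 h2]]] := rn_pop_cons w a r e2.
exists j, T; split; [by move: h1; lia | | by rewrite -e1].
by rewrite !tape_cat !tape_cons !size_cat !size_blk /=; lia.
Qed.

Lemma exec_ret s x : exec (ret x) s 1 x s.
Proof.
move=> r; exists r, 1; split; [lia | lia |].
have {2}-> : tapeS s ++ nseq r None = padr (tapeS s ++ nseq r None).
  by rewrite /tapeS /=; case: (s 0).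
exact: rn_ret.
Qed.

Lemma exec_cost n m (a b : nat) : n * (40 * (a + n)) + m * (40 * (b + m)) <=
  (n + m) * (40 * (a + (n + m))) + m * (40 * (b - (a + n))).
Proof.
case: (leqP b (a + n)) => h.
  have : m * (40 * (b + m)) <= m * (40 * (a + n + m)) by rewrite leq_mul2l; lia.
  nia.
nia.
Qed.

Lemma exec_bind C k s n x s1 m y s2 :
  exec C s n x s1 -> exec (k x) s1 m y s2 -> exec (bind C k) s (n + m) y s2.
Proof.
move=> h1 h2 r; have [r1 [T1 [a1 b1 c1]]] := h1 r; have [r2 [T2 [a2 b2 c2]]] := h2 r1.
exists r2, (T1 + T2); split; [|lia|exact: rn_bind c1 c2].
by have := exec_cost n m (sz s) (sz s1); rewrite (eqP b1) muln0 muln0 addn0; lia.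
Qed.

Lemma exec_loop_exit C (cont : pred cell) s n x s' :
  exec C s n x s' -> ~~ cont x -> exec (loop C cont) s n x s'.
Proof.
move=> h c r; have [r1 [T1 [a1 b1 c1]]] := h r.
by exists r1, T1; split => //; apply: rn_loop_exit.
Qed.

Lemma exec_loop_cont C (cont : pred cell) s n x s1 m y s2 :
  exec C s n x s1 -> cont x -> exec (loop C cont) s1 m y s2 ->
  exec (loop C cont) s (n + m) y s2.
Proof.
move=> h1 c h2 r; have [r1 [T1 [a1 b1 c1]]] := h1 r; have [r2 [T2 [a2 b2 c2]]] := h2 r1.
exists r2, (T1 + T2); split; [|lia|exact: rn_loop_cont c1 c c2].
by have := exec_cost n m (sz s) (sz s1); rewrite (eqP b1) muln0 muln0 addn0; lia.
Qed.

Lemma exec_le C s n m x s' : n <= m -> exec C s n x s' -> exec C s m x s'.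
Proof.
move=> h H r; have [r1 [T1 [a1 b1 c1]]] := H r.
exists r1, T1; split=> //; last lia.
by apply: leq_trans a1 _; apply: leq_mul => //; lia.
Qed.

(* The start state of the machine is forced to be [ord0], so it is made to
   behave like the code of [cq0 C]. *)
Section Machine.
Variable C : mach.
Let N := #|cQ C|.

Definition sym_of (c : cell) : sym :=
  match c with None => Blank | Some None => Sep | Some (Some b) => if b then B1 else B0 end.
Definition of_sym (c : sym) : cell :=
  match c with Blank => None | Sep => Some None | B0 => Some (Some false)
  | B1 => Some (Some true) end.

Lemma sym_ofK : cancel sym_of of_sym. Proof. by case=> [[[]|]|]. Qed.

Definition code_st (q : cQ C) : 'I_N.+2 := inord (enum_rank q).+1.
Definition dec_st (i : 'I_N.+2) : cQ C :=
  if (i : nat) is j.+1 then (if insub j is Some k then enum_val (A := cQ C) k else cq0 C)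
  else cq0 C.

Lemma code_val q : code_st q = (enum_rank q).+1 :> nat.
Proof. by rewrite inordK // !ltnS ltnW // ltn_ord. Qed.

Lemma code_stK : cancel code_st dec_st.
Proof.
move=> q; rewrite /dec_st code_val.
case: insubP => [u _ eu|]; last by rewrite ltn_ord.
by rewrite (_ : u = enum_rank q) ?enum_rankK //; apply: val_inj.
Qed.

Lemma code_max q : code_st q != ord_max.
Proof.
by rewrite -val_eqE /= code_val eqSS neq_ltn ltn_ord.
Qed.

Definition toTM : TM := @MkTM N (fun i c =>
  let: (o, s, d) := ctr (dec_st i) (of_sym c) in
  (match o with inl q => code_st q | inr _ => ord_max end, sym_of s, d)).

Local Open Scope ring_scope.

Definition tape_rep (l r : seq cell) (hd : int) (tp : int -> sym) : Prop :=
  hd = (size l)%:Z - 1 /\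
  forall i : nat, tp (i%:Z - 1) = sym_of (nth None (rev l ++ r) i).

Lemma tape_rep_head l r hd tp : tape_rep l r hd tp -> of_sym (tp hd) = head None r.
Proof.
move=> [-> ->]; rewrite sym_ofK nth_cat size_rev ltnn subnn; by case: r.
Qed.

Lemma tape_rep_mv d s l r l' r' hd tp : tape_rep l r hd tp -> mv d s l r = Some (l', r') ->
  tape_rep l' r' (hd + dir_int d) (fun z => if z == hd then sym_of s else tp z).
Proof.
move=> [-> h] hm.
have e : forall i : nat, (if i%:Z - 1 == (size l)%:Z - 1 then sym_of s else tp (i%:Z - 1)) =
    sym_of (nth None (rev l ++ s :: behead r) i).
  move=> i; rewrite h (inj_eq (addIr _)) eqz_nat !nth_cat size_rev.
  case: ltngtP => // hi; last by rewrite hi subnn.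
  by rewrite (_ : i - size l = (i - size l).-1.+1)%N; [case: (r) => //=; rewrite nth_nil|lia].
case: d hm => /=; [case: l h e => // a l h e [<- <-] | move=> [<- <-] | move=> [<- <-]].
- split=> [|i]; first by rewrite /=; lia.
  by rewrite -cat_rcons -rev_cons; apply: e.
- split=> [|i]; first by rewrite /=; lia.
  by rewrite rev_cons cat_rcons; apply: e.
- by split=> [|i]; [rewrite addr0 | apply: e].
Qed.

Lemma toTM_runs n q z x z' : runs (C := C) n q z x z' ->
  forall (i : 'I_N.+2) hd tp, i != ord_max -> dec_st i = q -> tape_rep z.1 z.2 hd tp ->
  exists hd' tp', iter n (step (M := toTM)) (i, hd, tp) = (ord_max, hd', tp') /\
    tape_rep z'.1 z'.2 hd' tp'.
Proof.
elim=> {n q z x z'} [q l r x s d [l' r'] e m|q l r q1 s d [l1 r1] n x z e m _ IH] i hd tp hi hq hr.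
  exists (hd + dir_int d), (fun z => if z == hd then sym_of s else tp z).
  split; last exact: tape_rep_mv hr m.
  by rewrite /= (negbTE hi) hq (tape_rep_head hr) e.
have [|||hd' [tp' [h1 h2]]] := IH (code_st q1) (hd + dir_int d)
   (fun z => if z == hd then sym_of s else tp z).
- exact: code_max.
- exact: code_stK.
- exact: tape_rep_mv hr m.
exists hd', tp'; split=> //; rewrite iterSr -h1; congr (iter _ _ _).
by rewrite /= (negbTE hi) hq (tape_rep_head hr) e.
Qed.

Lemma iter_halt n (c : config toTM) : c.1.1 = ord_max -> iter n (step (M := toTM)) c = c.
Proof.
by case: c => [[q hd] tp] /= ->; elim: n => //= n ->; rewrite /step eqxx.
Qed.

Definition init_state (inp : stk) : state := upd (fun=> [::]) 0 inp.

Lemma tapeS_init inp : tapeS (init_state inp) = map Some inp ++ nseq nstk None.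
Proof. by rewrite /tapeS /= /tape /= /blk -cats1 -catA. Qed.

Lemma init_rep inp : tape_rep [:: None] (tapeS (init_state inp)) 0
  (init_config toTM (map (fun a => sym_of (Some a)) inp)).2.
Proof.
rewrite tapeS_init; have hZ j : nth None (nseq nstk (None : cell)) j = None.
  by rewrite nth_nseq if_same.
move: (nseq _ _) hZ => Z hZ; split=> // -[|i] //.
rewrite (_ : i.+1%:Z - 1 = i%:Z); last lia.
rewrite /= nth_cat size_map; case: ltnP => h.
  by rewrite !(nth_map None).
by rewrite nth_default ?size_map // hZ.
Qed.

Lemma take_nonblank_map (w : stk) s :
  take_nonblank (map (fun a => sym_of (Some a)) w ++ Blank :: s) =
  map (fun a => sym_of (Some a)) w.
Proof. by elim: w => // [[[]|] w] /= ->. Qed.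

Lemma toTM_correct inp n x s' T : exec C (init_state inp) n x s' -> (0 < n)%N ->
  (n * (40 * (size inp + nstk + n)) <= T)%N ->
  let inp' := map (fun a => sym_of (Some a)) inp in
  halts_within toTM T inp' /\ tm_output toTM T inp' = map (fun a => sym_of (Some a)) (s' 0%N).
Proof.
move=> h n0 hT inp'.
have szi : sz (init_state inp) = (size inp + nstk)%N.
  by rewrite /sz tapeS_init size_cat size_map size_nseq.
have [r' [m [hm hs hrn]]] := h 0%N; rewrite cats0 szi in hm hs hrn.
have [hd' [tp' [e1 [_ e2]]]] := toTM_runs hrn (i := ord0)
  (isT : ord0 != ord_max :> 'I_N.+2) erefl (init_rep inp).
have e3 : run toTM T inp' = (ord_max, hd', tp').
  rewrite /run (_ : T = T - m + m)%N; last lia.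
  by rewrite iterD e1 iter_halt.
split; first by rewrite /halts_within e3.
rewrite /tm_output e3 /=.
set L := (T + size inp')%N; rewrite /= in e2.
have e4 : forall i : nat, tp' (Posz i) = sym_of (nth None (tapeS s' ++ nseq r' None) i).
  by move=> i; rewrite -(e2 i.+1); congr tp'; lia.
have [t et] : exists t, tapeS s' ++ nseq r' None = map Some (s' 0%N) ++ None :: t.
  by rewrite /tapeS /= tape_cons /blk cat_rcons -catA /=; eexists.
have hL : (size (s' 0%N) < L)%N.
  have : (size (s' 0%N) < sz s')%N.
    by rewrite /sz /tapeS tape_cons size_cat size_blk; lia.
  rewrite /L /inp' size_map; move: hs; nia.
have -> : L = (size (s' 0%N) + (L - size (s' 0%N)).-1.+1)%N by lia.
rewrite iotaD map_cat add0n /= e4 et nth_cat size_map ltnn subnn /=.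
have -> : [seq tp' (Posz i) | i <- iota 0 (size (s' 0%N))] =
  map (fun a => sym_of (Some a)) (s' 0%N).
  rewrite -[in RHS](mkseq_nth None (s' 0%N)) /mkseq -map_comp.
  apply/eq_in_map => i; rewrite mem_iota add0n /= => hi.
  by rewrite e4 et nth_cat size_map hi (nth_map None).
exact: take_nonblank_map.
Qed.
End Machine.

(** * Words of bits *)

Fixpoint bits_fuel (fuel n : nat) : seq bool :=
  if fuel is f.+1 then (if n == 0 then [::] else odd n :: bits_fuel f n./2) else [::].
Definition bits n := bits_fuel n n.
Definition encw (n : nat) : stk := rcons (map Some (bits n)) None.
Fixpoint val2 (w : seq bool) : nat := if w is b :: w' then b + (val2 w').*2 else 0.

Lemma bits_fuelE f n : n <= f -> bits_fuel f n = bits n.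
Proof.
have H g : forall f1 f2 n, n <= g -> n <= f1 -> n <= f2 -> bits_fuel f1 n = bits_fuel f2 n.
  elim: g => [|g IH] [|f1] [|f2] [|k] //= h h1 h2.
  by congr cons; apply: IH; lia.
by move=> h; apply: (H f).
Qed.

Lemma bitsE n : 0 < n -> bits n = odd n :: bits n./2.
Proof.
case: n => // n _; rewrite {1}/bits /= -(@bits_fuelE n) //; lia.
Qed.

Lemma size_bits L n : n < 2 ^ L -> size (bits n) <= L.
Proof.
elim: L n => [|L IH] n; first by case: n.
case: (posnP n) => [-> //|n0] h; rewrite bitsE //= ltnS IH //.
by move: h; rewrite expnS; lia.
Qed.

Lemma bits_canon w : last true w -> w = bits (val2 w).
Proof.
have H u : u != [::] -> last true u -> 0 < val2 u.
  by elim: u => // b [|b' u] IH _ hl; [case: b hl | have := IH isT hl; rewrite /=; lia].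
elim: w => // b w IH hl.
have h0 := H (b :: w) isT hl; rewrite bitsE //=; congr (_ :: _).
  by rewrite oddD odd_double addbF; case: b {hl h0}.
rewrite (_ : _./2 = val2 w); last by case: b {hl h0} => /=; rewrite ?add0n ?doubleK // uphalf_double.
apply: IH; case: w hl {h0} => //.
Qed.

Lemma val2_bits n : val2 (bits n) = n.
Proof.
elim/ltn_ind: n => n IH; case: (posnP n) => [-> //|n0].
by rewrite bitsE //= IH ?odd_double_half //; lia.
Qed.

Lemma val2_cat u w : val2 (u ++ w) = val2 u + 2 ^ size u * val2 w.
Proof.
elim: u => [|b u IH] /=; first by rewrite mul1n.
by rewrite IH expnS doubleD -[in LHS]mul2n; lia.
Qed.

Lemma val2_ub w : val2 w < 2 ^ size w.
Proof. by elim: w => //= b w IH; rewrite expnS; case: b; lia. Qed.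

Fixpoint strip (s : seq bool) : seq bool :=
  if s is false :: s' then strip s' else s.

Lemma size_strip s : size (strip s) <= size s.
Proof. by elim: s => // -[] s IH //=; lia. Qed.

Lemma rev_strip s : rev (strip s) = bits (val2 (rev s)).
Proof.
have -> : val2 (rev s) = val2 (rev (strip s)).
  elim: s => // -[] s IH //=; rewrite -IH rev_cons -cats1 val2_cat /=; lia.
apply: bits_canon; elim: s => // -[] s IH //=.
by rewrite rev_cons last_rcons.
Qed.

Lemma exec_eq C s n x s1 s2 : exec C s n x s1 -> s1 =1 s2 -> exec C s n x s2.
Proof. by move=> h /functional_extensionality <-. Qed.

Global Opaque exec.

Ltac upd_tac := let j := fresh "j" in
  move=> j; rewrite /upd;
  repeat (match goal with |- context [?a == ?b] =>
    lazymatch type of a with nat => case: (eqVneq a b) => [?|?]; subst => //= end end);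
  try match goal with H : is_true (?a != ?a) |- _ => by rewrite eqxx in H end.

Definition isbit (x : cell) := if x is Some (Some _) then true else false.

(* Stacks 1 (a reversed word) and 2 (the carry) are scratch space. *)
Definition popw i : mach :=
  loop (bind (pop nstk i)
    (fun x => if isbit x then push nstk 1 (odflt None x) ;; ret x else ret None)) isbit.

Lemma exec_popw s i w rest : i < nstk -> i != 1 -> s i = rcons (map Some w) None ++ rest ->
  exec (popw i) s (3 * size w + 2) None (upd (upd s i rest) 1 (rev (map Some w) ++ s 1)).
Proof.
move=> hi i1; elim: w s => [|b w IH] s hs.
  apply: exec_loop_exit => //; apply: (exec_bind (n := 1) (m := 1)); first exact: exec_pop.
  rewrite hs /=; apply: exec_eq; first exact: exec_ret.
  by upd_tac.
rewrite (_ : 3 * _ + 2 = (1 + (1 + 1)) + (3 * size w + 2)); last by rewrite /=; lia.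
apply: (exec_loop_cont (x := Some (Some b)) (s1 := upd (upd s i (map Some w ++ None :: rest)) 1 (Some b :: s 1))) => //.
  apply: exec_bind; first exact: exec_pop.
  rewrite hs /= cat_rcons; apply: exec_bind; last exact: exec_ret.
  apply: exec_eq; first exact: exec_push.
  by upd_tac.
apply: exec_eq.
  by apply: IH; rewrite /upd (negbTE i1) eqxx cat_rcons.
move=> j; rewrite /upd /=; case: (j =P 1) => [_|_]; last by case: (j =P i).
by rewrite rev_cons cat_rcons.
Qed.

Definition strip1 : mach :=
  loop (bind (pop nstk 1)
    (fun x => if x is Some (Some true) then push nstk 1 (Some true) ;; ret None else ret x))
  (pred1 (Some (Some false))).

Lemma exec_strip1 s rw : s 1 = map Some rw -> exists x,
  exec strip1 s (2 * size rw + 3) x (upd s 1 (map Some (strip rw))).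
Proof.
elim: rw s => [|[] rw IH] s hs.
- exists None; apply: (@exec_le _ _ 2) => //.
  apply: exec_loop_exit => //; apply: (exec_bind (n := 1) (m := 1)); first exact: exec_pop.
  by rewrite hs; apply: exec_ret.
- exists None; apply: (@exec_le _ _ 3); first lia.
  apply: exec_loop_exit => //; apply: (exec_bind (n := 1) (m := 1 + 1)); first exact: exec_pop.
  rewrite hs /=; apply: exec_bind; last exact: exec_ret.
  by apply: exec_eq; [exact: exec_push | upd_tac].
have [|x hx] := IH (upd s 1 (map Some rw)); first by rewrite /upd.
exists x; apply: (@exec_le _ _ ((1 + 1) + (2 * size rw + 3))); first by rewrite /=; lia.
apply: (exec_loop_cont (x := Some (Some false)) (s1 := upd s 1 (map Some rw))) => [|//|].
  apply: exec_bind; first exact: exec_pop.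
  by rewrite hs /=; apply: exec_ret.
by apply: exec_eq; [exact: hx | upd_tac].
Qed.

Definition pushes (js : seq nat) v : mach := foldr (fun j c => push nstk j v ;; c) (ret None) js.

Lemma exec_pushes js v s : all (fun j => j < nstk) js -> uniq js ->
  exec (pushes js v) s (size js).+1 None (fun j => if j \in js then v :: s j else s j).
Proof.
elim: js s => [|i js IH] s /=; first by move=> _ _; apply: exec_ret.
move=> /andP[hi ha] /andP[hn hu]; rewrite -add1n; apply: exec_bind; first exact: exec_push.
apply: exec_eq; first exact: IH.
by move=> j; rewrite inE /upd; case: (j =P i) => [->|//]; rewrite (negbTE hn).
Qed.

Definition outs (js : seq nat) : mach :=
  loop (bind (pop nstk 1) (fun x => if x is Some v then pushes js v ;; ret x else ret None)) isSome.

Lemma exec_outs js s u : all (fun j => j < nstk) js -> uniq js -> 1 \notin js ->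
  s 1 = u -> exec (outs js) s ((size js + 3) * size u + 2) None
    (fun j => if j == 1 then [::] else if j \in js then rev u ++ s j else s j).
Proof.
move=> ha hu h1; elim: u s => [|v u IH] s hs.
  rewrite muln0; apply: exec_loop_exit => //; apply: (exec_bind (n := 1) (m := 1)); first exact: exec_pop.
  rewrite hs /=; apply: exec_eq; first exact: exec_ret.
  by move=> j; rewrite /upd; case: eqP => //; case: ifP.
rewrite (_ : _ + 2 = (1 + ((size js).+1 + 1)) + ((size js + 3) * size u + 2)); last by rewrite /=; lia.
apply: (exec_loop_cont (x := Some v)) => //.
  apply: exec_bind; first exact: exec_pop.
  rewrite hs /=; apply: exec_bind; last exact: exec_ret.
  exact: exec_pushes.
apply: exec_eq; first by apply: IH; rewrite (negbTE h1) /upd.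
move=> j; rewrite /upd /=; case: (j =P 1) => // _; case: ifP => hj; rewrite hj //.
by rewrite rev_cons cat_rcons.
Qed.

Definition finish js : mach := strip1 ;; pushes js None ;; outs js.

Lemma exec_finish js s rw : all (fun j => j < nstk) js -> uniq js -> 1 \notin js ->
  size js <= 2 -> s 1 = map Some rw ->
  exec (finish js) s (7 * size rw + 10) None
  (fun j => if j == 1 then [::] else if j \in js then encw (val2 (rev rw)) ++ s j else s j).
Proof.
move=> ha hu h1 h2 hs; have [x hx] := exec_strip1 hs.
apply: (@exec_le _ _ ((2 * size rw + 3) + ((size js).+1 + ((size js + 3) * size (map Some (strip rw)) + 2)))).
  have := size_strip rw; rewrite size_map; nia.
apply: exec_bind; first exact: hx.
apply: exec_bind; first exact: exec_pushes.
apply: exec_eq; first by apply: exec_outs; rewrite // (negbTE h1) /upd.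
move=> j; rewrite /upd; case: (j =P 1) => // _; case: ifP => hj; rewrite hj //.
by rewrite -map_rev rev_strip /encw cat_rcons.
Qed.

Definition drop_ i : mach := loop (pop nstk i) isbit.

Lemma exec_drop s i w rest : i < nstk -> s i = rcons (map Some w) None ++ rest ->
  exec (drop_ i) s (size w + 1) (Some None) (upd s i rest).
Proof.
move=> hi; elim: w s => [|b w IH] s hs.
  apply: exec_loop_exit => //; apply: exec_eq.
    by have := exec_pop s hi; rewrite hs /=; apply.
  by upd_tac.
rewrite (_ : _ + 1 = 1 + (size w + 1)); last by rewrite /=; lia.
apply: (exec_loop_cont (x := Some (Some b))) => //.
  by have := exec_pop s hi; rewrite hs; apply.
apply: exec_eq; first by apply: IH; rewrite /upd eqxx.
by upd_tac.
Qed.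

Definition clear_ i : mach := loop (pop nstk i) isSome.

Lemma exec_clear s i : i < nstk ->
  exec (clear_ i) s (size (s i) + 1) None (upd s i [::]).
Proof.
move=> hi; move e : (s i) => u; elim: u s e => [|b u IH] s hs.
  apply: exec_loop_exit => //; apply: exec_eq.
    by have := exec_pop s hi; rewrite hs /=; apply.
  by upd_tac.
rewrite (_ : _ + 1 = 1 + (size u + 1)); last by rewrite /=; lia.
apply: (exec_loop_cont (x := Some b)) => //.
  by have := exec_pop s hi; rewrite hs; apply.
apply: exec_eq; first by apply: IH; rewrite /upd eqxx.
by upd_tac.
Qed.

Section Serial.
Variable f : bool -> bool -> bool -> bool * bool.

Fixpoint ser2 (c : bool) (ys : seq bool) : seq bool * bool :=
  if ys is b :: ys' then
    let r := f false b c in let o := ser2 r.2 ys' in (r.1 :: o.1, o.2)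
  else ([::], c).
Fixpoint ser1 (c : bool) (xs ys : seq bool) : seq bool * bool :=
  if xs is a :: xs' then
    let r := f a (head false ys) c in let o := ser1 r.2 xs' (behead ys) in (r.1 :: o.1, o.2)
  else ([::], c).
Definition ser (c : bool) (xs ys : seq bool) : seq bool * bool :=
  let p := ser1 c xs ys in let q := ser2 p.2 (drop (size xs) ys) in (p.1 ++ q.1, q.2).

Definition fstep a b : mach := bind (pop nstk 2) (fun x =>
  let r := f a b (x == Some (Some true)) in
  push nstk 1 (Some r.1) ;; push nstk 2 (Some r.2)).

Lemma exec_fstep a b c s u : s 2 = Some c :: u ->
  exec (fstep a b) s 3 None
   (upd (upd s 1 (Some (f a b c).1 :: s 1)) 2 (Some (f a b c).2 :: u)).
Proof.
move=> hs; apply: (exec_bind (n := 1) (m := 1 + 1)); first exact: exec_pop.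
have -> : (otop (s 2) == Some (Some true)) = c by rewrite hs; case: c {hs}.
rewrite hs /=; apply: exec_bind; first exact: exec_push.
by apply: exec_eq; [apply: exec_push | upd_tac].
Qed.

Definition ser_loop1 i j : mach :=
  loop (bind (pop nstk i) (fun x => if x is Some (Some a) then
    (bind (pop nstk j) (fun y => if y is Some (Some b) then fstep a b
       else push nstk j None ;; fstep a false)) ;; ret x else ret None)) isbit.
Definition ser_loop2 j : mach :=
  loop (bind (pop nstk j) (fun y => if y is Some (Some b) then fstep false b ;; ret y
       else ret None)) isbit.
Definition binop i j : mach := push nstk 2 (Some false) ;; ser_loop1 i j ;; ser_loop2 j.

Lemma exec_ser_loop2 j s ys r c u : j < nstk -> j != 1 -> j != 2 ->
  s j = rcons (map Some ys) None ++ r -> s 2 = Some c :: u ->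
  exec (ser_loop2 j) s (5 * size ys + 2) None
   (upd (upd (upd s j r) 1 (rev (map Some (ser2 c ys).1) ++ s 1)) 2
      (Some (ser2 c ys).2 :: u)).
Proof.
move=> hj j1 j2; elim: ys s c => [|b ys IH] s c hs hc.
  apply: exec_loop_exit => //; apply: (exec_bind (n := 1) (m := 1)); first exact: exec_pop.
  rewrite hs /=; apply: exec_eq; first exact: exec_ret.
  by upd_tac.
rewrite (_ : _ + 2 = (1 + (3 + 1)) + (5 * size ys + 2)); last by rewrite /=; lia.
apply: (exec_loop_cont (x := Some (Some b))) => //.
  apply: exec_bind; first exact: exec_pop.
  rewrite hs /=; apply: exec_bind; last exact: exec_ret.
  by apply: (@exec_fstep _ _ c _ u); rewrite /upd eq_sym (negbTE j2).
apply: exec_eq.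
  apply: (IH _ (f false b c).2); last by rewrite /upd eqxx.
  by rewrite /upd (negbTE j1) (negbTE j2) eqxx.
move=> k; rewrite /upd /=; case: (k =P 2) => //= _; case: (k =P 1) => //= _.
  by rewrite rev_cons !cat_rcons (eq_sym 1) (negbTE j1).
by case: (k =P j).
Qed.

Lemma exec_ser_loop1 i j s xs ys r1 r2 c u : i < nstk -> i != 1 -> i != 2 ->
  j < nstk -> j != 1 -> j != 2 -> i != j ->
  s i = rcons (map Some xs) None ++ r1 ->
  s j = rcons (map Some ys) None ++ r2 -> s 2 = Some c :: u ->
  exec (ser_loop1 i j) s (7 * size xs + 2) None
   (upd (upd (upd (upd s i r1) j (rcons (map Some (drop (size xs) ys)) None ++ r2)) 1
     (rev (map Some (ser1 c xs ys).1) ++ s 1)) 2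
      (Some (ser1 c xs ys).2 :: u)).
Proof.
move=> hi i1 i2 hj j1 j2 ij.
have neqs := (negbTE i1, negbTE i2, negbTE j1, negbTE j2, negbTE ij,
  etrans (eq_sym 1 i) (negbTE i1), etrans (eq_sym 2 i) (negbTE i2),
  etrans (eq_sym 1 j) (negbTE j1), etrans (eq_sym 2 j) (negbTE j2),
  etrans (eq_sym j i) (negbTE ij)).
elim: xs ys s c => [|a xs IH] ys s c hx hy hc.
  apply: exec_loop_exit => //; apply: (exec_bind (n := 1) (m := 1)); first exact: exec_pop.
  rewrite hx /= drop0; apply: exec_eq; first exact: exec_ret.
  move=> k; rewrite /upd; case: (k =P 2) => [->|_]; first by rewrite eq_sym (negbTE i2).
  case: (k =P 1) => [->|_]; first by rewrite eq_sym (negbTE i1).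
  by case: (k =P j) => [->|_] //; rewrite eq_sym (negbTE ij).
rewrite (_ : 7 * _ + 2 = (1 + (5 + 1)) + (7 * size xs + 2)); last by rewrite /=; lia.
pose r := f a (head false ys) c.
pose s1 := upd (upd (upd (upd s i (map Some xs ++ None :: r1)) j
  (rcons (map Some (behead ys)) None ++ r2)) 1 (Some r.1 :: s 1)) 2 (Some r.2 :: u).
apply: (exec_loop_cont (x := Some (Some a)) (s1 := s1)) => //.
  apply: exec_bind; first exact: exec_pop.
  rewrite hx /= cat_rcons; apply: exec_bind; last exact: exec_ret.
  apply: (@exec_bind _ _ _ 1 _ _ 4); first exact: exec_pop.
  have -> : upd s i (map Some xs ++ None :: r1) j = rcons (map Some ys) None ++ r2.
    by rewrite /upd eq_sym (negbTE ij).
  rewrite /s1 /r; case: ys hy {r s1} => [|b ys] hy /=.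
    apply: (@exec_bind _ _ _ 1 _ _ 3); first exact: exec_push.
    apply: exec_eq.
      apply: (@exec_fstep _ _ c _ u).
      by rewrite /upd !neqs.
    move=> k; rewrite /upd eqxx /= !neqs.
    by case: (k =P 2) => //= _; case: (k =P 1) => //= _; case: (k =P j).
  apply: (@exec_le _ _ 3) => //; apply: exec_eq.
    apply: (@exec_fstep _ _ c _ u).
    by rewrite /upd !neqs.
  by move=> k; rewrite /upd /= !neqs cat_rcons.
apply: exec_eq.
  apply: (IH (behead ys) _ r.2); rewrite /s1 /upd.
  - by rewrite !neqs eqxx cat_rcons.
  - by rewrite !neqs eqxx.
  - by [].
move=> k; rewrite /s1 /upd /=; case: (k =P 2) => //= _; case: (k =P 1) => //= _.
  by rewrite rev_cons cat_rcons.
case: (k =P j) => //= _; first by case: (ys).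
by case: (k =P i).
Qed.

Lemma exec_binop i j s xs ys r1 r2 : i < nstk -> i != 1 -> i != 2 ->
  j < nstk -> j != 1 -> j != 2 -> i != j ->
  s i = rcons (map Some xs) None ++ r1 ->
  upd s i r1 j = rcons (map Some ys) None ++ r2 -> s 1 = [::] -> s 2 = [::] ->
  exec (binop i j) s (7 * size xs + 5 * size ys + 5) None
   (upd (upd (upd (upd s i r1) j r2) 1
     (rev (map Some (ser false xs ys).1))) 2 [:: Some (ser false xs ys).2]).
Proof.
move=> hi i1 i2 hj j1 j2 ij hx hy h1 h2.
apply: (@exec_le _ _ (1 + ((7 * size xs + 2) + (5 * size (drop (size xs) ys) + 2)))).
  by rewrite size_drop; lia.
apply: exec_bind; first exact: exec_push.
rewrite h2; apply: exec_bind.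
  apply: (@exec_ser_loop1 _ _ _ xs ys r1 r2 false [::]) => //.
  - by rewrite /upd (negbTE i2).
  - by move: hy; rewrite /upd (negbTE j2) eq_sym (negbTE ij).
apply: exec_eq.
  apply: (@exec_ser_loop2 _ _ (drop (size xs) ys) r2 (ser1 false xs ys).2 [::]) => //.
  by rewrite /upd (negbTE j1) (negbTE j2) eqxx.
move=> k; rewrite /upd /ser /=; case: (k =P 2) => //= _; case: (k =P 1) => //= _.
  by rewrite map_cat rev_cat h1 cats0.
by case: (k =P j) => //= _; case: (k =P i).
Qed.
End Serial.

Lemma ser_cons f c a xs ys :
  let r := f a (head false ys) c in let o := ser f r.2 xs (behead ys) in
  ser f c (a :: xs) ys = (r.1 :: o.1, o.2).
Proof. by rewrite /ser /= (_ : drop _ (behead ys) = drop (size xs).+1 ys) //; case: ys. Qed.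

Definition fadd (a b c : bool) := (a (+) b (+) c, [|| a && b, a && c | b && c]).
Definition fsub (a b c : bool) := (a (+) b (+) c, (~~ a && (b || c)) || (b && c)).

Lemma ser2_add c ys : let o := ser2 fadd c ys in
  size o.1 = size ys /\ val2 o.1 + 2 ^ size ys * o.2 = val2 ys + c.
Proof.
elim: ys c => [|b ys IH] c /=; first by rewrite mul1n.
have [-> h] := IH ((b && c)); split=> //; move: h; rewrite expnS /=.
by case: b; case: c => /=; lia.
Qed.

Lemma ser_add xs ys : let o := ser fadd false xs ys in
  size o.1 <= size xs + size ys /\ val2 o.1 + 2 ^ size o.1 * o.2 = val2 xs + val2 ys.
Proof.
have H : forall xs ys c, let o := ser fadd c xs ys in
   size o.1 <= size xs + size ys /\ val2 o.1 + 2 ^ size o.1 * o.2 = val2 xs + val2 ys + c.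
  move=> {xs ys}; elim=> [|a xs IH] ys c.
    by rewrite /ser /= drop0; have [-> ->] := ser2_add c ys; split=> //; lia.
  rewrite ser_cons; move: (IH (behead ys) (fadd a (head false ys) c).2).
  move: (ser _ _ _ _) => o [h1 h2]; split; first by move: h1; rewrite /= size_behead; lia.
  rewrite /= expnS -mulnA; move: (2 ^ size o.1 * o.2) h2 => m.
  case: ys {h1 IH} => [|b ys]; case: a; case: c; try case: b; rewrite /= => h; lia.
by have := H xs ys false; rewrite /= addn0.
Qed.

Lemma ser2_sub c ys : let o := ser2 fsub c ys in
  size o.1 = size ys /\ val2 o.1 + val2 ys + c = 2 ^ size ys * o.2.
Proof.
elim: ys c => [|b ys IH] c /=; first by rewrite mul1n.
have := IH (b || c || b && c); set o := (ser2 _ _ _).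
move: o => o [e h]; rewrite e; split=> //; move: h; rewrite expnS -mulnA.
move: (2 ^ size ys * o.2) => m.
by case: b; case: c => /= h; lia.
Qed.

Lemma ser_sub xs ys : let o := ser fsub false xs ys in
  size o.1 <= size xs + size ys /\ val2 o.1 + val2 ys = val2 xs + 2 ^ size o.1 * o.2.
Proof.
have H : forall xs ys c, let o := ser fsub c xs ys in
   size o.1 <= size xs + size ys /\ val2 o.1 + val2 ys + c = val2 xs + 2 ^ size o.1 * o.2.
  move=> {xs ys}; elim=> [|a xs IH] ys c.
    by rewrite /ser /= drop0; have [-> ->] := ser2_sub c ys; split=> //; lia.
  rewrite ser_cons; move: (IH (behead ys) (fsub a (head false ys) c).2).
  move: (ser _ _ _ _) => o [h1 h2]; split; first by move: h1; rewrite /= size_behead; lia.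
  rewrite /= expnS -mulnA; move: (2 ^ size o.1 * o.2) h2 => m.
  case: ys {h1 IH} => [|b ys]; case: a; case: c; try case: b; rewrite /= => h; lia.
by have := H xs ys false; rewrite /= addn0.
Qed.

(** * Programs on lists of numbers *)

Definition st (ls : seq (seq nat)) : state := fun i => flatten (map encw (nth [::] ls i)).

(* All numbers involved are below [2 ^ L], so [m] elementary operations take
   [O(m L)] pushes and pops. *)
Definition hrun (L : nat) (C : mach) (ls : seq (seq nat)) (m : nat) (ls' : seq (seq nat)) :=
  exists x n, n <= m * (100 * L.+1) /\ exec C (st ls) n x (st ls').

Lemma hle L C ls m m' ls' : hrun L C ls m ls' -> m <= m' -> hrun L C ls m' ls'.
Proof.
move=> [x [n [h1 h2]]] h; exists x, n; split=> //.
by apply: leq_trans h1 _; rewrite leq_mul2r h orbT.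
Qed.

Lemma hseq L C1 C2 ls m1 ls1 m2 ls2 :
  hrun L C1 ls m1 ls1 -> hrun L C2 ls1 m2 ls2 -> hrun L (C1 ;; C2) ls (m1 + m2) ls2.
Proof.
move=> [x [n [h1 h2]]] [x' [n' [h1' h2']]]; exists x', (n + n'); split.
  by rewrite mulnDl; lia.
exact: exec_bind h2 h2'.
Qed.

Lemma hret L ls x : hrun L (ret x) ls 1 ls.
Proof. by exists x, 1; split; [lia | apply: exec_ret]. Qed.

Lemma st_cons ls i v r : nth [::] ls i = v :: r ->
  st ls i = encw v ++ flatten (map encw r).
Proof. by rewrite /st => ->. Qed.

Lemma upd_st ls i l : upd (st ls) i (flatten (map encw l)) = st (set_nth [::] ls i l).
Proof.
apply: functional_extensionality => j; rewrite /upd /st nth_set_nth /=.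
by case: (j =P i).
Qed.

Lemma st_set ls i l j : st (set_nth [::] ls i l) j =
  if j == i then flatten (map encw l) else st ls j.
Proof. by rewrite /st nth_set_nth /=; case: eqP. Qed.

Definition finst (js : seq nat) (s : state) v : state :=
  fun j => if j == 1 then [::] else if j \in js then encw v ++ s j else s j.

Definition mov i j : mach := popw i ;; finish [:: j].
Definition cpy i j : mach := popw i ;; finish [:: i; j].

Lemma exec_move_raw i j s w rest : i < nstk -> i != 1 -> j < nstk -> j != 1 ->
  s i = rcons (map Some w) None ++ rest -> s 1 = [::] ->
  exec (mov i j) s (10 * size w + 12) None (finst [:: j] (upd s i rest) (val2 w)).
Proof.
move=> hi i1 hj j1 hs h1.
rewrite (_ : _ + 12 = (3 * size w + 2) + (7 * size (rev w) + 10)); last by rewrite size_rev; lia.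
apply: exec_bind; first exact: (exec_popw hi i1 hs).
apply: exec_eq.
  apply: (exec_finish (rw := rev w)) => //=; rewrite ?hj ?inE //.
  - by rewrite eq_sym.
  - by rewrite /upd /= h1 cats0 map_rev.
by move=> k; rewrite /finst /upd revK; case: (k =P 1).
Qed.

Lemma exec_copy_raw i j s w rest : i < nstk -> i != 1 -> j < nstk -> j != 1 -> i != j ->
  s i = rcons (map Some w) None ++ rest -> s 1 = [::] ->
  exec (cpy i j) s (10 * size w + 12) None (finst [:: i; j] (upd s i rest) (val2 w)).
Proof.
move=> hi i1 hj j1 ij hs h1.
rewrite (_ : _ + 12 = (3 * size w + 2) + (7 * size (rev w) + 10)); last by rewrite size_rev; lia.
apply: exec_bind; first exact: (exec_popw hi i1 hs).
apply: exec_eq.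
  apply: (exec_finish (rw := rev w)) => //=; rewrite ?hi ?hj ?inE ?andbT //.
  - by rewrite !(eq_sym 1) negb_or i1.
  - by rewrite /upd /= h1 cats0 map_rev.
by move=> k; rewrite /finst /upd revK; case: (k =P 1).
Qed.

Lemma finst_st ls j v : j != 1 -> nth [::] ls 1 = [::] ->
  finst [:: j] (st ls) v =1 st (set_nth [::] ls j (v :: nth [::] ls j)).
Proof.
move=> j1 h1 k; rewrite st_set /finst inE.
case: (k =P 1) => [->|_]; first by rewrite eq_sym (negbTE j1) /st h1.
by case: (k =P j) => [->|].
Qed.

Lemma hmove L i j ls v r : i < nstk -> i != 1 -> j < nstk -> j != 1 ->
  nth [::] ls 1 = [::] -> nth [::] ls i = v :: r -> v < 2 ^ L ->
  hrun L (mov i j) ls 1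
    (let l1 := set_nth [::] ls i r in set_nth [::] l1 j (v :: nth [::] l1 j)).
Proof.
move=> hi i1 hj j1 h1 hs /size_bits hv; exists None, (10 * size (bits v) + 12); split; first lia.
apply: exec_eq; first apply: (exec_move_raw (rest := flatten (map encw r))) => //.
- by rewrite /st hs.
- by rewrite /st h1.
rewrite val2_bits upd_st; apply: finst_st => //.
by rewrite nth_set_nth /= eq_sym (negbTE i1).
Qed.

Lemma hcopy L i j ls v r : i < nstk -> i != 1 -> j < nstk -> j != 1 -> i != j ->
  nth [::] ls 1 = [::] -> nth [::] ls i = v :: r -> v < 2 ^ L ->
  hrun L (cpy i j) ls 1 (set_nth [::] ls j (v :: nth [::] ls j)).
Proof.
move=> hi i1 hj j1 ij h1 hs /size_bits hv; exists None, (10 * size (bits v) + 12); split; first lia.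
apply: exec_eq; first apply: (exec_copy_raw (rest := flatten (map encw r))) => //.
- by rewrite /st hs.
- by rewrite /st h1.
move=> k; rewrite val2_bits st_set /finst /upd !inE.
case: (k =P 1) => [->|_]; first by rewrite eq_sym (negbTE j1) /st h1.
case: (k =P i) => [->|_] /=; first by rewrite (negbTE ij) /st hs.
by case: (k =P j) => [->|].
Qed.

Lemma hdrop L i ls v r : i < nstk -> nth [::] ls i = v :: r -> v < 2 ^ L ->
  hrun L (drop_ i) ls 1 (set_nth [::] ls i r).
Proof.
move=> hi hs /size_bits hv; exists (Some None), (size (bits v) + 1); split; first lia.
by rewrite -upd_st; apply: exec_drop => //; rewrite /st hs.
Qed.

Definition addw i j k : mach := binop fadd i j ;;
  bind (pop nstk 2) (fun x => if x is Some c then push nstk 1 c else ret None) ;;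
  finish [:: k].
Definition subw i j k : mach := binop fsub i j ;;
  bind (pop nstk 2) (fun x => if x == Some (Some true) then clear_ 1 else ret None) ;;
  finish [:: k].

Section Arith.
Variables (L i j k : nat) (ls : seq (seq nat)) (x y : nat) (r r2 : seq nat).
Hypotheses (hi : i < nstk) (i1 : i != 1) (i2 : i != 2).
Hypotheses (hj : j < nstk) (j1 : j != 1) (j2 : j != 2) (ij : i != j).
Hypotheses (hk : k < nstk) (k1 : k != 1).
Hypotheses (h1 : nth [::] ls 1 = [::]) (h2 : nth [::] ls 2 = [::]).
Hypotheses (hx : nth [::] ls i = x :: r) (hy : nth [::] ls j = y :: r2).
Hypotheses (bx : x < 2 ^ L) (by_ : y < 2 ^ L).
Let l2 := set_nth [::] (set_nth [::] ls i r) j r2.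

Let l2_1 : nth [::] l2 1 = [::].
Proof. by rewrite /l2 nth_set_nth /= eq_sym (negbTE j1) nth_set_nth /= eq_sym (negbTE i1). Qed.
Let l2_2 : nth [::] l2 2 = [::].
Proof. by rewrite /l2 nth_set_nth /= eq_sym (negbTE j2) nth_set_nth /= eq_sym (negbTE i2). Qed.

Let binopP f : exec (binop f i j) (st ls) (7 * size (bits x) + 5 * size (bits y) + 5) None
   (upd (upd (st l2) 1 (rev (map Some (ser f false (bits x) (bits y)).1))) 2
      [:: Some (ser f false (bits x) (bits y)).2]).
Proof.
rewrite /l2 -!upd_st; apply: exec_binop => //; rewrite /st ?h1 ?h2 ?hx //.
by rewrite /upd eq_sym (negbTE ij) hy.
Qed.

Let sx := size_bits bx.
Let sy := size_bits by_.

Lemma hadd : hrun L (addw i j k) ls 1 (set_nth [::] l2 k (x + y :: nth [::] l2 k)).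
Proof.
have [hs hv] := ser_add (bits x) (bits y); rewrite !val2_bits in hv.
move: (binopP fadd) hs hv; move: (ser _ _ _ _) => o hb hs hv.
exists None, ((7 * size (bits x) + 5 * size (bits y) + 5) + ((1 + 1) + (7 * (size o.1).+1 + 10))).
split; first lia.
apply: exec_bind; first exact: hb.
apply: exec_bind.
  apply: exec_bind; first exact: exec_pop.
  rewrite /upd /=; exact: exec_push.
apply: exec_eq.
  rewrite (_ : (size o.1).+1 = size (o.2 :: rev o.1)); last by rewrite /= size_rev.
  apply: exec_finish => //=; rewrite ?hk ?inE 1?eq_sym //.
  by rewrite /upd /= map_rev.
rewrite rev_cons revK -cats1 val2_cat /= addn0 hv.
move=> t; rewrite -(finst_st _ k1 l2_1) /finst /upd.
case: (t =P 1) => //= _; case: (t =P 2) => //= ->.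
by rewrite /st l2_2.
Qed.

Lemma hsub : hrun L (subw i j k) ls 1 (set_nth [::] l2 k (x - y :: nth [::] l2 k)).
Proof.
have [hs hv] := ser_sub (bits x) (bits y); rewrite !val2_bits in hv.
move: (binopP fsub) hs hv; move: (ser _ _ _ _) => o hb hs hv.
have hub := val2_ub o.1.
exists None, ((7 * size (bits x) + 5 * size (bits y) + 5) + ((1 + (size o.1).+1) + (7 * size o.1 + 10))).
split; first lia.
apply: exec_bind; first exact: hb.
pose z := if o.2 then [::] else rev o.1.
apply: (@exec_bind _ _ _ _ None (upd (st l2) 1 (map Some z))).
  apply: exec_bind; first exact: exec_pop.
  rewrite /upd /z /=; case: (o.2) => /=.
    apply: exec_eq.
      apply: (exec_le _ (exec_clear _ _)) => //=.
      by rewrite size_rev size_map addn1.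
    by move=> t; rewrite /upd; case: (t =P 1) => //= _; case: (t =P 2) => //= ->; rewrite /st l2_2.
  apply: (@exec_le _ _ 1) => //; apply: exec_eq; first exact: exec_ret.
  by move=> t; rewrite /upd map_rev; case: (t =P 2) => //= ->; rewrite /st l2_2.
apply: (@exec_le _ _ (7 * size z + 10)).
  by rewrite /z; case: ifP; rewrite ?size_rev /=; lia.
apply: exec_eq.
  by apply: (@exec_finish _ _ z) => //=; rewrite ?hk ?inE 1?eq_sym.
move=> t; rewrite -(finst_st _ k1 l2_1) /finst /upd.
have -> : val2 (rev z) = x - y.
  by rewrite /z; case: (o.2) hv; rewrite ?revK /=; lia.
by case: (t =P 1).
Qed.
End Arith.

Definition pushw (l : stk) i : mach := foldr (fun a c => push nstk i a ;; c) (ret None) l.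
Definition pushc v i : mach := pushw (rev (encw v)) i.

Lemma exec_pushw l i s : i < nstk ->
  exec (pushw l i) s (size l).+1 None (upd s i (rev l ++ s i)).
Proof.
move=> hi; elim: l s => [|a l IH] s /=.
  apply: exec_eq; first exact: exec_ret.
  by move=> k; rewrite /upd; case: (k =P i) => [->|].
rewrite -add1n; apply: exec_bind; first exact: exec_push.
apply: exec_eq; first exact: IH.
move=> k; rewrite /upd eqxx; case: (k =P i) => // _.
by rewrite rev_cons cat_rcons.
Qed.

Lemma hpushc L v i ls : i < nstk -> v < 2 ^ L ->
  hrun L (pushc v i) ls 1 (set_nth [::] ls i (v :: nth [::] ls i)).
Proof.
move=> hi /size_bits hv; exists None, (size (rev (encw v))).+1; split.
  by rewrite size_rev /encw size_rcons size_map; lia.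
apply: exec_eq; first exact: exec_pushw.
by move=> k; rewrite st_set /upd; case: (k =P i) => // _; rewrite revK.
Qed.

Definition ifz i (p q : mach) : mach := bind (pop nstk i)
  (fun x => if x is Some (Some b) then push nstk i (Some b) ;; drop_ i ;; q else p).

Lemma encw_pos v : 0 < v -> encw v = Some (odd v) :: encw v./2.
Proof. by move=> h; rewrite /encw bitsE. Qed.

Lemma upd_upd (s : state) i a b : upd (upd s i a) i b = upd s i b.
Proof. by apply: functional_extensionality => k; rewrite /upd; case: eqP. Qed.

Lemma hifz L i p q ls v r m ls' : i < nstk -> nth [::] ls i = v :: r -> v < 2 ^ L ->
  hrun L (if v == 0 then p else q) (set_nth [::] ls i r) m ls' ->
  hrun L (ifz i p q) ls m.+1 ls'.
Proof.
move=> hi hs hv [x [n [h1 h2]]]; have := size_bits hv.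
case: (posnP v) h2 => [v0|v0].
  move=> /= h2 _; exists x, (1 + n); split; first by rewrite mulSn; lia.
  apply: exec_bind; first exact: exec_pop.
  by rewrite (st_cons hs) v0 /= upd_st.
move=> /= h2 hb; exists x, (1 + (1 + (size (bits v) + 1 + n))).
split; first by rewrite mulSn; lia.
apply: exec_bind; first exact: exec_pop.
rewrite (st_cons hs) encw_pos //=; apply: exec_bind; first exact: exec_push.
apply: exec_bind; last exact: h2.
rewrite upd_upd -upd_st; set s1 := upd _ i (_ :: _).
have -> : upd (st ls) i (flatten (map encw r)) = upd s1 i (flatten (map encw r)).
  by rewrite /s1 upd_upd.
apply: exec_drop => //; rewrite /s1 /upd eqxx.
by rewrite -/(encw v) (encw_pos v0).
Qed.
Definition loopbits i (p0 p1 : mach) : mach := loop (bind (pop nstk i)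
  (fun x => if x is Some (Some b) then (if b then p1 else p0) ;; ret x else ret None)) isbit.

Lemma hloopbits0 L i p0 p1 ls r : i < nstk -> nth [::] ls i = 0 :: r ->
  hrun L (loopbits i p0 p1) ls 1 (set_nth [::] ls i r).
Proof.
move=> hi hs; exists None, (1 + 1); split; first lia.
apply: exec_loop_exit => //; apply: exec_bind; first exact: exec_pop.
by rewrite (st_cons hs) /= upd_st; apply: exec_ret.
Qed.

Lemma hloopbitsS L i p0 p1 ls v r m ls1 m' ls' : i < nstk -> nth [::] ls i = v :: r -> 0 < v ->
  hrun L (if odd v then p1 else p0) (set_nth [::] ls i (v./2 :: r)) m ls1 ->
  hrun L (loopbits i p0 p1) ls1 m' ls' ->
  hrun L (loopbits i p0 p1) ls (m + m').+1 ls'.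
Proof.
move=> hi hs v0 [x [n [h1 h2]]] [x' [n' [h1' h2']]].
exists x', (1 + (n + 1) + n'); split; first by rewrite mulSn mulnDl; lia.
apply: (exec_loop_cont (x := Some (Some (odd v)))); [|by []|exact: h2'].
apply: exec_bind; first exact: exec_pop.
rewrite (st_cons hs) encw_pos //= -[encw _ ++ _]/(flatten (map encw (v./2 :: r))) upd_st.
by apply: exec_bind; [exact: h2 | exact: exec_ret].
Qed.

Definition whilene i (p : mach) : mach := loop (bind (pop nstk i)
  (fun x => if x is Some a then push nstk i a ;; p ;; ret x else ret None)) isSome.

Lemma hwhile0 L i p ls : i < nstk -> nth [::] ls i = [::] ->
  hrun L (whilene i p) ls 1 ls.
Proof.
move=> hi hs; exists None, (1 + 1); split; first lia.
apply: exec_loop_exit => //; apply: exec_bind; first exact: exec_pop.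
have -> : st ls i = [::] by rewrite /st hs.
rewrite /= -[X in upd _ _ X]/(flatten (map encw [::])) upd_st.
apply: exec_eq; first exact: exec_ret.
by move=> k; rewrite st_set; case: (k =P i) => // ->; rewrite /st hs.
Qed.

Lemma hwhileS L i p ls m ls1 m' ls' : i < nstk -> nth [::] ls i != [::] ->
  hrun L p ls m ls1 -> hrun L (whilene i p) ls1 m' ls' ->
  hrun L (whilene i p) ls (m + m').+1 ls'.
Proof.
move=> hi hs [x [n [h1 h2]]] [x' [n' [h1' h2']]].
have [a [u hu]] : exists a u, st ls i = a :: u.
  rewrite /st; case: (nth _ _ _) hs => // v r _ /=.
  by case: (posnP v) => [->|/encw_pos ->] /=; do 2 eexists.
exists x', (1 + (1 + (n + 1)) + n'); split; first by rewrite mulSn mulnDl; lia.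
apply: (exec_loop_cont (x := Some a)); [|by []|exact: h2'].
apply: exec_bind; first exact: exec_pop.
rewrite hu /=; apply: exec_bind; first exact: exec_push.
apply: exec_bind; last exact: exec_ret.
rewrite upd_upd (_ : upd _ _ _ = st ls); first exact: h2.
apply: functional_extensionality => k; rewrite /upd eqxx.
by case: (k =P i) => // ->; rewrite hu.
Qed.

Ltac hstep lem := eapply hseq; [eapply lem; try (by []) | rewrite /=].
Lemma heqr L C ls m ls2 ls' : hrun L C ls m ls2 -> ls2 = ls' -> hrun L C ls m ls'.
Proof. by move=> h <-. Qed.

Lemma hst L C ls m ls2 ls' : hrun L C ls m ls2 -> st ls2 =1 st ls' -> hrun L C ls m ls'.
Proof.
by rewrite /hrun => -[x [n [h1 h2]]] e; exists x, n; split=> //; apply: exec_eq h2 e.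
Qed.

Global Opaque hrun.

Ltac hlast lem := eapply heqr; [eapply lem; try (by []) | by []].

(** * Multiplication, division and expressions *)

Definition dbl : mach := cpy 4 5 ;; addw 4 5 4.
Definition mulX : mach := mov 6 3 ;; mov 6 4 ;; pushc 0 6 ;;
  loopbits 3 dbl (cpy 4 5 ;; addw 6 5 6 ;; dbl) ;; drop_ 4.

Lemma hdbl L l0 l3 y l4 l5 X l7 rest : y.*2 < 2 ^ L ->
  hrun L dbl [:: l0, [::], [::], l3, y :: l4, l5, X, l7 & rest] 2
    [:: l0, [::], [::], l3, y.*2 :: l4, l5, X, l7 & rest].
Proof.
move=> h; have hy : y < 2 ^ L by lia.
by rewrite /dbl -addnn; apply: hle; [hstep hcopy; hlast hadd|].
Qed.

Lemma hmul_loop L l0 X rest v : forall y acc, acc + v * y < 2 ^ L -> (v * y).*2 < 2 ^ L ->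
  y < 2 ^ L -> exists2 y', y' < 2 ^ L &
  hrun L (loopbits 3 dbl (cpy 4 5 ;; addw 6 5 6 ;; dbl))
    [:: l0, [::], [::], [:: v], [:: y], [::], acc :: X, [::] & rest]
    (5 * size (bits v) + 1)
    [:: l0, [::], [::], [::], [:: y'], [::], acc + v * y :: X, [::] & rest].
Proof.
elim/ltn_ind: v => v IH y acc h1 h2 h3.
case: (posnP v) => [v0|v0].
  by subst v; exists y => //; rewrite mul0n addn0 muln0; apply: hloopbits0.
have e := odd_double_half v; have vy : y <= v * y by rewrite leq_pmull.
have hv : v./2 < v by lia.
have ev : (if odd v then acc + y else acc) + v./2 * y.*2 = acc + v * y.
  by rewrite -[in RHS]e; case: (odd v); nia.
have [||| y' hy' H] := IH _ hv y.*2 (if odd v then acc + y else acc).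
- by rewrite ev.
- by move: ev h2; case: (odd v); nia.
- by lia.
exists y' => //; apply: hle.
  apply: (@hloopbitsS _ _ _ _ _ v [::] 4) => //=; last by rewrite -ev; exact: H.
  case: (odd v); last by apply: hle; [apply: hdbl; lia | ].
  have ha : acc < 2 ^ L by lia.
  by apply: (@hle _ _ _ (1 + (1 + 2))) => //; hstep hcopy; hstep hadd; apply: hdbl; lia.
by rewrite (bitsE v0) /=; lia.
Qed.

Lemma hmul L a b l0 x y X rest : x < 2 ^ a -> y < 2 ^ b -> a + b < L ->
  hrun L mulX [:: l0, [::], [::], [::], [::], [::], y :: x :: X, [::] & rest]
    (10 * L.+1) [:: l0, [::], [::], [::], [::], [::], x * y :: X, [::] & rest].
Proof.
move=> hx hy hab.
have hp : (y * x).*2 < 2 ^ L.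
  have : 2 ^ (a + b).+1 <= 2 ^ L by rewrite leq_exp2l.
  by rewrite expnS expnD; nia.
have hp2 : 0 + y * x < 2 ^ L by lia.
have hyL : y < 2 ^ L by apply: leq_trans hy _; rewrite leq_exp2l; lia.
have hxL : x < 2 ^ L by apply: leq_trans hx _; rewrite leq_exp2l; lia.
have hsz := size_bits hyL.
have [y' hy' H] := hmul_loop l0 X rest hp2 hp hxL.
apply: hle.
  hstep hmove; hstep hmove; hstep hpushc; first by rewrite expn_gt0.
  eapply hseq; first exact: H.
  rewrite mulnC; hlast hdrop.
by lia.
Qed.

(* For [d = 0] the long division below yields a quotient with all bits set. *)
Definition hdiv x d := if d == 0 then (2 ^ size (bits x)).-1 else x %/ d.

(* Long division with the shifted divisors d, 2d, 4d, ... kept on a stack: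
   register 5 holds them with the largest on top. *)
Definition divX : mach := mov 6 4 ;; cpy 6 3 ;;
  loopbits 3 (cpy 4 5 ;; cpy 4 7 ;; addw 4 7 4) (cpy 4 5 ;; cpy 4 7 ;; addw 4 7 4) ;;
  drop_ 4 ;; pushc 0 4 ;;
  whilene 5 (cpy 4 7 ;; addw 4 7 4 ;; cpy 5 3 ;; cpy 6 7 ;; subw 3 7 3 ;;
    ifz 3 (mov 5 7 ;; subw 6 7 6 ;; pushc 1 7 ;; addw 4 7 4) (drop_ 5)) ;;
  drop_ 6 ;; mov 4 6.

Fixpoint shifts (d k : nat) : seq nat :=
  if k is k'.+1 then 2 ^ k' * d :: shifts d k' else [::].

Lemma hdiv_loop1 L l0 X rest d v : forall k, 2 ^ (k + size (bits v)) * d < 2 ^ L ->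
  hrun L (loopbits 3 (cpy 4 5 ;; cpy 4 7 ;; addw 4 7 4) (cpy 4 5 ;; cpy 4 7 ;; addw 4 7 4))
    [:: l0, [::], [::], [:: v], [:: 2 ^ k * d], shifts d k, X, [::] & rest]
    (4 * size (bits v) + 1)
    [:: l0, [::], [::], [::], [:: 2 ^ (k + size (bits v)) * d], shifts d (k + size (bits v)),
      X, [::] & rest].
Proof.
elim/ltn_ind: v => v IH k.
case: (posnP v) => [v0|v0].
  by subst v; rewrite muln0 addn0 => h; apply: hloopbits0.
rewrite (bitsE v0) /= addnS -addSn => h.
have hv : v./2 < v by lia.
have H := IH _ hv k.+1 h.
have h2 : 2 ^ k.+1 * d < 2 ^ L.
  by apply: leq_ltn_trans h; rewrite leq_mul2r leq_exp2l // leq_addr orbT.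
have h3 : 2 ^ k * d < 2 ^ L by move: h2; rewrite expnS; lia.
apply: hle.
  apply: (@hloopbitsS _ _ _ _ _ v [::] 3) => //=; last exact: H.
  have -> : (if odd v then (cpy 4 5 ;; cpy 4 7 ;; addw 4 7 4) else
     (cpy 4 5 ;; cpy 4 7 ;; addw 4 7 4)) = (cpy 4 5 ;; cpy 4 7 ;; addw 4 7 4) by case: ifP.
  apply: (@hle _ _ _ (1 + (1 + 1))) => //; hstep hcopy; hstep hcopy.
  rewrite expnS mul2n -addnn mulnDl; hlast hadd.
by lia.
Qed.

Lemma hdiv_loop2 L l0 X rest d k : forall q r, 2 ^ k * d + r < 2 ^ L ->
  2 ^ k * q.+1 <= 2 ^ L ->
  exists q' r', [/\ r' < 2 ^ L, q' < 2 ^ L,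
   (if d == 0 then q'.+1 = 2 ^ k * q.+1 else
     (q' + r' %/ d = 2 ^ k * q + r %/ d /\ (r < 2 ^ k * d -> r' < d))) &
  hrun L (whilene 5 (cpy 4 7 ;; addw 4 7 4 ;; cpy 5 3 ;; cpy 6 7 ;; subw 3 7 3 ;;
    ifz 3 (mov 5 7 ;; subw 6 7 6 ;; pushc 1 7 ;; addw 4 7 4) (drop_ 5)))
    [:: l0, [::], [::], [::], [:: q], shifts d k, r :: X, [::] & rest]
    (12 * k + 1)
    [:: l0, [::], [::], [::], [:: q'], [::], r' :: X, [::] & rest]].
Proof.
elim: k => [|k IH] q r h1 h2.
  exists q, r; split; try lia; last by rewrite muln0; apply: hwhile0.
  case: eqP => // h0; first by rewrite mul1n.
  by rewrite expn0 !mul1n.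
have p0 : 0 < 2 ^ k by rewrite expn_gt0.
move: h1 h2; rewrite expnS => h1 h2.
have hq2 : q + q < 2 ^ L by nia.
have hqL : q < 2 ^ L by lia.
have he : 2 ^ k * d < 2 ^ L by nia.
have hr : r < 2 ^ L by nia.
pose c := 2 ^ k * d <= r.
have [||q' [r' [hr' hq' hE H]]] := IH (q + q + c) (r - c * (2 ^ k * d)).
- by rewrite /c; case: leqP; nia.
- by rewrite /c; case: leqP; nia.
exists q', r'; split=> //.
  move: hE; rewrite /c; case: eqP => d0.
    by rewrite d0 muln0 leq0n /=; nia.
  move=> [hE1 hE2]; have dp : 0 < d by lia.
  split.
    rewrite hE1; case: leqP => hc; rewrite ?mul1n ?mul0n ?subn0; last by nia.
    by have := divnMDl (2 ^ k) (r - 2 ^ k * d) dp; rewrite subnKC //; nia.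
  by move=> h; apply: hE2; case: leqP; lia.
apply: hle.
  apply: (@hwhileS _ _ _ _ 11) => //; last exact: H.
  apply: hle.
    hstep hcopy; hstep hadd; hstep hcopy; hstep hcopy; hstep hsub.
    eapply hifz; try by [].
      by apply: leq_ltn_trans he; lia.
    rewrite /= subn_eq0 -/c.
    instantiate (1 := 1 + (1 + (1 + 1))).
    case: (c) => /=.
      rewrite mul1n; hstep hmove; hstep hsub; hstep hpushc; first by nia.
      by hlast hadd; nia.
    rewrite mul0n addn0 subn0; apply: hle; [hlast hdrop | by []].
  by [].
by lia.
Qed.

Lemma hdivX L a b l0 x d X rest : x < 2 ^ a -> d < 2 ^ b -> a + b < L ->
  hrun L divX [:: l0, [::], [::], [::], [::], [::], d :: x :: X, [::] & rest]
    (30 * L.+1) [:: l0, [::], [::], [::], [::], [::], hdiv x d :: X, [::] & rest].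
Proof.
move=> hx hd hab; have sx := size_bits hx.
have hxL : x < 2 ^ L by apply: leq_trans hx _; rewrite leq_exp2l; lia.
have hdL : d < 2 ^ L by apply: leq_trans hd _; rewrite leq_exp2l; lia.
have p0 : 2 ^ (size (bits x)) <= 2 ^ a by rewrite leq_exp2l.
have p1 : 0 < 2 ^ (size (bits x)) by rewrite expn_gt0.
have p2 : 0 < 2 ^ b by rewrite expn_gt0.
have hL : 2 * (2 ^ a * 2 ^ b) <= 2 ^ L by rewrite -expnD -expnS leq_exp2l.
have hd2 : 2 ^ (0 + size (bits x)) * d < 2 ^ L by rewrite add0n; nia.
have H1 := hdiv_loop1 l0 (x :: X) rest hd2.
rewrite add0n in hd2.
have [||q [r [hr hq hE H2]]] := @hdiv_loop2 L l0 X rest d (size (bits x)) 0 x.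
- by clear H1; nia.
- by nia.
apply: hle.
  hstep hmove; hstep hcopy.
  eapply hseq; first by move: H1; rewrite expn0 mul1n; apply.
  rewrite add0n; hstep hdrop; hstep hpushc; first by rewrite expn_gt0.
  eapply hseq; first exact: H2.
  hstep hdrop.
  have -> : hdiv x d = q.
    move: hE; rewrite /hdiv; case: eqP => d0; first by rewrite muln1 => <-.
    have dp : 0 < d by lia.
    move=> [e1 e2]; rewrite muln0 add0n in e1; rewrite -e1 divn_small ?addn0 //.
    apply: e2; have := val2_ub (bits x); rewrite val2_bits; nia.
  hlast hmove.
have := size_bits hxL; lia.
Qed.

Lemma hdiv_ub x d : hdiv x d <= x.*2.
Proof.
rewrite /hdiv; case: eqP => _; last by apply: leq_trans (leq_div _ _) _; lia.
case: (posnP x) => [-> //|x0]; suff : 2 ^ size (bits x) <= x.*2 by lia.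
elim/ltn_ind: x x0 => x IH x0; rewrite (bitsE x0) /= expnS.
case: (posnP x./2) => [->|h]; first by rewrite /= expn0; lia.
have hx : x./2 < x by lia.
by have := IH _ hx h; lia.
Qed.

Inductive expr := EReg of nat | EMul of expr & expr | EAdd of expr & expr
  | ESub of expr & expr | EDiv of expr & expr.

Fixpoint ecode (e : expr) : mach :=
  match e with
  | EReg i => cpy (8 + i) 6
  | EMul e1 e2 => ecode e1 ;; ecode e2 ;; mulX
  | EAdd e1 e2 => ecode e1 ;; ecode e2 ;; mov 6 3 ;; addw 6 3 6
  | ESub e1 e2 => ecode e1 ;; ecode e2 ;; mov 6 3 ;; subw 6 3 6
  | EDiv e1 e2 => ecode e1 ;; ecode e2 ;; divX
  end.

Fixpoint eval (env : nat -> nat) (e : expr) : nat :=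
  match e with
  | EReg i => env i
  | EMul e1 e2 => eval env e1 * eval env e2
  | EAdd e1 e2 => eval env e1 + eval env e2
  | ESub e1 e2 => eval env e1 - eval env e2
  | EDiv e1 e2 => hdiv (eval env e1) (eval env e2)
  end.

Fixpoint regs (e : expr) : seq nat :=
  match e with
  | EReg i => [:: i]
  | EMul e1 e2 | EAdd e1 e2 | ESub e1 e2 | EDiv e1 e2 => regs e1 ++ regs e2
  end.

Fixpoint weight (e : expr) : nat :=
  match e with
  | EReg i => 1
  | EMul e1 e2 | EAdd e1 e2 | ESub e1 e2 => weight e1 + weight e2
  | EDiv e1 e2 => (weight e1 + weight e2).+1
  end.

Fixpoint nodes (e : expr) : nat :=
  match e with
  | EReg i => 1
  | EMul e1 e2 | EAdd e1 e2 | ESub e1 e2 | EDiv e1 e2 => (nodes e1 + nodes e2).+1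
  end.

Definition envl (rest : seq (seq nat)) (i : nat) : nat := head 0 (nth [::] rest i).

Section Expr.
Variables (L lam : nat) (l0 : seq nat) (rest : seq (seq nat)).
Hypothesis lam_pos : 0 < lam.

Definition regok (i : nat) := (nth [::] rest i != [::]) && (envl rest i < 2 ^ lam).

Lemma weight_pos e : 0 < weight e.
Proof. by elim: e => //= e1 h1 e2 h2; lia. Qed.

Lemma eval_ub e : all regok (regs e) -> eval (envl rest) e < 2 ^ (weight e * lam).
Proof.
have H a b : 0 < a -> 2 ^ (a * lam) * 2 ^ (b * lam) = 2 ^ ((a + b) * lam).
  by move=> _; rewrite -expnD mulnDl.
have H2 a : 0 < a -> 2 <= 2 ^ (a * lam).
  by move=> h; rewrite -{1}(expn1 2) leq_exp2l //; nia.
have H1 e' := H2 _ (weight_pos e').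
elim: e => [i|e1 IH1 e2 IH2|e1 IH1 e2 IH2|e1 IH1 e2 IH2|e1 IH1 e2 IH2] /=.
- by rewrite andbT mul1n => /andP[].
- rewrite all_cat => /andP[/IH1 h1 /IH2 h2]; rewrite -H ?weight_pos //; nia.
- rewrite all_cat => /andP[/IH1 h1 /IH2 h2]; rewrite -H ?weight_pos //.
  by have := H1 e1; have := H1 e2; nia.
- rewrite all_cat => /andP[/IH1 h1 /IH2 h2]; rewrite -H ?weight_pos //.
  by have := H1 e2; nia.
- rewrite all_cat => /andP[/IH1 h1 /IH2 h2]; rewrite -(addn1 (_ + _)) -H ?addn_gt0 ?weight_pos // -H ?weight_pos //.
  have := hdiv_ub (eval (envl rest) e1) (eval (envl rest) e2).
  have := H1 e2; have := H2 1 isT; move: (2 ^ (1 * lam)) (2 ^ (weight e2 * lam)) => a b.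
  move: h1; move: (2 ^ (weight e1 * lam)) (eval (envl rest) e1) (hdiv _ _) => D v q.
  move=> h1 ha hb hq; have : D * 2 <= D * b * a by rewrite -mulnA leq_mul2l; nia.
  lia.
Qed.

Lemma hexpr e X : all (fun i => 8 + i < nstk) (regs e) -> all regok (regs e) ->
  weight e * lam < L ->
  hrun L (ecode e) [:: l0, [::], [::], [::], [::], [::], X, [::] & rest]
    (40 * nodes e * L.+1)
    [:: l0, [::], [::], [::], [::], [::], eval (envl rest) e :: X, [::] & rest].
Proof.
have lt_pow a v : v < 2 ^ a -> a < L -> v < 2 ^ L.
  by move=> h1 h2; apply: leq_trans h1 _; rewrite leq_exp2l; lia.
elim: e X => [i|e1 IH1 e2 IH2|e1 IH1 e2 IH2|e1 IH1 e2 IH2|e1 IH1 e2 IH2] X /=.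
- rewrite !andbT mul1n => hn /andP[hne hub] hL.
  apply: (@hle _ _ _ 1); last by rewrite muln1; lia.
  apply: heqr.
    apply: (@hcopy _ (8 + i) 6 _ (envl rest i) (behead (nth [::] rest i))) => //.
      by rewrite /envl /=; case: (nth _ _ _) hne.
    exact: lt_pow hub hL.
  by [].
- rewrite !all_cat => /andP[s1 s2] /andP[a1 a2] hw; have b1 := eval_ub a1; have b2 := eval_ub a2.
  have := weight_pos e1; have := weight_pos e2 => w2 w1.
  apply: hle.
    eapply hseq; first by apply: IH1 => //; nia.
    eapply hseq; first by apply: IH2 => //; nia.
    by apply: hmul; [exact: b1 | exact: b2 | rewrite -mulnDl].
  have := ltn0Sn L; move: L.+1 => M M0; rewrite -(addn1 (_ + _)) !mulnDr !mulnDl; lia.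
- rewrite !all_cat => /andP[s1 s2] /andP[a1 a2] hw; have b1 := eval_ub a1; have b2 := eval_ub a2.
  have := weight_pos e1; have := weight_pos e2 => w2 w1.
  have c1 : eval (envl rest) e1 < 2 ^ L by apply: lt_pow b1 _; nia.
  have c2 : eval (envl rest) e2 < 2 ^ L by apply: lt_pow b2 _; nia.
  apply: hle.
    eapply hseq; first by apply: IH1 => //; nia.
    eapply hseq; first by apply: IH2 => //; nia.
    hstep hmove; hlast hadd.
  have := ltn0Sn L; move: L.+1 => M M0; rewrite -(addn1 (_ + _)) !mulnDr !mulnDl; lia.
- rewrite !all_cat => /andP[s1 s2] /andP[a1 a2] hw; have b1 := eval_ub a1; have b2 := eval_ub a2.
  have := weight_pos e1; have := weight_pos e2 => w2 w1.
  have c1 : eval (envl rest) e1 < 2 ^ L by apply: lt_pow b1 _; nia.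
  have c2 : eval (envl rest) e2 < 2 ^ L by apply: lt_pow b2 _; nia.
  apply: hle.
    eapply hseq; first by apply: IH1 => //; nia.
    eapply hseq; first by apply: IH2 => //; nia.
    hstep hmove; hlast hsub.
  have := ltn0Sn L; move: L.+1 => M M0; rewrite -(addn1 (_ + _)) !mulnDr !mulnDl; lia.
- rewrite !all_cat => /andP[s1 s2] /andP[a1 a2] hw; have b1 := eval_ub a1; have b2 := eval_ub a2.
  have := weight_pos e1; have := weight_pos e2 => w2 w1.
  apply: hle.
    eapply hseq; first by apply: IH1 => //; nia.
    eapply hseq; first by apply: IH2 => //; nia.
    by apply: hdivX; [exact: b1 | exact: b2 | nia].
  have := ltn0Sn L; move: L.+1 => M M0; rewrite -(addn1 (_ + _)) !mulnDr !mulnDl; lia.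
Qed.
End Expr.

Definition movall i j : mach := whilene i (mov i j).

Lemma hmovall L i j ls l : i < nstk -> i != 1 -> j < nstk -> j != 1 -> i != j ->
  nth [::] ls 1 = [::] -> nth [::] ls i = l -> all (fun v => v < 2 ^ L) l ->
  hrun L (movall i j) ls (2 * size l + 1)
    (set_nth [::] (set_nth [::] ls i [::]) j (rev l ++ nth [::] ls j)).
Proof.
move=> hi i1 hj j1 ij; elim: l ls => [|v l IH] ls h1 hs.
  move=> _; apply: hst; first exact: hwhile0.
  move=> k; rewrite !st_set; case: (k =P j) => [->|_] //.
  by case: (k =P i) => [->|] //; rewrite /st hs.
move=> /= /andP[hv ha]; apply: hle.
  apply: hwhileS => //; first by rewrite hs.
    exact: (@hmove L i j ls v l).
  apply: hst; first apply: IH => //.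
  - by rewrite nth_set_nth /= eq_sym (negbTE j1) nth_set_nth /= eq_sym (negbTE i1).
  - by rewrite nth_set_nth /= (negbTE ij) nth_set_nth /= eqxx.
  - move=> k; rewrite !st_set; case: (k =P j) => [_|_].
      rewrite nth_set_nth /= eqxx nth_set_nth /= (eq_sym j) (negbTE ij).
      by rewrite rev_cons cat_rcons.
    by case: (k =P i).
by rewrite /=; lia.
Qed.

Definition repeat_ i (p : mach) : mach := whilene i (cpy i 6 ;;
  ifz 6 (drop_ i) (p ;; mov i 6 ;; pushc 1 3 ;; subw 6 3 i)).

Lemma hrepeat L i p k m (l0 : nat -> seq nat) X (R : nat -> seq nat -> seq (seq nat)) :
  8 <= i -> i < nstk -> k < 2 ^ L -> 1 < 2 ^ L ->
  (forall j l, nth [::] (R j l) (i - 8) = l) ->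
  (forall j l l', set_nth [::] (R j l) (i - 8) l' = R j l') ->
  (forall j, j < k -> hrun L p
     [:: l0 j, [::], [::], [::], [::], [::], X, [::] & R j [:: k - j]] m
     [:: l0 j.+1, [::], [::], [::], [::], [::], X, [::] & R j.+1 [:: k - j]]) ->
  hrun L (repeat_ i p)
     [:: l0 0, [::], [::], [::], [::], [::], X, [::] & R 0 [:: k]] (k * (m + 6) + 5)
     [:: l0 k, [::], [::], [::], [::], [::], X, [::] & R k [::]].
Proof.
move=> i8 hi hk h1 hn hset hbody.
have [i' ei] : exists i', i = i' + 8 by exists (i - 8); lia.
rewrite ei addnK in hn hset.
have nthE (ls : seq (seq nat)) a0 a1 a2 a3 a4 a5 a6 a7 :
    nth [::] [:: a0, a1, a2, a3, a4, a5, a6, a7 & ls] i = nth [::] ls i'.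
  by rewrite ei !addnS addn0.
have setE (ls : seq (seq nat)) a0 a1 a2 a3 a4 a5 a6 a7 l :
    set_nth [::] [:: a0, a1, a2, a3, a4, a5, a6, a7 & ls] i l =
    [:: a0, a1, a2, a3, a4, a5, a6, a7 & set_nth [::] ls i' l].
  by rewrite ei !addnS addn0.
have [i1 i2 i3 i6] : [/\ i != 1, i != 2, i != 3 & i != 6] by split; lia.
have p0 : 0 < 2 ^ L by lia.
have H d : forall j, j + d = k -> hrun L (repeat_ i p)
     [:: l0 j, [::], [::], [::], [::], [::], X, [::] & R j [:: d]] (d * (m + 6) + 5)
     [:: l0 k, [::], [::], [::], [::], [::], X, [::] & R k [::]].
  elim: d => [|d IH] j hj.
    apply: hle.
      apply: hwhileS => //; first by rewrite nthE hn.
        eapply hseq; first by apply: (@hcopy L i 6 _ 0 [::]) => //; rewrite nthE hn.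
        rewrite /=; eapply hifz; try by [].
        rewrite /=; eapply heqr.
          by apply: (@hdrop L i _ 0 [::]) => //; rewrite nthE hn.
        by rewrite setE hset.
      by rewrite -hj addn0; apply: hwhile0 => //; rewrite nthE hn.
    by [].
  have jk : j < k by lia.
  have ed : k - j = d.+1 by lia.
  have bd : d.+1 < 2 ^ L by lia.
  apply: hle.
    apply: hwhileS => //; first by rewrite nthE hn.
      eapply hseq; first by apply: (@hcopy L i 6 _ d.+1 [::]) => //; rewrite nthE hn.
      rewrite /=; eapply hifz; try by [].
      rewrite /= -ed; eapply hseq; first exact: hbody.
      rewrite ed; eapply hseq; first by apply: (@hmove L i 6 _ d.+1 [::]) => //; rewrite nthE hn.
      rewrite /= setE hset /=; hstep hpushc.
      eapply heqr; first by apply: (@hsub L 6 3 i _ d.+1 1 X [::]).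
      by rewrite /= nthE hn setE hset subn1.
    by apply: IH; lia.
  by rewrite mulSn; lia.
by have := H k 0 (add0n _).
Qed.

Definition FR out ps ps' bs bs' nu nu' (n S : nat) v acc ai k b : seq (seq nat) :=
  [:: out; [::]; [::]; [::]; [::]; [::]; [::]; [::]; ps; ps'; bs; bs'; nu; nu'; [:: n]; [:: S];
     [::]; [::]; [::]; [::]; [::]; [::]; [::]; [::]; v; acc; ai; k; [::]; b].

(** * The rounds of the algorithm *)

(* Stacks: 0 input and output; 1-5 and 7 scratch; 6 operands; 8 the quadruples
   (x, y, u, w) with p = x / y and w_ab = u / w; 10 a record [t; c; f; mu] per
   buyer, where f marks the current one; 12 the opportunity costs; 9, 11 and 13
   what has been read of 8, 10 and 12; 14 n; 15 the scale; 16-23 the current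
   record and quadruple; 24 nu; 25 the increment of nu; 26 the item's index;
   27 a loop counter; 28 the gain; 29 the current buyer. An [EReg i] denotes
   stack [8 + i]. *)
Notation rN := (EReg 6).
Notation rS := (EReg 7).
Notation rT := (EReg 8).
Notation rC := (EReg 9).
Notation rF := (EReg 10).
Notation rM := (EReg 11).
Notation rX := (EReg 12).
Notation rY := (EReg 13).
Notation rU := (EReg 14).
Notation rW := (EReg 15).
Notation rV := (EReg 16).
Notation rA := (EReg 17).
Notation rI := (EReg 18).
Notation rG := (EReg 20).
Notation rB := (EReg 21).

Definition gain_expr : expr :=
  EDiv (ESub (EMul (EMul (EMul (EMul rX rT) rU) rS) rN)
           (EMul rW (EAdd (EMul (EMul rX rT) rV) (EMul (EMul (EAdd (EMul rX rT) rY) rN) rM))))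
      (EMul (EMul (EMul rY rT) rW) rN).

(* The floor of [p (S w_ab - v / n - m) - m / t] with denominators cleared:
   costs [v] are kept in units of [1 / (n S)], prices [m] in units of [1 / S]. *)
Definition gain_nat (n S t x y u w v m : nat) : nat :=
  hdiv (x * t * u * S * n - w * (x * t * v + (x * t + y) * n * m)) (y * t * w * n).

Arguments ecode : simpl never.
Arguments nodes : simpl nomatch.

Definition load_elem : mach :=
  mov 10 16 ;; mov 10 17 ;; mov 10 18 ;; mov 10 19 ;;
  mov 8 20 ;; mov 8 21 ;; mov 8 22 ;; mov 8 23.
Definition store_elem : mach :=
  mov 16 11 ;; mov 17 11 ;; mov 18 11 ;; mov 19 11 ;;
  mov 20 9 ;; mov 21 9 ;; mov 22 9 ;; mov 23 9.
Definition elem : mach :=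
  load_elem ;; ecode gain_expr ;; mov 6 28 ;;
  ecode (EAdd rA (EMul rC rG)) ;; drop_ 25 ;; mov 6 25 ;;
  ecode (EAdd rM rG) ;; drop_ 19 ;; mov 6 19 ;;
  ecode (EMul rF rG) ;; ifz 6 (ret None) (cpy 26 0) ;; drop_ 28 ;; store_elem.

Ltac hex lm := eapply hseq; [eapply (@hexpr _ lm);
  [ by [] | by [] | by rewrite /regok /envl /=; repeat (apply/andP; split) | by rewrite /=; lia ] | ].

Section Elem.
Variables (L lam : nat).
Hypothesis lam_pos : 0 < lam.
Hypothesis lamL : 20 * lam < L.

Lemma lam_fit a v : v < 2 ^ (a * lam) -> a <= 20 -> v < 2 ^ L.
Proof. by move=> h ha; apply: leq_trans h _; rewrite leq_exp2l; nia. Qed.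

Lemma lam_fit1 v : v < 2 ^ lam -> v < 2 ^ L.
Proof. by move=> h; apply: (@lam_fit 1) => //; rewrite mul1n. Qed.

Lemma helem out t c f m x y u w ps ps' bs bs' nu nu' n S v acc ai k b :
  let G := gain_nat n S t x y u w v m in
  all (fun z => z < 2 ^ lam) [:: t; c; f; m; x; y; u; w; n; S; v; acc; ai; G; acc + c * G; m + G] ->
  hrun L elem
    (FR out [:: x, y, u, w & ps] ps' [:: t, c, f, m & bs] bs' nu nu' n S [:: v] [:: acc] [:: ai] k b)
    (3000 * L.+1)
    (FR (nseq (f * G != 0) ai ++ out) ps [:: w, u, y, x & ps'] bs [:: m + G, f, c, t & bs'] nu nu'
       n S [:: v] [:: acc + c * G] [:: ai] k b).
Proof.
move=> G /= /and5P[ht hc hf hm /and5P[hx hy hu hw /and5P[hn hS hv hacc /and5P[hai hG hacc' hm' _]]]].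
have [Lt Lc Lf Lm] := And4 (lam_fit1 ht) (lam_fit1 hc) (lam_fit1 hf) (lam_fit1 hm).
have [Lx Ly Lu Lw] := And4 (lam_fit1 hx) (lam_fit1 hy) (lam_fit1 hu) (lam_fit1 hw).
have [Lv La Li LG] := And4 (lam_fit1 hv) (lam_fit1 hacc) (lam_fit1 hai) (lam_fit1 hG).
have [La' Lm'] := conj (lam_fit1 hacc') (lam_fit1 hm').
have LfG : f * G < 2 ^ L.
  apply: (@lam_fit 2) => //; rewrite mul2n -addnn expnD; nia.
rewrite /FR; apply: hle.
  eapply hseq.
    rewrite /load_elem; do 7 hstep hmove; hlast hmove.
  hex lam.
  rewrite -[eval _ gain_expr]/G; clearbody G; rewrite /=.
  hstep hmove; hex lam; hstep hdrop; hstep hmove; hex lam; hstep hdrop; hstep hmove; hex lam.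
  apply: (@hseq L _ _ _ 2 [:: nseq (f * G != 0) ai ++ out; [::]; [::]; [::]; [::]; [::];
      [::]; [::]; ps; ps'; bs; bs'; nu; nu'; [:: n]; [:: S]; [:: t]; [:: c]; [:: f];
      [:: m + G]; [:: x]; [:: y]; [:: u]; [:: w]; [:: v]; [:: acc + c * G]; [:: ai]; k;
      [:: G]; b]).
    eapply (@hifz L 6 _ _ _ (f * G) [::] 1) => //=.
    by case: (f * G == 0) => /=; [apply: hret | hlast hcopy].
  rewrite /=; hstep hdrop.
  rewrite /store_elem; do 7 hstep hmove; hlast hmove.
rewrite /=; lia.
Qed.

End Elem.

Definition bloop : mach := whilene 10 elem.
Definition abody : mach :=
  mov 12 24 ;; pushc 0 25 ;; bloop ;; movall 11 10 ;; ecode (EAdd rV rA) ;; mov 6 13 ;;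
  drop_ 24 ;; drop_ 25 ;; pushc 1 6 ;; mov 26 3 ;; addw 6 3 26.
Definition reset_mu : mach :=
  whilene 10 (mov 10 11 ;; mov 10 11 ;; mov 10 11 ;; drop_ 10 ;; pushc 0 11).
Definition round_prog : mach :=
  drop_ 26 ;; pushc 0 26 ;; whilene 0 (drop_ 0) ;; reset_mu ;; movall 11 10 ;;
  whilene 12 abody ;; movall 9 8 ;; movall 13 12.

Definition main_loop : mach := repeat_ 27 round_prog.

Section Gains.
Variables (A : eqType) (B : Type) (px py pu pw : A -> B -> nat) (t c : B -> nat) (n S : nat).
Variables (sA : seq A) (sB : seq B).

Definition gainf (v : nat) a b (m : nat) : nat :=
  gain_nat n S (t b) (px a b) (py a b) (pu a b) (pw a b) v m.

(* The items of [p] are listed in reverse order of processing. *)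
Fixpoint mu (nu : A -> nat) (p : seq A) (b : B) : nat :=
  if p is a :: p' then mu nu p' b + gainf (nu a) a b (mu nu p' b) else 0.
Definition gk nu p a b := gainf (nu a) a b (mu nu p b).
Definition bef a := drop (index a (rev sA)).+1 (rev sA).
Definition nustep (nu : A -> nat) (a : A) : nat :=
  nu a + \sum_(b <- sB) c b * gk nu (bef a) a b.
Definition nuk k := iter k nustep (fun=> 0).

Variable f : B -> nat.
Fixpoint plist (nu : A -> nat) (p : seq A) : seq nat :=
  if p is a :: p' then
    nseq (count (fun b => f b * gk nu p' a b != 0) sB) (size p') ++ plist nu p'
  else [::].
End Gains.

Lemma bef_suffix (A : eqType) (sA q p : seq A) a :
  uniq sA -> rev sA = q ++ a :: p -> bef sA a = p.
Proof.
move=> uA e; rewrite /bef e index_cat; have : uniq (q ++ a :: p) by rewrite -e rev_uniq.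
rewrite cat_uniq /= negb_or => /and3P[_ /andP[/negbTE -> _] _].
by rewrite /= eqxx addn0 drop_cat ltnNge leqnSn /= subSnn drop1.
Qed.

Section Layout.
Variables (A B : Type) (px py pu pw : A -> B -> nat) (t c f : B -> nat) (sB : seq B).

Definition quad a b := [:: px a b; py a b; pu a b; pw a b].
Definition rec (m : B -> nat) b := [:: t b; c b; f b; m b].
Definition quads a s := flatten [seq quad a b | b <- s].
Definition recs m s := flatten [seq rec m b | b <- s].

Lemma quads_cons a b s : quads a (b :: s) = quad a b ++ quads a s. Proof. by []. Qed.
Lemma recs_cons m b s : recs m (b :: s) = rec m b ++ recs m s. Proof. by []. Qed.

Lemma size_recs m s : size (recs m s) = 4 * size s.
Proof. by elim: s => // b s IH; rewrite recs_cons size_cat IH /=; lia. Qed.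

Lemma size_quads a s : size (quads a s) = 4 * size s.
Proof. by elim: s => // b s IH; rewrite quads_cons size_cat IH /=; lia. Qed.

Definition allquads s := flatten [seq quads a sB | a <- s].

Lemma allquads_cons a s : allquads (a :: s) = quads a sB ++ allquads s. Proof. by []. Qed.

Lemma size_allquads s : size (allquads s) = 4 * (size s * size sB).
Proof. by elim: s => // a s IH; rewrite allquads_cons size_cat size_quads IH /=; lia. Qed.

Lemma rev_allquads_cons a p : rev (allquads (rev (a :: p))) =
  rev (quads a sB) ++ rev (allquads (rev p)).
Proof. by rewrite rev_cons -cats1 /allquads map_cat flatten_cat rev_cat /= cats0. Qed.

End Layout.

Section Round.
Variables (A : eqType) (B : Type) (px py pu pw : A -> B -> nat) (t c f : B -> nat) (n S : nat).
Variables (sA : seq A) (sB : seq B) (N l0 lam L : nat).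
Hypotheses (elam : lam = 10 * l0) (eL : L = (20 * lam).+1).
Hypothesis l0_pos : 0 < l0.
Hypothesis uA : uniq sA.
Hypothesis hAB : forall a b, all (fun z => z < 2 ^ l0) [:: px a b; py a b; pu a b; pw a b].
Hypothesis hBB : forall b, all (fun z => z < 2 ^ l0) [:: t b; c b; f b].
Hypotheses (hn : n < 2 ^ l0) (hS : S < 2 ^ l0) (hN : N < 2 ^ l0).
Hypothesis hA : size sA <= N.
Hypothesis hB : size sB <= N.
Variables (GM CM : nat).
Hypotheses (eGM : GM = 2 ^ (5 * l0 + 1)) (eCM : CM = 2 ^ (6 * l0 + 1)).
Local Notation G := (gainf px py pu pw t n S).
Local Notation gkk := (gk px py pu pw t n S).
Local Notation muu := (mu px py pu pw t n S).
Local Notation nustepp := (nustep px py pu pw t c n S sA sB).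
Local Notation nukk := (nuk px py pu pw t c n S sA sB).
Local Notation plistt := (plist px py pu pw t n S sB f).

Let lam_pos : 0 < lam. Proof. by lia. Qed.
Let lamL : 20 * lam < L. Proof. by rewrite eL. Qed.

Local Notation quads := (quads px py pu pw).
Local Notation recs := (recs t c f).
Local Notation allquads := (allquads px py pu pw sB).

Lemma G_ub v a b m : G v a b m < GM.
Proof.
have := hAB a b => /= /and5P[hx hy hu hw _].
have := hBB b => /= /and4P[ht hc hf _].
rewrite /gainf /gain_nat; set M := pw a b * _; set D := _ * n.
apply: leq_ltn_trans (hdiv_ub _ _) _.
have h1 : px a b * t b * pu a b * S * n < 2 ^ (5 * l0).
  rewrite (_ : 5 * l0 = l0 + l0 + l0 + l0 + l0); last lia.
  by rewrite !expnD !ltn_mul.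
by rewrite eGM addn1 expnS; lia.
Qed.

Lemma cG_ub v a b m : c b * G v a b m < CM.
Proof.
have := hBB b => /= /and4P[_ hc _ _].
rewrite eCM (_ : 6 * l0 + 1 = l0 + (5 * l0 + 1)); last lia.
by rewrite expnD -eGM ltn_mul // G_ub.
Qed.

Lemma pow_lam v k : v < 2 ^ k -> k <= lam -> v < 2 ^ lam.
Proof. by move=> h hk; apply: leq_trans h _; rewrite leq_exp2l. Qed.

Lemma lamLt v : v < 2 ^ lam -> v < 2 ^ L.
Proof. by move=> h; apply: leq_trans h _; rewrite leq_exp2l //; lia. Qed.

Lemma hbloop a v m s nu nu' ai k b0 : forall out ps ps' bs' acc,
  v < 2 ^ lam -> ai < 2 ^ lam -> (forall b, m b + GM <= 2 ^ lam) ->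
  acc + size s * CM < 2 ^ lam ->
  hrun L bloop
    (FR out (quads a s ++ ps) ps' (recs m s) bs' nu nu' n S [:: v] [:: acc] [:: ai] k b0)
    (size s * (3000 * L.+1 + 1) + 1)
    (FR (nseq (count (fun b => f b * G v a b (m b) != 0) s) ai ++ out) ps
       (rev (quads a s) ++ ps') [::]
       (rev (recs (fun b => m b + G v a b (m b)) s) ++ bs') nu nu' n S [:: v]
       [:: acc + \sum_(b <- s) c b * G v a b (m b)] [:: ai] k b0).
Proof.
elim: s => [|b s IH] out ps ps' bs' acc hv hai hm hacc.
  by rewrite big_nil addn0; apply: hwhile0.
have hG := G_ub v a b (m b); have hcG := cG_ub v a b (m b).
have := hAB a b => /= /and5P[hx hy hu hw _].
have := hBB b => /= /and4P[ht hc hf _].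
have l0lam : l0 <= lam by lia.
have GMlam : 5 * l0 + 1 <= lam by lia.
move: hacc; rewrite /= mulSn => hacc.
apply: hle.
  apply: hwhileS => //.
    apply: (@helem L lam) => //=; rewrite -/(G v a b (m b)).
    rewrite (pow_lam hx) // (pow_lam hy) // (pow_lam hu) // (pow_lam hw) // (pow_lam ht) //.
    rewrite (pow_lam hc) // (pow_lam hf) // (pow_lam hn) // (pow_lam hS) // hv hai.
    by have := hm b; rewrite andbT /=; repeat (apply/andP; split); lia.
  apply: heqr; first by apply: (IH _ _ _ _ (acc + c b * G v a b (m b))) => //; lia.
  rewrite /FR big_cons addnA !recs_cons quads_cons !rev_cat -!catA /=.
  by rewrite (addnC (f b * _ != 0 : nat)) nseqD -catA.
by lia.
Qed.
Lemma all_recs m s : (forall b, m b < 2 ^ lam) -> all (fun v => v < 2 ^ L) (recs m s).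
Proof.
move=> hm; elim: s => // b s IH; rewrite recs_cons all_cat IH andbT /=.
have := hBB b => /= /and4P[ht hc hf _].
by rewrite !lamLt ?hm // ?(pow_lam ht) ?(pow_lam hc) ?(pow_lam hf) //; lia.
Qed.

Lemma all_quads a s : all (fun v => v < 2 ^ L) (quads a s).
Proof.
elim: s => // b s IH; rewrite quads_cons all_cat IH andbT /=.
have := hAB a b => /= /and5P[hx hy hu hw _].
by rewrite !lamLt ?(pow_lam hx) ?(pow_lam hy) ?(pow_lam hu) ?(pow_lam hw) //; lia.
Qed.

Lemma habody a v m nul nu' ai k b0 out ps ps' :
  v + N * CM < 2 ^ lam -> ai.+1 < 2 ^ lam -> (forall b, m b + GM < 2 ^ lam) ->
  let m' b := m b + G v a b (m b) in
  hrun L abody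
    (FR out (quads a sB ++ ps) ps' (recs m sB) [::] (v :: nul) nu' n S [::] [::] [:: ai] k b0)
    ((size sB).+1 * (4000 * L.+1))
    (FR (nseq (count (fun b => f b * G v a b (m b) != 0) sB) ai ++ out) ps
       (rev (quads a sB) ++ ps') (recs m' sB) [::] nul
       (v + \sum_(b <- sB) c b * G v a b (m b) :: nu') n S [::] [::] [:: ai.+1] k b0).
Proof.
move=> hv hai hm m'.
have hsum : \sum_(b <- sB) c b * G v a b (m b) <= N * CM.
  apply: leq_trans (leq_mul hB (leqnn _)).
  rewrite -sum1_size big_distrl /=; apply: leq_sum => b _; rewrite mul1n.
  exact/ltnW/cG_ub.
have vlam : v < 2 ^ lam by lia.
have slam : \sum_(b <- sB) c b * G v a b (m b) < 2 ^ lam by lia.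
have Lv := lamLt vlam; have p0 : 0 < 2 ^ L by rewrite expn_gt0.
have Lai : ai < 2 ^ L by apply: lamLt; lia.
have L1 : 1 < 2 ^ L by rewrite -{1}(expn0 2) ltn_exp2l // eL.
have Lvs : v + \sum_(b <- sB) c b * G v a b (m b) < 2 ^ L by apply: lamLt; lia.
apply: hle.
  rewrite /abody; hstep hmove; hstep hpushc.
  eapply hseq.
    apply: (@hbloop a v m sB nul nu' ai k b0 out ps ps' [::] 0) => //; try lia.
    + by move=> b; have := hm b; lia.
    + by have := leq_mul hB (leqnn CM); lia.
  rewrite add0n cats0 -/m'.
  eapply hseq.
    apply: (@hmovall L 11 10 _ (rev (recs m' sB))) => //.
    rewrite all_rev; apply: all_recs => b; rewrite /m'.
    by have := hm b; have := G_ub v a b (m b); lia.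
  rewrite /= revK cats0.
  move: (\sum_(b <- sB) _) hsum slam Lvs => sm hsum slam Lvs.
  have Ls := lamLt slam.
  hex lam; hstep hmove; hstep hdrop; hstep hdrop; hstep hpushc; hstep hmove.
  eapply heqr; first by apply: (@hadd L 6 3 26 _ 1 ai [::] [::]).
  by rewrite /= add1n.
rewrite size_rev size_recs /=.
move: L.+1 (ltn0Sn L) => M M0; nia.
Qed.

Fixpoint nulist (nu : A -> nat) (p : seq A) : seq nat :=
  if p is a :: p' then (nu a + \sum_(b <- sB) c b * gkk nu p' a b) :: nulist nu p' else [::].

Lemma all_allquads s : all (fun v => v < 2 ^ L) (allquads s).
Proof. by elim: s => // a s IH; rewrite allquads_cons all_cat all_quads. Qed.

Lemma mu_ub nu p b : muu nu p b <= size p * GM.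
Proof. by elim: p => // a p IH /=; have := G_ub (nu a) a b (muu nu p b); lia. Qed.

Lemma mu_lam nu p b : size p <= N -> muu nu p b + GM < 2 ^ lam.
Proof.
move=> hp; have := mu_ub nu p b; have : 2 ^ (6 * l0 + 2) <= 2 ^ lam by rewrite leq_exp2l //; lia.
rewrite (_ : 6 * l0 + 2 = l0 + (5 * l0 + 1) + 1); last lia.
rewrite expnD expn1 expnD -eGM.
have : (size p).+1 * GM <= 2 ^ l0 * GM by rewrite leq_mul2r; lia.
rewrite mulSn; have : 0 < 2 ^ l0 * GM by rewrite eGM muln_gt0 !expn_gt0.
lia.
Qed.

Lemma haloop nu k b0 s : forall p, size s + size p <= N ->
  (forall a, nu a + N * CM < 2 ^ lam) ->
  hrun L (whilene 12 abody)
    (FR (plistt nu p) (allquads s) (rev (allquads (rev p))) (recs (muu nu p) sB) [::]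
      (map nu s) (nulist nu p) n S [::] [::] [:: size p] k b0)
    (size s * ((size sB).+1 * (4000 * L.+1) + 1) + 1)
    (FR (plistt nu (catrev s p)) [::] (rev (allquads (rev (catrev s p))))
      (recs (muu nu (catrev s p)) sB) [::]
      [::] (nulist nu (catrev s p)) n S [::] [::] [:: size (catrev s p)] k b0).
Proof.
elim: s => [|a s IH] p hs hnu; first by apply: hwhile0.
apply: hle.
  apply: hwhileS => //.
    apply: (@habody a (nu a)) => //.
      have : N <= 2 ^ l0 by lia.
      have : 2 ^ l0 <= 2 ^ lam by rewrite leq_exp2l //; lia.
      by move: hs; rewrite /=; lia.
    by move=> b; apply: mu_lam; move: hs; rewrite /=; lia.
  have := IH (a :: p); rewrite rev_allquads_cons /=; apply => //.
  by move: hs; rewrite /=; lia.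
by rewrite /= mulSn; lia.
Qed.

Lemma hreset k b0 out ps ps' nul nu' ai m s : forall bs', (forall b, m b < 2 ^ lam) ->
  hrun L reset_mu
    (FR out ps ps' (recs m s) bs' nul nu' n S [::] [::] ai k b0) (6 * size s + 1)
    (FR out ps ps' [::] (rev (recs (fun=> 0) s) ++ bs') nul nu' n S [::] [::] ai k b0).
Proof.
elim: s => [|b s IH] bs' hm; first by apply: hwhile0.
have := all_recs [:: b] hm => /= /and5P[ht hc hf hmb _].
have p0 : 0 < 2 ^ L by rewrite expn_gt0.
apply: hle.
  apply: hwhileS => //.
    hstep hmove; hstep hmove; hstep hmove; hstep hdrop; hlast hpushc.
  apply: heqr; first exact: IH.
  by rewrite recs_cons rev_cat -catA.
by rewrite /=; lia.
Qed.

Lemma hclear0 l ls : all (fun v => v < 2 ^ L) l ->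
  hrun L (whilene 0 (drop_ 0)) (l :: ls) (2 * size l + 1) ([::] :: ls).
Proof.
elim: l => [|v l IH]; first by move=> _; apply: hwhile0.
move=> /= /andP[hv ha]; apply: hle.
  apply: hwhileS => //; first by hlast hdrop.
  exact: IH.
by rewrite /=; lia.
Qed.

Lemma nulist_step nu q p : rev sA = q ++ p -> nulist nu p = map (nustepp nu) p.
Proof.
elim: p q => // a p IH q e; rewrite /= -(IH (rcons q a)) ?cat_rcons //.
congr (_ :: _); rewrite /nustep; congr (_ + _); apply: eq_bigr => b _.
by rewrite (bef_suffix uA e).
Qed.

Lemma hround out m nu ai k b0 : all (fun v => v < 2 ^ L) out ->
  (forall b, m b < 2 ^ lam) -> (forall a, nu a + N * CM < 2 ^ lam) -> ai < 2 ^ L ->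
  hrun L round_prog
    (FR out (allquads sA) [::] (recs m sB) [::] (map nu sA) [::] n S [::] [::] [:: ai] k b0)
    (2 * size out + 20 + N.+1 * (N.+1 * (5000 * L.+1)))
    (FR (plistt nu (rev sA)) (allquads sA) [::] (recs (muu nu (rev sA)) sB) [::]
       (map (nustepp nu) sA) [::] n S [::] [::] [:: size sA] k b0).
Proof.
move=> hout hm hnu hai; have p0 : 0 < 2 ^ L by rewrite expn_gt0.
have hsum a : \sum_(b <- sB) c b * gkk nu (bef sA a) a b <= N * CM.
  apply: leq_trans (leq_mul hB (leqnn _)).
  rewrite -sum1_size big_distrl /=; apply: leq_sum => b _; rewrite mul1n.
  exact/ltnW/cG_ub.
apply: hle.
  rewrite /round_prog; hstep hdrop; hstep hpushc.
  eapply hseq; first exact: hclear0.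
  eapply hseq; first exact: hreset.
  rewrite cats0; eapply hseq.
    apply: (@hmovall L 11 10 _ (rev (recs (fun=> 0) sB))) => //.
    by rewrite all_rev; apply: all_recs => b; rewrite expn_gt0.
  rewrite /= revK cats0.
  eapply hseq; first by apply: (@haloop nu k b0 sA [::]); rewrite ?addn0.
  rewrite catrevE cats0 revK.
  eapply hseq; first by apply: (@hmovall L 9 8 _ (rev (allquads sA))) => //; rewrite all_rev all_allquads.
  rewrite /= revK cats0 size_rev (@nulist_step nu [::]) // map_rev.
  eapply heqr.
    apply: (@hmovall L 13 12 _ (rev (map (nustepp nu) sA))) => //.
    rewrite all_rev all_map; apply/allT => a /=; apply: lamLt.
    by have := hnu a; have := hsum a; rewrite /nustep; lia.
  by rewrite /= revK cats0.
rewrite !size_rev size_recs size_allquads size_map.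
have h1 : size sA * size sB <= N * N by rewrite leq_mul.
have h2 : size sA * ((size sB).+1 * (4000 * L.+1) + 1) <= N * (N.+1 * (4000 * L.+1) + 1).
  by rewrite leq_mul // leq_add2r leq_mul2r ltnS hB orbT.
move: L.+1 (ltn0Sn L) h2 => M M0 h2; nia.
Qed.
Lemma nuk_ub k a : nukk k a <= k * (N * CM).
Proof.
elim: k => [|k IH] //; rewrite /nuk iterS -/(nukk k) /nustep mulSn addnC leq_add //.
apply: leq_trans (leq_mul hB (leqnn _)).
rewrite -sum1_size big_distrl /=; apply: leq_sum => b _; rewrite mul1n.
by apply/ltnW; apply: cG_ub.
Qed.

Lemma nuk_lam k a : k < N -> nukk k a + N * CM < 2 ^ lam.
Proof.
move=> hk; have := nuk_ub k a.
have : k.+1 * (N * CM) <= 2 ^ l0 * (2 ^ l0 * CM) by rewrite leq_mul ?leq_mul //; lia.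
rewrite mulSn eCM -!expnD; have : 2 ^ (l0 + (l0 + (6 * l0 + 1))) < 2 ^ lam.
  by rewrite ltn_exp2l //; lia.
lia.
Qed.

Lemma plist_bound nu p : size p <= N ->
  all (fun v => v < 2 ^ L) (plistt nu p) /\ size (plistt nu p) <= size p * N.
Proof.
elim: p => [//|a p IH] /= hp; have [|h1 h2] := IH; first lia.
have hpL : size p < 2 ^ L.
  have : 2 ^ l0 <= 2 ^ L by rewrite leq_exp2l; lia.
  lia.
rewrite all_cat h1 size_cat size_nseq mulSn; split.
  by rewrite all_nseq hpL orbT.
by have := count_size (fun b => f b * gk px py pu pw t n S nu p a b != 0) sB; lia.
Qed.

Lemma hrounds out kk ai b0 : all (fun v => v < 2 ^ L) out -> kk <= N -> ai < 2 ^ L ->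
  exists out' ls',
  [/\ hrun L main_loop
    (FR out (allquads sA) [::] (recs (fun=> 0) sB) [::] (nseq (size sA) 0) [::] n S [::] [::]
      [:: ai] [:: kk] b0)
    (kk * (2 * (size out + N * N) + 26 + N.+1 * (N.+1 * (5000 * L.+1))) + 5) (out' :: ls') &
   0 < kk -> out' = plistt (nukk kk.-1) (rev sA)].
Proof.
move=> hout hk hai.
pose l j := if j is j'.+1 then plistt (nukk j') (rev sA) else out.
pose m j := if j is j'.+1 then muu (nukk j') (rev sA) else fun=> 0.
pose aj j := if j is j'.+1 then size sA else ai.
pose R j k := [:: allquads sA; [::]; recs (m j) sB; [::]; map (nukk j) sA; [::]; [:: n];
   [:: S]; [::]; [::]; [::]; [::]; [::]; [::]; [::]; [::]; [::]; [::]; [:: aj j]; k; [::]; b0].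
have hlam2 : 2 ^ l0 <= 2 ^ L by rewrite leq_exp2l //; lia.
have H := @hrepeat L 27 round_prog kk
   (2 * (size out + N * N) + 20 + N.+1 * (N.+1 * (5000 * L.+1))) l [::] R isT isT.
have hz : nseq (size sA) 0 = map (nukk 0) sA by elim: (sA) => //= a s ->.
exists (l kk), [:: [::], [::], [::], [::], [::], [::], [::] & R kk [::]]; split; last by case: (kk).
rewrite hz; apply: hle.
  apply: H => //.
  - lia.
  - by rewrite -{1}(expn0 2) ltn_exp2l // eL.
  move=> j hj; apply: hle.
    apply: (@hround (l j) (m j) (nukk j) (aj j) [:: kk - j] b0).
    + by rewrite /l; case: (j) => // j'; have [] := @plist_bound (nukk j') (rev sA); rewrite ?size_rev.
    + move=> b; rewrite /m; case: (j) => [|j']; first by rewrite expn_gt0.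
      have := @mu_lam (nukk j') (rev sA) b.
      by rewrite size_rev => /(_ hA); lia.
    + by move=> a; apply: nuk_lam; lia.
    + by rewrite /aj; case: (j) => // _; lia.
  have : size (l j) <= size out + N * N.
    rewrite /l; case: (j) => [|j']; first lia.
    have [|_] := @plist_bound (nukk j') (rev sA); rewrite size_rev //.
    by have := leq_mul hA (leqnn N); lia.
  by lia.
by lia.
Qed.
End Round.

(** * Reading the input *)

Definition read_quad : mach :=
  mov 0 20 ;; mov 0 21 ;; mov 0 22 ;; mov 0 23 ;;
  ecode (EMul (EMul rS rY) rW) ;; drop_ 15 ;; mov 6 15 ;;
  mov 20 9 ;; mov 21 9 ;; mov 22 9 ;; mov 23 9.
Definition read_buyer : mach :=
  mov 0 11 ;; mov 0 11 ;;
  ecode (EAdd (ESub rI rB) (ESub rB rI)) ;; ifz 6 (pushc 1 11) (pushc 0 11) ;;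
  pushc 0 11 ;; pushc 1 6 ;; mov 26 3 ;; addw 6 3 26.
Definition parse_input : mach :=
  mov 0 24 ;; mov 0 25 ;; mov 0 14 ;;
  pushc 64 15 ;; ecode (EMul (EMul (EMul rS rN) rN) rV) ;; drop_ 15 ;; mov 6 15 ;;
  ecode (EMul rV rA) ;; mov 6 27 ;; repeat_ 27 read_quad ;; movall 9 8 ;;
  mov 25 27 ;; pushc 0 26 ;; repeat_ 27 read_buyer ;; movall 11 10 ;;
  mov 24 27 ;; repeat_ 27 (pushc 0 12) ;;
  mov 0 19 ;; ecode (ESub rN rM) ;; mov 6 27 ;; drop_ 19.

Section Parse.
Variables (A : eqType) (B : Type) (px py pu pw : A -> B -> nat) (t c f : B -> nat) (n : nat).
Variables (sA : seq A) (sB : seq B) (N l0 lam L bst h : nat) (junk : seq nat).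
Hypotheses (elam : lam = 10 * l0) (eL : L = (20 * lam).+1).
Hypothesis hAB : forall a b, all (fun z => z < 2 ^ l0) [:: px a b; py a b; pu a b; pw a b].
Hypothesis hBB : forall b, all (fun z => z < 2 ^ l0) [:: t b; c b; f b].
Hypotheses (hn : n < 2 ^ l0) (hN : N < 2 ^ l0) (h64 : 64 < 2 ^ l0).
Hypotheses (hh : h < 2 ^ l0) (hbst : bst < 2 ^ l0).
Hypotheses (hA : size sA <= N) (hB : size sB <= N) (hsAB : size sA * size sB <= N).
Hypothesis hf : map f sB = [seq nat_of_bool (i == bst) | i <- iota 0 (size sB)].
Local Notation recss := (recs t c f).
Local Notation allq := (allquads px py pu pw sB).

Definition tcs s := flatten [seq [:: t b; c b] | b <- s].
Definition cells := [seq (a, b) | a <- sA, b <- sB].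
Definition quadl (s : seq (A * B)) := flatten [seq quad px py pu pw q.1 q.2 | q <- s].
Definition scale (s : seq (A * B)) :=
  64 * n * n * size sA * \prod_(q <- s) (py q.1 q.2 * pw q.1 q.2).
Hypothesis hS : forall j, scale (take j cells) < 2 ^ l0.

Lemma quadl_cells : quadl cells = allq sA.
Proof.
rewrite /quadl /cells; elim: (sA) => // a s IH.
by rewrite allquads_cons /= map_cat flatten_cat IH -map_comp.
Qed.

Lemma fit0 v : v < 2 ^ l0 -> v < 2 ^ lam.
Proof. by move=> hv; apply: leq_trans hv _; rewrite leq_exp2l //; lia. Qed.

Lemma fit0L v : v < 2 ^ l0 -> v < 2 ^ L.
Proof. by move=> hv; apply: leq_trans hv _; rewrite leq_exp2l //; lia. Qed.

Lemma l0_pos : 0 < l0. Proof. by case: l0 h64. Qed.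
Lemma lam_pos : 0 < lam. Proof. by have := l0_pos; lia. Qed.

Lemma hread_quad x y u w S W ps' nA nB k b0 :
  all (fun z => z < 2 ^ l0) [:: x; y; u; w] -> S < 2 ^ l0 -> S * y * w < 2 ^ l0 ->
  hrun L read_quad
   [:: [:: x, y, u, w & W], [::], [::], [::], [::], [::], [::], [::] &
     [:: [::]; ps'; [::]; [::]; [::]; [::]; [:: n]; [:: S]; [::]; [::]; [::]; [::];
       [::]; [::]; [::]; [::]; nA; nB; [::]; k; [::]; b0]]
   (300 * L.+1)
   [:: W, [::], [::], [::], [::], [::], [::], [::] &
     [:: [::]; [:: w, u, y, x & ps']; [::]; [::]; [::]; [::]; [:: n]; [:: S * y * w];
      [::]; [::]; [::]; [::]; [::]; [::]; [::]; [::]; nA; nB; [::]; k; [::]; b0]].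
Proof.
move=> /= /and5P[hx hy hu hw _] hS1 hS2.
have [Lx Ly Lu Lw] := And4 (fit0L hx) (fit0L hy) (fit0L hu) (fit0L hw).
have [LS1 LS2] := conj (fit0L hS1) (fit0L hS2); have lp := lam_pos.
have [My Mw MS] := And3 (fit0 hy) (fit0 hw) (fit0 hS1).
apply: hle.
  rewrite /read_quad; do 4 hstep hmove.
  hex lam; hstep hdrop; hstep hmove; do 3 hstep hmove; hlast hmove.
by rewrite /=; lia.
Qed.

Lemma hread_quads W nA nB b0 : 
  hrun L (repeat_ 27 read_quad)
   [:: quadl cells ++ W, [::], [::], [::], [::], [::], [::], [::] &
     [:: [::]; [::]; [::]; [::]; [::]; [::]; [:: n]; [:: scale [::]]; [::]; [::]; [::]; [::];
       [::]; [::]; [::]; [::]; nA; nB; [::]; [:: size cells]; [::]; b0]]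
   (N * (310 * L.+1) + 5)
   [:: W, [::], [::], [::], [::], [::], [::], [::] &
     [:: [::]; rev (quadl cells); [::]; [::]; [::]; [::]; [:: n]; [:: scale cells];
      [::]; [::]; [::]; [::]; [::]; [::]; [::]; [::]; nA; nB; [::]; [::]; [::]; b0]].
Proof.
have hc : size cells <= N by rewrite size_allpairs.
have hcL : size cells < 2 ^ L by apply: fit0L; lia.
have h1 : 1 < 2 ^ L by apply: fit0L; lia.
have H := @hrepeat L 27 read_quad (size cells) (300 * L.+1)
  (fun j => quadl (drop j cells) ++ W) [::]
  (fun j l => [:: [::]; rev (quadl (take j cells)); [::]; [::]; [::]; [::]; [:: n];
    [:: scale (take j cells)]; [::]; [::]; [::]; [::];
       [::]; [::]; [::]; [::]; nA; nB; [::]; l; [::]; b0]) isT isT hcL h1.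
rewrite drop0 take0 drop_size take_size in H.
apply: hle; first (apply: H => // j hj); last first.
  have : size cells * (300 * L.+1 + 6) <= N * (300 * L.+1 + 6) by rewrite leq_mul2r hc orbT.
  have : N * (300 * L.+1 + 6) <= N * (310 * L.+1) by rewrite leq_mul2l; apply/orP; right; lia.
  lia.
case ec : cells hj => [|q0 cs] // hj; rewrite -ec in hj *; move: (q0) => {cs ec} q0.
rewrite (drop_nth q0 hj) (take_nth q0 hj).
set q := nth q0 cells j.
have -> : quadl (q :: drop j.+1 cells) ++ W = quad px py pu pw q.1 q.2 ++ quadl (drop j.+1 cells) ++ W.
  by rewrite /quadl /=.
have eS : scale (rcons (take j cells) q) = scale (take j cells) * py q.1 q.2 * pw q.1 q.2.
  by rewrite /scale -cats1 big_cat big_seq1 /= !mulnA.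
have -> : rev (quadl (rcons (take j cells) q)) = rev (quad px py pu pw q.1 q.2) ++ rev (quadl (take j cells)).
  by rewrite /quadl map_rcons flatten_rcons rev_cat.
rewrite eS; apply: hread_quad => //.
by rewrite -eS -take_nth.
Qed.

Lemma hread_buyer x y j W PS bs' S nA k : x < 2 ^ l0 -> y < 2 ^ l0 -> j.+1 < 2 ^ l0 ->
  hrun L read_buyer
   [:: [:: x, y & W], [::], [::], [::], [::], [::], [::], [::] &
     [:: PS; [::]; [::]; bs'; [::]; [::]; [:: n]; S; [::]; [::]; [::]; [::];
       [::]; [::]; [::]; [::]; nA; [::]; [:: j]; k; [::]; [:: bst]]]
   (400 * L.+1)
   [:: W, [::], [::], [::], [::], [::], [::], [::] &
     [:: PS; [::]; [::]; [:: 0, nat_of_bool (j == bst), y, x & bs']; [::]; [::]; [:: n]; S;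
       [::]; [::]; [::]; [::]; [::]; [::]; [::]; [::]; nA; [::]; [:: j.+1]; k; [::]; [:: bst]]].
Proof.
move=> hx hy hj; have [Lx Ly Lj Lb] := And4 (fit0L hx) (fit0L hy) (fit0L hj) (fit0L hbst).
have hj' : j < 2 ^ l0 by lia.
have [Mj Mb] := conj (fit0 hj') (fit0 hbst); have lp := lam_pos.
have Lj' := fit0L hj'.
have L0 : 0 < 2 ^ L by rewrite expn_gt0.
have L1 : 1 < 2 ^ L by apply: fit0L; lia.
apply: hle.
  rewrite /read_buyer; do 2 hstep hmove; hex lam.
  apply: (@hseq L _ _ _ 2 [:: W, [::], [::], [::], [::], [::], [::], [::] &
     [:: PS; [::]; [::]; [:: nat_of_bool (j == bst), y, x & bs']; [::]; [::]; [:: n]; S;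
       [::]; [::]; [::]; [::]; [::]; [::]; [::]; [::]; nA; [::]; [:: j]; k; [::]; [:: bst]]]).
    apply: (@hifz L 6 _ _ _ (j - bst + (bst - j)) [::] 1) => //=; first by lia.
    have -> : (j - bst + (bst - j) == 0) = (j == bst) by lia.
    by case: (j == bst) => /=; hlast hpushc.
  rewrite /=; hstep hpushc; hstep hpushc; hstep hmove.
  by eapply heqr; [apply: (@hadd L 6 3 26 _ 1 j [::] [::]) | rewrite /= add1n].
by rewrite /=; lia.
Qed.

Lemma hread_buyers W PS S nA :
  hrun L (repeat_ 27 read_buyer)
   [:: tcs sB ++ W, [::], [::], [::], [::], [::], [::], [::] &
     [:: PS; [::]; [::]; [::]; [::]; [::]; [:: n]; S; [::]; [::]; [::]; [::];
       [::]; [::]; [::]; [::]; nA; [::]; [:: 0]; [:: size sB]; [::]; [:: bst]]]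
   (N * (410 * L.+1) + 5)
   [:: W, [::], [::], [::], [::], [::], [::], [::] &
     [:: PS; [::]; [::]; rev (recss (fun=> 0) sB); [::]; [::]; [:: n]; S; [::]; [::]; [::]; [::];
       [::]; [::]; [::]; [::]; nA; [::]; [:: size sB]; [::]; [::]; [:: bst]]].
Proof.
have hcL : size sB < 2 ^ L by apply: fit0L; lia.
have h1 : 1 < 2 ^ L by apply: fit0L; lia.
have H := @hrepeat L 27 read_buyer (size sB) (400 * L.+1)
  (fun j => tcs (drop j sB) ++ W) [::]
  (fun j l => [:: PS; [::]; [::]; rev (recss (fun=> 0) (take j sB)); [::]; [::]; [:: n]; S;
    [::]; [::]; [::]; [::]; [::]; [::]; [::]; [::]; nA; [::]; [:: j]; l; [::]; [:: bst]])
  isT isT hcL h1.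
rewrite drop0 take0 drop_size take_size in H.
apply: hle; first (apply: H => // j hj); last first.
  have : size sB * (400 * L.+1 + 6) <= N * (400 * L.+1 + 6) by rewrite leq_mul2r hB orbT.
  have : N * (400 * L.+1 + 6) <= N * (410 * L.+1) by rewrite leq_mul2l; apply/orP; right; lia.
  lia.
case ec : sB (hj) => [|b0 cs] // _; rewrite -ec; move: (b0) => {cs ec} b0.
rewrite (drop_nth b0 hj) (take_nth b0 hj).
set b := nth b0 sB j.
have -> : tcs (b :: drop j.+1 sB) ++ W = [:: t b, c b & tcs (drop j.+1 sB) ++ W] by [].
have -> : rev (recss (fun=> 0) (rcons (take j sB) b)) =
    [:: 0, f b, c b, t b & rev (recss (fun=> 0) (take j sB))].
  by rewrite /recs map_rcons flatten_rcons rev_cat.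
have -> : f b = (j == bst).
  have := congr1 (fun s => nth 0 s j) hf.
  by rewrite (nth_map b0) // (nth_map 0) ?size_iota // nth_iota.
have := hBB b => /= /and4P[ht hc _ _].
by apply: hread_buyer => //; lia.
Qed.

Lemma hinit_nu W PS bs S ai : 
  hrun L (repeat_ 27 (pushc 0 12))
   [:: W, [::], [::], [::], [::], [::], [::], [::] &
     [:: PS; [::]; bs; [::]; [::]; [::]; [:: n]; S; [::]; [::]; [::]; [::];
       [::]; [::]; [::]; [::]; [::]; [::]; ai; [:: size sA]; [::]; [:: bst]]]
   (N * 7 + 5)
   [:: W, [::], [::], [::], [::], [::], [::], [::] &
     [:: PS; [::]; bs; [::]; nseq (size sA) 0; [::]; [:: n]; S; [::]; [::]; [::]; [::];
       [::]; [::]; [::]; [::]; [::]; [::]; ai; [::]; [::]; [:: bst]]].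
Proof.
have hcL : size sA < 2 ^ L by apply: fit0L; lia.
have h1 : 1 < 2 ^ L by apply: fit0L; lia.
have H := @hrepeat L 27 (pushc 0 12) (size sA) 1
  (fun j => W) [::]
  (fun j l => [:: PS; [::]; bs; [::]; nseq j 0; [::]; [:: n]; S;
    [::]; [::]; [::]; [::]; [::]; [::]; [::]; [::]; [::]; [::]; ai; l; [::]; [:: bst]])
  isT isT hcL h1.
apply: hle; first (apply: H => // j hj); last lia.
by hlast hpushc; lia.
Qed.

Lemma hparse :
  hrun L parse_input
   [:: [:: size sA, size sB, n & allq sA ++ tcs sB ++ h :: junk],
     [::], [::], [::], [::], [::], [::], [::] &
     [:: [::]; [::]; [::]; [::]; [::]; [::]; [::]; [::]; [::]; [::]; [::]; [::];
       [::]; [::]; [::]; [::]; [::]; [::]; [::]; [::]; [::]; [:: bst]]]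
   (N.+1 * (1500 * L.+1))
   (FR junk (allq sA) [::] (recss (fun=> 0) sB) [::] (nseq (size sA) 0) [::] n
     (scale cells) [::] [::] [:: size sB] [:: n - h] [:: bst]).
Proof.
have p0 : 0 < 2 ^ L by rewrite expn_gt0.
have lp := lam_pos.
have bA : size sA < 2 ^ l0 by lia.
have bB : size sB < 2 ^ l0 by lia.
have bAB : size sA * size sB < 2 ^ l0 by lia.
have hS0 : 64 * n * n * size sA < 2 ^ l0.
  by have := hS 0; rewrite take0 /scale big_nil muln1.
have [LA LB LAB LS0] := And4 (fit0L bA) (fit0L bB) (fit0L bAB) (fit0L hS0).
have [MA MB Mn M64] := And4 (fit0 bA) (fit0 bB) (fit0 hn) (fit0 h64).
have [Ln L64 Lh] := And3 (fit0L hn) (fit0L h64) (fit0L hh).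
have Mh := fit0 hh.
have bnh : n - h < 2 ^ l0 by lia.
have Lnh := fit0L bnh.
have aq : all (fun v => v < 2 ^ L) (allq sA).
  elim: (sA) => // a s IH; rewrite allquads_cons all_cat IH andbT.
  elim: (sB) => // b s' IH'; rewrite quads_cons all_cat IH' andbT /=.
  by have := hAB a b => /= /and5P[hx hy hu hw _]; rewrite !fit0L.
have ar : all (fun v => v < 2 ^ L) (recss (fun=> 0) sB).
  elim: (sB) => // b s IH; rewrite recs_cons all_cat IH andbT /=.
  by have := hBB b => /= /and4P[ht hc hfb _]; rewrite !fit0L // expn_gt0.
have e1 : 64 * n * n * size sA = scale [::] by rewrite /scale big_nil muln1.
have e2 : size sA * size sB = size cells by rewrite size_allpairs.
apply: hle.
  rewrite /parse_input; do 3 hstep hmove; hstep hpushc.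
  hex lam; hstep hdrop; hstep hmove; hex lam; hstep hmove.
  rewrite /envl /= e1 e2 -quadl_cells.
  eapply hseq; first exact: hread_quads.
  eapply hseq.
    apply: (@hmovall L 9 8 _ (rev (quadl cells))) => //.
    by rewrite all_rev quadl_cells.
  rewrite /= revK cats0 quadl_cells; hstep hmove; hstep hpushc.
  eapply hseq; first exact: hread_buyers.
  eapply hseq.
    by apply: (@hmovall L 11 10 _ (rev (recss (fun=> 0) sB))) => //; rewrite all_rev.
  rewrite /= revK cats0; hstep hmove.
  eapply hseq; first exact: hinit_nu.
  hstep hmove; hex lam; hstep hmove; hlast hdrop.
rewrite !size_rev quadl_cells size_recs size_allquads /=.
have : N * (310 * L.+1) + N * (410 * L.+1) = N * (720 * L.+1) by lia.
have : N <= N * L.+1 by rewrite leq_pmulr.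
move: L.+1 (ltn0Sn L) => M M0; nia.
Qed.
End Parse.

(* Reversing all words brings the current buyer's type to the front, so the
   history need not be parsed beyond its length. *)
Definition main_prog : mach :=
  whilene 0 (mov 0 9) ;; (drop_ 9 ;; mov 9 29 ;; movall 9 0) ;; parse_input ;; main_loop.

Definition raws (ws : seq (seq bool)) : stk := flatten [seq rcons (map Some w) None | w <- ws].

Lemma exec_normalize ws : forall ls, nth [::] ls 1 = [::] ->
  exec (whilene 0 (mov 0 9)) (upd (st ls) 0 (raws ws)) (30 * size (raws ws) + 2) None
    (st (set_nth [::] (set_nth [::] ls 0 [::]) 9 (rev (map val2 ws) ++ nth [::] ls 9))).
Proof.
elim: ws => [|w ws IH] ls h1.
  apply: exec_loop_exit => //; apply: (exec_bind (n := 1) (m := 1)); first exact: exec_pop.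
  rewrite {1}/upd eqxx /=; apply: exec_eq; first exact: exec_ret.
  move=> k; rewrite upd_upd !st_set /upd; case: (k =P 0) => [->//|_] /=.
  by case: (k =P 9) => [->|].
have e0 : raws (w :: ws) = rcons (map Some w) None ++ raws ws by [].
have [a [u eu]] : exists a u, raws (w :: ws) = a :: u.
  by rewrite e0; case: w {e0} => [|b w]; do 2 eexists.
apply: (@exec_le _ _ ((1 + (1 + ((10 * size w + 12) + 1))) + (30 * size (raws ws) + 2))).
  by rewrite e0 size_cat size_rcons size_map; lia.
apply: (exec_loop_cont (x := Some a)
   (s1 := upd (st (set_nth [::] ls 9 (val2 w :: nth [::] ls 9))) 0 (raws ws))) => //.
  apply: exec_bind; first exact: exec_pop.
  rewrite {1}/upd eqxx eu /=; apply: exec_bind; first exact: exec_push.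
  apply: exec_bind; last exact: exec_ret.
  apply: exec_eq; first apply: (@exec_move_raw 0 9 _ w (raws ws)) => //.
    by rewrite /upd /= /st h1.
  move=> k; rewrite /finst !upd_upd {3}/upd st_set /upd inE.
  case: (k =P 1) => [->|_] /=; first by rewrite /st h1.
  by case: (k =P 9) => [->|].
apply: exec_eq; first by apply: IH; rewrite nth_set_nth.
move=> k; rewrite !st_set nth_set_nth /=; case: (k =P 9) => [_|_].
  by rewrite rev_cons cat_rcons.
by case: (k =P 0).
Qed.

Lemma val2_raws ws v : v \in map val2 ws -> v < 2 ^ size (raws ws).
Proof.
elim: ws => // w ws IH; rewrite inE => /orP[/eqP ->|/IH h].
  apply: leq_trans (val2_ub w) _; rewrite leq_exp2l // /raws /= size_cat size_rcons size_map.
  by lia.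
by apply: leq_trans h _; rewrite leq_exp2l // /raws /= size_cat; lia.
Qed.

Lemma size_raws ws : size ws <= size (raws ws).
Proof.
elim: ws => // w ws IH; rewrite -[raws _]/(rcons (map Some w) None ++ raws ws).
by rewrite size_cat size_rcons /=; lia.
Qed.

Definition Lof (N : nat) := (20 * (10 * (2 * N * N + 4 * N + 7))).+1.
Definition prim_bound (N : nat) : nat :=
  let L1 := (Lof N).+1 in
  (30 * N + 2) + (8 + 2 * N + N.+1 * (1500 * L1) +
    (N * (2 * (N + N * N) + 26 + N.+1 * (N.+1 * (5000 * L1))) + 5)) * (100 * L1).

Section Main.
Variables (A : eqType) (B : Type) (px py pu pw : A -> B -> nat) (t c f : B -> nat) (n : nat).
Variables (sA : seq A) (sB : seq B) (bst h r : nat) (junk : seq nat) (ws : seq (seq bool)).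
Hypothesis uA : uniq sA.
Hypothesis hb : size sB != 0.
Hypothesis hf : map f sB = [seq nat_of_bool (i == bst) | i <- iota 0 (size sB)].
Hypothesis hws : map val2 ws =
  [:: size sA, size sB, n & allquads px py pu pw sB sA ++ tcs t c sB ++ h :: junk] ++ [:: bst; r].
Let N := size (raws ws) + n + 1.
Let l0 := 2 * N * N + 4 * N + 7.
Hypothesis hAB : forall a b, all (fun z => z < 2 ^ N) [:: px a b; py a b; pu a b; pw a b].
Hypothesis hBB : forall b, all (fun z => z < 2 ^ N) [:: t b; c b; f b].

Lemma exec_main : exists out' s', exists x,
  [/\ exec main_prog (init_state (raws ws)) (prim_bound N) x s',
   s' 0 = flatten (map encw out') &
   h < n -> out' = plist px py pu pw t n (scale py pw n sA (cells sA sB)) sB f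
     (nuk px py pu pw t c n (scale py pw n sA (cells sA sB)) sA sB (n - h).-1) (rev sA)].
Proof.
have hval v : v \in map val2 ws -> v < 2 ^ N.
  by move=> /val2_raws hv; apply: leq_trans hv _; rewrite leq_exp2l // /N; lia.
have Nl0 : 2 ^ N <= 2 ^ l0 by rewrite leq_exp2l // /l0; lia.
have up v : v < 2 ^ N -> v < 2 ^ l0 by move=> hv; apply: leq_trans hv Nl0.
have hNN : N < 2 ^ N by apply: ltn_expl.
have hN := up _ hNN.
have hsz : size (map val2 ws) <= N.
  by rewrite size_map; have := size_raws ws; rewrite /N; lia.
move: (hsz); rewrite {1}hws size_cat /= !size_cat size_allquads /= => hsz2.
have hA : size sA <= N by nia.
have hAB' : size sA * size sB <= N by nia.
have htc : size (tcs t c sB) = 2 * size sB.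
  by elim: (sB) => // b s IH; rewrite /tcs /= -/(tcs t c s) IH; lia.
have hB : size sB <= N by lia.
have hj : size junk <= N by lia.
have hn : n < 2 ^ N by apply: hval; rewrite hws !inE eqxx !orbT.
have hh : h < 2 ^ N by apply: hval; rewrite hws !(mem_cat, inE) eqxx !orbT.
have hbst : bst < 2 ^ N by apply: hval; rewrite hws !(mem_cat, inE) eqxx !orbT.
have hr : r < 2 ^ N by apply: hval; rewrite hws !(mem_cat, inE) eqxx !orbT.
have hjunk v : v \in junk -> v < 2 ^ N.
  by move=> hv; apply: hval; rewrite hws !(mem_cat, inE) hv !orbT.
have h64 : 64 < 2 ^ l0 by rewrite (@ltn_exp2l 2 6) // /l0; lia.
have l0p : 0 < l0 by rewrite /l0; lia.
have hAB0 a b : all (fun z => z < 2 ^ l0) [:: px a b; py a b; pu a b; pw a b].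
  by apply: sub_all (hAB a b) => z; apply: up.
have hBB0 b : all (fun z => z < 2 ^ l0) [:: t b; c b; f b].
  by apply: sub_all (hBB b) => z; apply: up.
have hscale j : scale py pw n sA (take j (cells sA sB)) < 2 ^ l0.
  rewrite /scale; set s := take _ _.
  have hs : size s <= N.
    rewrite size_take /cells size_allpairs; case: ifP => // hlt.
    by apply: leq_trans (ltnW hlt) _.
  have hprod : \prod_(q <- s) (py q.1 q.2 * pw q.1 q.2) <= 2 ^ (2 * N * size s).
    elim: s {hs} => [|q s IH]; first by rewrite big_nil muln0.
    rewrite big_cons /= mulnS expnD leq_mul // mul2n -addnn expnD leq_mul //.
      by have := hAB q.1 q.2 => /= /and5P[_ ? _ _ _]; apply: ltnW.
    by have := hAB q.1 q.2 => /= /and5P[_ _ _ ? _]; apply: ltnW.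
  have hprod2 : \prod_(q <- s) (py q.1 q.2 * pw q.1 q.2) <= 2 ^ (2 * N * N).
    by apply: leq_trans hprod _; rewrite leq_exp2l // leq_mul2l hs orbT.
  apply: (@leq_ltn_trans (2 ^ 6 * 2 ^ N * 2 ^ N * 2 ^ N * 2 ^ (2 * N * N))).
    by rewrite !leq_mul //; lia.
  by rewrite -!expnD ltn_exp2l // /l0; lia.
set L := Lof N.
have eL : L = (20 * (10 * l0)).+1 by [].
have l0L : 2 ^ l0 <= 2 ^ L by rewrite leq_exp2l // eL; lia.
have upL v : v < 2 ^ N -> v < 2 ^ L by move=> /up hv; apply: leq_trans hv l0L.
have [x1 [m1 [hm1 he1]]] : hrun L (drop_ 9 ;; mov 9 29 ;; movall 9 0)
  (set_nth [::] (nseq 30 [::]) 9 (rev (map val2 ws)))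
  (8 + 2 * N)
  [:: [:: size sA, size sB, n & allquads px py pu pw sB sA ++ tcs t c sB ++ h :: junk],
     [::], [::], [::], [::], [::], [::], [::] &
     [:: [::]; [::]; [::]; [::]; [::]; [::]; [::]; [::]; [::]; [::]; [::]; [::];
       [::]; [::]; [::]; [::]; [::]; [::]; [::]; [::]; [::]; [:: bst]]].
  move: hval; rewrite hws => hval.
  set W := (X in rev (X ++ _)).
  have -> : rev (W ++ [:: bst; r]) = [:: r, bst & rev W] by rewrite rev_cat.
  have [Lr Lb] := conj (upL _ hr) (upL _ hbst).
  apply: hle.
    rewrite /=; hstep hdrop; hstep hmove.
    eapply heqr.
      apply: (@hmovall L 9 0 _ (rev W)) => //.
      rewrite all_rev; apply/allP => v hv; apply: upL; apply: hval.
      by rewrite mem_cat hv.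
    by rewrite /= revK cats0.
  have : size W <= N by rewrite /W /= !size_cat size_allquads /=; lia.
  by rewrite size_rev; lia.
have [x2 [m2 [hm2 he2]]] := @hparse A B px py pu pw t c f n sA sB N l0 (10 * l0) L bst h junk
  erefl eL hAB0 hBB0 (up _ hn) hN h64 (up _ hh) (up _ hbst) hA hB hAB' hf hscale.
have hS : scale py pw n sA (cells sA sB) < 2 ^ l0.
  by have := hscale (size (cells sA sB)); rewrite take_size.
have [|||out' [ls' [[x3 [m3 [hm3 he3]]] ho]]] := @hrounds A B px py pu pw t c f n
  (scale py pw n sA (cells sA sB)) sA sB N l0 (10 * l0) L
  erefl eL l0p uA hAB0 hBB0 (up _ hn) hS hN hA hB _ _ erefl erefl junk (n - h) (size sB) [:: bst].
- by apply/allP => v hv; apply: upL; apply: hjunk.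
- by rewrite /N; lia.
- by apply: upL; lia.
exists out', (st (out' :: ls')), x3; split=> //; last by move=> hlt; apply: ho; lia.
have hnorm := @exec_normalize ws (nseq 30 [::]) erefl.
have einit : upd (st (nseq 30 [::])) 0 (raws ws) = init_state (raws ws).
  apply: functional_extensionality => k; rewrite /init_state /upd; case: eqP => // _.
  by rewrite /st nth_nseq if_same.
rewrite einit in hnorm.
apply: (@exec_le _ _ ((30 * size (raws ws) + 2) + (m1 + (m2 + m3)))).
  rewrite /prim_bound -/L.
  have hkk : (n - h) * (2 * (size junk + N * N) + 26 + N.+1 * (N.+1 * (5000 * L.+1))) <=
      N * (2 * (N + N * N) + 26 + N.+1 * (N.+1 * (5000 * L.+1))).
    apply: leq_mul; first by rewrite /N; lia.
    by rewrite leq_add2r leq_add2r leq_mul2l leq_add2r hj orbT.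
  have hs : size (raws ws) <= N by rewrite /N; lia.
  have {hm3} := leq_trans hm3 (leq_mul (leq_add hkk (leqnn 5)) (leqnn _)).
  move: hm1 hm2; rewrite -/L; move: (100 * L.+1) (N * _) (N.+1 * _) => X a b hm1 hm2 hm3.
  by rewrite !mulnDl; move: hm1 hm3; rewrite !mulnDl; lia.
apply: exec_bind; first exact: hnorm.
rewrite cats0.
by apply: exec_bind; [exact: he1 | apply: exec_bind; [exact: he2 | exact: he3]].
Qed.
End Main.

Local Open Scope ring_scope.

(** * The approximation guarantee *)

Lemma gain_nat_bounds (n S t x y u w v m : nat) :
  (0 < n)%N -> (0 < t)%N -> (0 < y)%N -> (0 < w)%N ->
  let p : rat := x%:R / y%:R in let W : rat := u%:R / w%:R in
  let g : rat := p * (W * S%:R - v%:R / n%:R - m%:R) - m%:R / t%:R in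
  let G := gain_nat n S t x y u w v m in
  ((0 < G)%N -> G%:R <= g) /\ g < G%:R + 1.
Proof.
move=> n0 t0 y0 w0 p W g G.
have D0 : (0 < y * t * w * n)%N by rewrite !muln_gt0 y0 t0 w0.
set P := (x * t * u * S * n)%N; set Q := (w * (x * t * v + (x * t + y) * n * m))%N.
have eG : G = ((P - Q) %/ (y * t * w * n))%N.
  by rewrite /G /gain_nat /hdiv; case: eqP => // e; rewrite e in D0.
have nz (k : nat) : (0 < k)%N -> (k%:R : rat) != 0 by move=> h; rewrite pnatr_eq0; lia.
have eg : g * (y * t * w * n)%:R = P%:R - Q%:R.
  rewrite /g /p /W /P /Q !(natrM, natrD).
  by field; rewrite !nz.
have DR : (0 : rat) < (y * t * w * n)%:R by rewrite ltr0n.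
split=> [G0|].
  have h : (G * (y * t * w * n) + Q <= P)%N.
    have := leq_divM (P - Q) (y * t * w * n); rewrite -eG => h1.
    have : (0 < G * (y * t * w * n))%N by rewrite muln_gt0 G0.
    lia.
  by rewrite -(ler_pM2r DR) eg lerBrDr -natrM -natrD ler_nat.
have h : (P < G.+1 * (y * t * w * n) + Q)%N.
  by have := ltn_ceil (P - Q) D0; rewrite -eG; lia.
by rewrite -(ltr_pM2r DR) eg ltrBlDr natr1 -natrM -natrD ltr_nat.
Qed.

Lemma offer_step (J g s mu rho tau P A v FA FR z : rat) :
  A + J - v <= FA -> J + s - mu * (1 - rho) <= FR -> g <= P * (A - v - mu) - mu * tau ->
  0 <= P -> P <= 1 -> s <= mu -> 0 <= mu -> 0 <= rho -> 0 <= tau -> 0 <= g -> rho + tau <= 1 ->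
  z = J + (g + s) - (mu + g) * (1 - (rho + tau)) ->
  z <= P * FA + (1 - P) * FR.
Proof.
move=> hA hR hg P0 P1 sm m0 rho0 tau0 g0 hrt ->.
have h1 : P * (A + J - v) <= P * FA by rewrite ler_wpM2l.
have h2 : (1 - P) * (J + s - mu * (1 - rho)) <= (1 - P) * FR by rewrite ler_wpM2l ?subr_ge0.
have h3 : 0 <= P * (mu - s) by rewrite mulr_ge0 ?subr_ge0.
have h4 : 0 <= P * mu * (1 - rho) by rewrite !mulr_ge0 // subr_ge0; lra.
have h5 : 0 <= g * (1 - (rho + tau)) by rewrite mulr_ge0 // subr_ge0.
lra.
Qed.

Lemma half_bound (n k M : nat) (x : rat) : (0 < n)%N ->
  (64 * n * n * k)%:R <= x -> x < (2 * M + 1)%:R ->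
  32%:R * (n * k)%:R <= M%:R / n%:R :> rat.
Proof.
move=> n0 h1 h2; have := le_lt_trans h1 h2.
rewrite ltr_nat => h.
rewrite ler_pdivlMr; last by rewrite ltr0n.
have {}h : (32 * (n * k) * n <= M)%N by lia.
rewrite -!natrM ler_nat; exact: h.
Qed.

(* An encoded integer is read as one word whose lowest bit is the sign; for
   nonnegative numerator and denominator the factor 2 cancels. *)
Definition wordval (z : int) : nat := (`|z|%N.*2 + nat_of_bool (z < 0)%R)%N.

Section Algorithm.
Variable I : instance.
Local Notation item := 'I_(nA I).
Local Notation buyer := 'I_(nB I).
Hypothesis hI : valid_instance I.

Definition xn (a : item) (b : buyer) := wordval (numq (prob a b)).
Definition yn (a : item) (b : buyer) := wordval (denq (prob a b)).
Definition un (a : item) (b : buyer) := wordval (numq (wt a b)).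
Definition wn (a : item) (b : buyer) := wordval (denq (wt a b)).
Definition items := enum 'I_(nA I).
Definition buyers := enum 'I_(nB I).
Definition Sn : nat := scale yn wn (nr I) items (cells items buyers).
Definition gf := gainf xn yn un wn (@tout I) (nr I) Sn.
Definition muf := mu xn yn un wn (@tout I) (nr I) Sn.
Definition gkf := gk xn yn un wn (@tout I) (nr I) Sn.
Definition nuf := nuk xn yn un wn (@tout I) (@cnt I) (nr I) Sn items buyers.

Lemma prob_bounds a b : 0 < @prob I a b <= 1. Proof. by case: hI. Qed.
Lemma wt_ge0 a b : 0 <= @wt I a b. Proof. by case: hI. Qed.
Lemma tout_gt0 b : (0 < @tout I b)%N. Proof. by case: hI. Qed.
Lemma nr_gt0 : (0 < nr I)%N. Proof. by case: hI. Qed.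
Lemma sum_cnt : (\sum_(b < nB I) cnt b)%N = nr I. Proof. by case: hI. Qed.

Lemma wordval_den (q : rat) : (0 < wordval (denq q))%N.
Proof. by rewrite /wordval; have := denq_gt0 q; lia. Qed.

Lemma wordval_frac (q : rat) : 0 <= q -> q = (wordval (numq q))%:R / (wordval (denq q))%:R.
Proof.
move=> q0; have hn : 0 <= numq q by rewrite numq_ge0.
have hd := denq_gt0 q.
have e z : 0 <= z -> ((wordval z)%:R : rat) = 2%:R * z%:~R.
  move=> z0; rewrite /wordval ltNge z0 /= addn0 -mul2n natrM; congr (_ * _).
  by rewrite pmulrn abszE ger0_norm.
rewrite !e // ?ltW // -[LHS]divq_num_den; field.
by rewrite intr_eq0 denq_neq0.
Qed.

Lemma gf_bounds v a b m : let g : rat := prob a b * (wt a b * Sn%:R - v%:R / (nr I)%:R - m%:R)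
   - m%:R / (tout b)%:R in
  ((0 < gf v a b m)%N -> (gf v a b m)%:R <= g) /\ g < (gf v a b m)%:R + 1.
Proof.
have := @gain_nat_bounds (nr I) Sn (tout b) (xn a b) (yn a b) (un a b) (wn a b) v m nr_gt0
  (tout_gt0 b) (wordval_den _) (wordval_den _).
rewrite /= -!wordval_frac // ?wt_ge0 //.
by have /andP[/ltW] := prob_bounds a b.
Qed.

Definition avail (h : history I) (a : item) := a \notin matched h.

Fixpoint offer (nu : item -> nat) (b : buyer) (p : seq item) : seq item :=
  if p is a :: p' then
    if gkf nu p' a b != 0%N then a :: offer nu b p' else offer nu b p'
  else [::].

Fixpoint avail_gain (X : pred item) (nu : item -> nat) (b : buyer) (p : seq item) : nat :=
  if p is a :: p' then X a * gkf nu p' a b + avail_gain X nu b p' else 0%N.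

Lemma avail_gain_le X nu b p : (avail_gain X nu b p <= muf nu p b)%N.
Proof.
elim: p => //= a p IH; rewrite /muf /= -/(muf nu p b) addnC leq_add //.
by case: (X a); rewrite ?mul1n.
Qed.

(* With [r] probes left, the buyer's price is only charged in proportion to the
   probes already used. *)
Lemma offer_probe (X : pred item) nu b (J : rat) (F : option item -> rat) p :
  J <= Sn%:R * F None ->
  (forall a, X a -> Sn%:R * wt a b + J - (nu a)%:R / (nr I)%:R <= Sn%:R * F (Some a)) ->
  forall r, (r <= tout b)%N ->
  J + (avail_gain X nu b p)%:R - (muf nu p b)%:R * (1 - r%:R / (tout b)%:R) <=
  Sn%:R * probe_val b (take r [seq a <- offer nu b p | X a]) F.
Proof.
move=> hJ hF; have tR : (0 : rat) < (tout b)%:R by rewrite ltr0n tout_gt0.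
elim: p => [|a p IH] r hr.
  by rewrite /= /muf /= mul0r subr0 addr0.
have rt : r%:R / (tout b)%:R <= 1 :> rat by rewrite ler_pdivrMr // mul1r ler_nat.
have r0 : 0 <= r%:R / (tout b)%:R :> rat by rewrite divr_ge0.
have [/andP[p0 p1] [hg1 _]] := conj (prob_bounds a b) (gf_bounds (nu a) a b (muf nu p b)).
rewrite /= /muf /= -/(muf nu p b) -/(gk _ _ _ _ _ _ _ nu p a b) -/(gkf nu p a b).
rewrite -/(gkf nu p a b) in hg1; have hIH := IH r hr.
have hag := avail_gain_le X nu b p.
have m0 : (0 : rat) <= (muf nu p b)%:R by [].
have hagR : (avail_gain X nu b p)%:R <= (muf nu p b)%:R :> rat by rewrite ler_nat.
have ag0 : (0 : rat) <= (avail_gain X nu b p)%:R by [].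
case: eqP => [->|/eqP g0] /=; first by rewrite muln0 addn0.
rewrite natrD; have gR : (0 : rat) <= (gkf nu p a b)%:R by [].
case Xa : (X a); rewrite /= ?mul0n ?mul1n ?add0n; last first.
  by apply: le_trans hIH; nra.
case: r hr rt r0 {hIH} => [|r] hr rt r0 /=.
  by apply: le_trans hJ; rewrite natrD mul0r; nra.
have {IH} hIH := IH r (ltnW hr).
have hFa := hF a Xa.
have g1 : (gkf nu p a b)%:R <= _ := hg1 _; rewrite lt0n in g1.
have {}g1 := g1 g0.
rewrite [leRHS]mulrDr [in leRHS](mulrCA Sn%:R) [in leRHS](mulrCA Sn%:R (1 - _)).
rewrite [Sn%:R * wt a b]mulrC in hFa.
apply: (@offer_step J (gkf nu p a b)%:R (avail_gain X nu b p)%:R (muf nu p b)%:R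
  (r%:R / (tout b)%:R) (tout b)%:R^-1 (prob a b) (wt a b * Sn%:R) _ _ _ _ hFa hIH g1) => //.
- exact: ltW.
- by rewrite divr_ge0 // ltW.
- by rewrite ltW // invr_gt0.
- by move: rt; rewrite -natr1 mulrDl mul1r.
by rewrite -natr1 natrD; ring.
Qed.

Lemma items_uniq : uniq items. Proof. exact: enum_uniq. Qed.

Definition gb nu a b := gkf nu (bef items a) a b.

Lemma avail_gain_sum X nu b q p : rev items = q ++ p ->
  avail_gain X nu b p = (\sum_(a <- p | X a) gb nu a b)%N.
Proof.
elim: p q => [|a p IH] q e; first by rewrite big_nil.
rewrite /= big_cons (IH (rcons q a)) ?cat_rcons // /gb (bef_suffix items_uniq e).
by case: (X a); rewrite ?mul1n ?mul0n.
Qed.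

Lemma muf_avail nu b p : muf nu p b = avail_gain predT nu b p.
Proof. by elim: p => //= a p IH; rewrite mul1n addnC -IH. Qed.

Lemma avail_gain_items X nu b :
  avail_gain X nu b (rev items) = (\sum_(a | X a) gb nu a b)%N.
Proof.
rewrite (@avail_gain_sum X nu b [::]) // (perm_big items); last by rewrite perm_rev.
by rewrite big_enum_cond.
Qed.

Lemma muf_items nu b : muf nu (rev items) b = (\sum_a gb nu a b)%N.
Proof. by rewrite muf_avail avail_gain_items. Qed.

Lemma muf_suffix nu b u v : (muf nu v b <= muf nu (u ++ v) b)%N.
Proof. by elim: u => //= x s IH; apply: leq_trans IH _; rewrite /muf /=; apply: leq_addr. Qed.

Lemma muf_bef nu a b : (muf nu (bef items a) b <= muf nu (rev items) b)%N.
Proof.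
have := muf_suffix nu b (take (index a (rev items)).+1 (rev items)) (bef items a).
by rewrite /bef cat_take_drop.
Qed.

Lemma nufS k a : nuf k.+1 a = (nuf k a + \sum_b cnt b * gb (nuf k) a b)%N.
Proof. by rewrite /nuf /nuk iterS -/(nuk _ _ _ _ _ _ _ _ _ _ _) /nustep big_enum. Qed.

Lemma offer_mem nu b p a : a \in offer nu b p -> a \in p.
Proof.
elim: p => //= x p IH; case: ifP => _; rewrite !inE => h.
  by case/orP: h => [->//|/IH ->]; rewrite orbT.
by rewrite IH ?orbT.
Qed.

Lemma offer_uniq nu b p : uniq p -> uniq (offer nu b p).
Proof.
elim: p => //= x p IH /andP[hx /IH hu]; case: ifP => //= _; rewrite hu andbT.
by apply: contra hx; apply: offer_mem.
Qed.

Lemma matched_rcons (h : history I) r :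
  matched (rcons h r) = matched h ++ (if r.2 is Some a then [:: a] else [::]).
Proof. by rewrite /matched map_rcons flatten_rcons. Qed.

Lemma avail_rcons_none (h : history I) b s : avail (rcons h (b, s, None)) =1 avail h.
Proof. by move=> a; rewrite /avail matched_rcons cats0. Qed.

Lemma sum_avail_some (h : history I) b s a (F : item -> rat) : avail h a ->
  \sum_(a' | avail (rcons h (b, s, Some a)) a') F a' = \sum_(a' | avail h a') F a' - F a.
Proof.
move=> ha; rewrite [in RHS](bigD1 a) //= [F a + _]addrC addrK; apply: eq_bigl => a'.
by rewrite /avail matched_rcons mem_cat negb_or inE.
Qed.

Definition nR : rat := (nr I)%:R.
Definition pot k (X : pred item) : rat := \sum_(a | X a) (nuf k a)%:R / nR.

Lemma nR_gt0 : 0 < nR. Proof. by rewrite ltr0n nr_gt0. Qed.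

Lemma avg_const (z : rat) (F : buyer -> rat) :
  \sum_b ((cnt b)%:R / nR) * (z + F b) = z + \sum_b ((cnt b)%:R / nR) * F b.
Proof.
under eq_bigr do rewrite mulrDr.
rewrite big_split /= -!mulr_suml -natr_sum sum_cnt divff ?mul1r //.
by rewrite gt_eqF ?nR_gt0.
Qed.

Lemma potS k X : pot k.+1 X = pot k X +
  \sum_b ((cnt b)%:R / nR) * (\sum_(a | X a) gb (nuf k) a b)%:R.
Proof.
rewrite /pot; under eq_bigr do rewrite nufS natrD mulrDl.
rewrite big_split /=; congr (_ + _).
under eq_bigr do rewrite natr_sum mulr_suml.
rewrite exchange_big /=; apply: eq_bigr => b _.
rewrite natr_sum mulr_sumr; apply: eq_bigr => a _.
by rewrite natrM mulrAC.
Qed.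

Lemma value_lower (pol : rpolicy I) :
  (forall h b, (size h < nr I)%N ->
     pol h b = [:: (1, offer (nuf (nr I - size h).-1) b (rev items))]) ->
  forall k h, (size h + k)%N = nr I ->
  pot k (avail h) <= Sn%:R * value_from pol k h.
Proof.
move=> hpol; elim=> [|k IH] h hk.
  by rewrite mulr0 /pot big1 // => a _; rewrite /nuf /nuk /= mul0r.
rewrite potS /= mulr_sumr -avg_const.
apply: ler_sum => b _; rewrite mulrCA ler_wpM2l ?divr_ge0 //.
rewrite hpol; last lia.
rewrite big_seq1 mul1r (_ : (nr I - size h).-1 = k); last lia.
set s := exec_list _ _ _; set F := fun o : option item => _.
have es : s = take (tout b) [seq a <- offer (nuf k) b (rev items) | avail h a].
  by rewrite /s /exec_list undup_id // filter_uniq // offer_uniq // rev_uniq items_uniq.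
have hIH o : pot k (avail (rcons h (b, s, o))) <= Sn%:R * value_from pol k (rcons h (b, s, o)).
  by apply: IH; rewrite size_rcons; lia.
have := @offer_probe (avail h) (nuf k) b (pot k (avail h)) F (rev items).
move=> /(_ _ _ (tout b) (leqnn _)); rewrite -es.
rewrite divff ?subrr ?mulr0 ?subr0; last by rewrite pnatr_eq0 -lt0n tout_gt0.
rewrite avail_gain_items; apply.
  rewrite /F add0r; apply: le_trans (hIH None).
  by rewrite /pot (eq_bigl _ _ (avail_rcons_none h b s)).
move=> a ha; rewrite /F mulrDr -addrA lerD2l; apply: le_trans (hIH (Some a)).
by rewrite /pot sum_avail_some.
Qed.

Lemma probe_step (J g s mu M P tau sigma A v FA FR : rat) :
  FA <= A + J - v -> FR <= J + s + M + M * sigma -> P * (A - v - mu) - mu * tau < g + 1 ->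
  0 <= P -> P <= 1 -> 0 <= mu -> mu <= M -> 0 <= s -> 0 <= sigma -> 0 <= tau ->
  P * FA + (1 - P) * FR <= J + (g + 1 + s) + M + M * (sigma + tau).
Proof.
move=> hA hR hg P0 P1 m0 mM s0 sg0 t0.
have h1 : P * FA <= P * (A + J - v) by rewrite ler_wpM2l.
have h2 : (1 - P) * FR <= (1 - P) * (J + s + M + M * sigma) by rewrite ler_wpM2l ?subr_ge0.
have h3 : 0 <= P * (M - mu) by rewrite mulr_ge0 ?subr_ge0.
have h4 : 0 <= tau * (M - mu) by rewrite mulr_ge0 ?subr_ge0.
have h5 : 0 <= P * s by rewrite mulr_ge0.
have h6 : 0 <= P * (M * sigma) by rewrite !mulr_ge0 //; lra.
lra.
Qed.

(* The order of [s] is arbitrary: prices are bounded by their final value [M], so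
   the buyer and the probes contribute at most [M] each. *)
Lemma probe_upper (X : pred item) nu b (J : rat) (F : option item -> rat) s :
  Sn%:R * F None <= J ->
  (forall a, X a -> Sn%:R * F (Some a) <= Sn%:R * wt a b + J - (nu a)%:R / nR) ->
  all X s ->
  forall M : rat, M = (muf nu (rev items) b)%:R ->
  Sn%:R * probe_val b s F <=
    J + (\sum_(a <- s) ((gb nu a b)%:R + 1)) + M + M * ((size s)%:R / (tout b)%:R).
Proof.
move=> hJ hF hs M eM; have M0 : 0 <= M by rewrite eM.
have tR : (0 : rat) < (tout b)%:R by rewrite ltr0n tout_gt0.
elim: s hs => [|a s IH] /=; first by rewrite big_nil mul0r mulr0 !addr0 => _; lra.
move=> /andP[Xa /IH {}IH]; rewrite big_cons.
have [/andP[p0 p1] [_ hg]] := conj (prob_bounds a b) (gf_bounds (nu a) a b (muf nu (bef items a) b)).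
rewrite [leLHS]mulrDr [in leLHS](mulrCA Sn%:R) [in leLHS](mulrCA Sn%:R (1 - _)).
have hFa := hF a Xa; rewrite [Sn%:R * wt a b]mulrC in hFa.
have -> : (size s).+1%:R / (tout b)%:R = (size s)%:R / (tout b)%:R + (tout b)%:R^-1 :> rat.
  by rewrite -natr1 mulrDl mul1r.
apply: (@probe_step J (gb nu a b)%:R _ (muf nu (bef items a) b)%:R M (prob a b)
  (tout b)%:R^-1 ((size s)%:R / (tout b)%:R) (wt a b * Sn%:R) _ _ _ hFa IH hg) => //.
- exact: ltW.
- by rewrite eM ler_nat muf_bef.
- by apply: sumr_ge0 => x _; rewrite addr_ge0.
- by rewrite divr_ge0.
- by rewrite ltW // invr_gt0.
Qed.

Lemma value_upper (pol : rpolicy I) : valid_rpolicy pol -> forall k h,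
  Sn%:R * value_from pol k h <= pot k (avail h) + 3%:R * pot k predT + k%:R * (nA I)%:R.
Proof.
move=> hpol; elim=> [|k IH] h.
  by rewrite /= mulr0 mul0r addr0 /pot addr_ge0 ?mulr_ge0 // sumr_ge0 // => a _; rewrite divr_ge0 // ltW ?nR_gt0.
pose M b : rat := (muf (nuf k) (rev items) b)%:R.
have hM b : M b = (\sum_(a | predT a) gb (nuf k) a b)%:R by rewrite /M muf_items.
pose J := pot k (avail h) + 3%:R * pot k predT + k%:R * (nA I)%:R.
apply: (@le_trans _ _ (\sum_b ((cnt b)%:R / nR) * ((J + (nA I)%:R) + 3%:R * M b))).
  rewrite /= mulr_sumr; apply: ler_sum => b _; rewrite mulrCA ler_wpM2l ?divr_ge0 //.
  have [h0 h1] := hpol h b.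
  have hU (U : rat) : U = \sum_(d <- pol h b) d.1 * U by rewrite -mulr_suml h1 mul1r.
  rewrite mulr_sumr [leRHS]hU big_seq [leRHS]big_seq.
  apply: ler_sum => d hd; rewrite mulrCA ler_wpM2l //; first by have /allP := h0; apply.
  set s := exec_list _ _ _; set F := fun o : option item => _.
  have us : uniq s by rewrite /s /exec_list take_uniq // undup_uniq.
  have as_ : all (avail h) s.
    apply/allP => a /mem_take; rewrite mem_undup mem_filter => /andP[].
    by [].
  have ss : (size s <= tout b)%N by rewrite /s /exec_list size_take; case: ltnP.
  have hF0 : Sn%:R * F None <= J.
    rewrite /F add0r; apply: le_trans (IH _) _.
    by rewrite /J /pot (eq_bigl _ _ (avail_rcons_none h b s)).
  have hFa a : avail h a -> Sn%:R * F (Some a) <= Sn%:R * wt a b + J - (nuf k a)%:R / nR.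
    move=> ha; rewrite /F mulrDr -[leRHS]addrA lerD2l; apply: le_trans (IH _) _.
    by rewrite /J /pot sum_avail_some //; lra.
  apply: le_trans (probe_upper hF0 hFa as_ erefl) _.
  have h2 : \sum_(a <- s) ((gb (nuf k) a b)%:R + 1) <= M b + (nA I)%:R :> rat.
    have -> : M b + (nA I)%:R = \sum_a ((gb (nuf k) a b)%:R + 1).
      rewrite hM big_split /= -natr_sum; congr (_ + _).
      by rewrite sumr_const card_ord.
    rewrite (big_uniq _ us) /= [leRHS](bigID (mem s)) /= lerDl.
    by apply: sumr_ge0 => a _; rewrite addr_ge0.
  have h3 : M b * ((size s)%:R / (tout b)%:R) <= M b * 1.
    rewrite ler_wpM2l // ler_pdivrMr ?ltr0n ?tout_gt0 // mul1r ler_nat //.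
  rewrite -/(M b); lra.
rewrite avg_const; under eq_bigr do rewrite mulrCA.
rewrite -mulr_sumr !potS -natr1 mulrDl mul1r /J.
set T := \sum_b _ * M b.
have -> : \sum_b (cnt b)%:R / nR * (\sum_(a | predT a) gb (nuf k) a b)%:R = T.
  by apply: eq_bigr => b _; rewrite hM.
have : 0 <= \sum_b (cnt b)%:R / nR * (\sum_(a | avail h a) gb (nuf k) a b)%:R :> rat.
  by apply: sumr_ge0 => b _; rewrite mulr_ge0 // divr_ge0.
lra.
Qed.

Lemma value_le0 (pol : rpolicy I) : valid_rpolicy pol ->
  (forall a b, (0 < @cnt I b)%N -> @wt I a b = 0) -> forall k h, value_from pol k h <= 0.
Proof.
move=> hpol hw; elim=> [|k IH] h //=.
apply: sumr_le0 => b _; case: (posnP (cnt b)) => [->|hc]; first by rewrite mul0r mul0r.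
apply: mulr_ge0_le0; first by rewrite divr_ge0.
have [h0 _] := hpol h b; rewrite big_seq; apply: sumr_le0 => d hd.
apply: mulr_ge0_le0; first by have /allP := h0; apply.
set F := fun o : option item => _.
have hF o : F o <= 0.
  by rewrite /F; case: o => [a|]; rewrite ?(hw _ _ hc) add0r; apply: IH.
elim: (exec_list _ _ _) F hF => [|a s IHs] F hF /=; first exact: hF.
have /andP[p0 p1] := prob_bounds a b.
rewrite -oppr_ge0 opprD -!mulrN addr_ge0 ?mulr_ge0 ?subr_ge0 ?oppr_ge0 //; [exact: ltW|exact: IHs].
Qed.

Lemma nuf_mono k a : (nuf k a <= nuf k.+1 a)%N.
Proof. by rewrite nufS leq_addr. Qed.

Lemma pot_mono k m X : (k <= m)%N -> pot k X <= pot m X.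
Proof.
move=> /subnK <-; elim: (m - k)%N => [|j IH] //; rewrite addSn; apply: le_trans IH _.
rewrite /pot; apply: ler_sum => a _; rewrite ler_pM2r ?invr_gt0 ?nR_gt0 // ler_nat.
exact: nuf_mono.
Qed.

Lemma Sn_large a b : (64 * nr I * nr I * nA I * (yn a b * wn a b) <= Sn)%N.
Proof.
rewrite /Sn /scale /items size_enum_ord leq_mul2l; apply/orP; right.
rewrite /cells; have hm : (a, b) \in [seq (x, y) | x <- items, y <- buyers].
  by apply/allpairsP; exists (a, b); rewrite !mem_enum.
rewrite (big_rem _ hm) /= leq_pmulr // prodn_gt0 // => q.
by rewrite muln_gt0 !wordval_den.
Qed.

(* After all items have been processed the buyer's potential [M] is at least
   half the best single gain, since the gain rule subtracts at most
   [(p + 1/t) M <= 2 M]. *)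
Lemma pot_large a b : (0 < @cnt I b)%N -> 0 < @wt I a b ->
  31%:R * (nr I * nA I)%:R <= pot (nr I) predT.
Proof.
move=> hc hw.
apply: le_trans (pot_mono predT nr_gt0); rewrite potS.
have -> : pot 0 predT = 0 by rewrite /pot big1 // => a' _; rewrite /nuf /nuk /= mul0r.
rewrite [leRHS]add0r [leRHS](bigD1 b isT) [leRHS]/= -muf_items.
set M := muf _ _ _; set rest := (X in _ <= _ + X).
have h0 : 0 <= rest.
  by apply: sumr_ge0 => i _; apply: mulr_ge0; [exact: divr_ge0 | exact: ler0n].
have hgM : (muf (nuf 0) (bef items a) b + gb (nuf 0) a b <= M)%N.
  have hin : a \in rev items by rewrite mem_rev mem_enum.
  have [p1 [p2 e]] : exists p1 p2, rev items = p1 ++ a :: p2.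
    by case/splitPr: hin => p1 p2; exists p1, p2.
  rewrite /M /gb (bef_suffix items_uniq e) e.
  exact: (muf_suffix (nuf 0) b p1 (a :: p2)).
have [/andP[p0 p1] [_ hg]] := conj (prob_bounds a b)
  (gf_bounds (nuf 0 a) a b (muf (nuf 0) (bef items a) b)).
rewrite -/(gkf (nuf 0) (bef items a) a b) -/(gb (nuf 0) a b) in hg.
move: hg hgM; set m := muf _ _ _; set G := gb _ _ _ => hg hgM.
have t1 : (tout b)%:R^-1 <= 1 :> rat.
  by rewrite invf_le1 ?ltr0n ?tout_gt0 // ler1n tout_gt0.
have t0 : 0 <= (tout b)%:R^-1 :> rat by rewrite invr_ge0.
have hm : prob a b * m%:R <= m%:R by rewrite ler_piMl.
have hm2 : m%:R / (tout b)%:R <= m%:R :> rat by rewrite ler_piMr.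
have hgMR : m%:R + G%:R <= M%:R :> rat by rewrite -natrD ler_nat.
have hG0 : 0 <= G%:R :> rat by [].
have e0 : nuf 0 a = 0%N by [].
rewrite e0 mul0r subr0 mulrBr in hg.
have hS : (64 * nr I * nr I * nA I)%:R <= prob a b * (wt a b * Sn%:R) :> rat.
  have := Sn_large a b; rewrite -(ler_nat rat) natrM => hS.
  rewrite mulrA; apply: le_trans (ler_wpM2l _ hS); last by rewrite mulr_ge0 // ltW.
  rewrite mulrCA -[leLHS]mulr1 ler_wpM2l //.
  have hp := wordval_frac (ltW p0); have hww := wordval_frac (ltW hw).
  have y0 : (yn a b)%:R != 0 :> rat by rewrite pnatr_eq0 -lt0n wordval_den.
  have w0 : (wn a b)%:R != 0 :> rat by rewrite pnatr_eq0 -lt0n wordval_den.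
  rewrite hp hww -/(xn a b) -/(yn a b) -/(un a b) -/(wn a b) natrM.
  have -> : (xn a b)%:R / (yn a b)%:R * ((un a b)%:R / (wn a b)%:R) *
    ((yn a b)%:R * (wn a b)%:R) = (xn a b * un a b)%:R :> rat.
    by rewrite natrM; field; rewrite y0 w0.
  rewrite ler1n muln_gt0 !lt0n; apply/andP; split; apply/eqP => h.
    by move: p0; rewrite hp -/(xn a b) h mul0r ltxx.
  by move: hw; rewrite hww -/(un a b) h mul0r ltxx.
have hMR : 32%:R * (nr I * nA I)%:R <= M%:R / nR.
  apply: (half_bound nr_gt0 hS); rewrite natrD natrM; clear hS; lra.
have hc1 : M%:R / nR <= (cnt b)%:R / nR * M%:R.
  by rewrite mulrAC -[leLHS]mul1r -mulrA ler_wpM2r ?divr_ge0 // ?ler1n //.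
have hz : 0 <= (nr I * nA I)%:R :> rat by apply: ler0n.
move: hMR hc1 h0 hz; move: rest => rest; lra.
Qed.

Lemma value_ge0 (pol : rpolicy I) : valid_rpolicy pol -> forall k h, 0 <= value_from pol k h.
Proof.
move=> hpol; elim=> [|k IH] h //=.
apply: sumr_ge0 => b _; apply: mulr_ge0; first by rewrite divr_ge0.
have [h0 _] := hpol h b; rewrite big_seq; apply: sumr_ge0 => d hd.
apply: mulr_ge0; first by have /allP := h0; apply.
set F := fun o : option item => _.
have hF o : 0 <= F o.
  rewrite /F; apply: addr_ge0; last exact: IH.
  by case: o => [a|]; [exact: wt_ge0 | exact: lexx].
elim: (exec_list _ _ _) F hF => [|a s IHs] F hF /=; first exact: hF.
have /andP[p0 p1] := prob_bounds a b.
apply: addr_ge0; apply: mulr_ge0; [exact: ltW | exact: hF | by rewrite subr_ge0 | exact: IHs].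
Qed.

Theorem offer_ratio (pol opt : rpolicy I) :
  (forall h b, (size h < nr I)%N ->
     pol h b = [:: (1, offer (nuf (nr I - size h).-1) b (rev items))]) ->
  valid_rpolicy pol -> valid_rpolicy opt -> 245%:R / 1000%:R * value opt <= value pol.
Proof.
move=> hpol vpol hopt; have hv := value_ge0 vpol (nr I) [::].
case: (boolP [exists a, exists b, (0 < @cnt I b)%N && (0 < @wt I a b)]); last first.
  move=> hno; apply: le_trans hv; apply: mulr_ge0_le0; first by rewrite divr_ge0 ?ler0n.
  apply: value_le0 => // a b hc.
  apply/eqP; rewrite eq_le wt_ge0 andbT leNgt; apply: contra hno => hw.
  by apply/existsP; exists a; apply/existsP; exists b; rewrite hc.
move=> /existsP[a /existsP[b /andP[hc hw]]].
have hl := value_lower hpol (k := nr I) (h := [::]) (add0n _).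
have hu := value_upper hopt (nr I) [::].
have hT := pot_large hc hw.
have eT : pot (nr I) (avail [::]) = pot (nr I) predT by apply: eq_bigl.
rewrite eT in hl hu.
have S0 : 0 < Sn%:R :> rat.
  rewrite ltr0n; apply: leq_trans (Sn_large a b).
  by rewrite !muln_gt0 nr_gt0 !wordval_den !andbT /=; apply: leq_ltn_trans (ltn_ord a).
rewrite -(ler_pM2l S0) mulrCA; rewrite natrM in hT.
move: hl hu hT; rewrite /value.
move: (Sn%:R * value_from opt _ _) (Sn%:R * value_from pol _ _) (pot _ _) => x y T.
have hz : 0 <= (nr I)%:R * (nA I)%:R :> rat by apply: mulr_ge0; apply: ler0n.
move: ((nr I)%:R * (nA I)%:R) hz => z; lra.
Qed.
End Algorithm.

Local Close Scope ring_scope.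

(** * Polynomial time *)

Definition poly_bounded (F : nat -> nat) : Prop :=
  exists c k, forall N, 0 < N -> F N <= c * N ^ k.

Lemma pb_const c : poly_bounded (fun=> c).
Proof. by exists c, 0 => N _; rewrite muln1. Qed.

Lemma pb_id : poly_bounded id.
Proof. by exists 1, 1 => N _; rewrite mul1n expn1. Qed.

Lemma pb_add F G : poly_bounded F -> poly_bounded G -> poly_bounded (fun N => F N + G N).
Proof.
move=> [c [k h]] [c' [k' h']]; exists (c + c'), (k + k') => N N0.
rewrite mulnDl leq_add //.
  by apply: leq_trans (h N N0) _; rewrite leq_mul2l leq_pexp2l ?leq_addr ?orbT.
by apply: leq_trans (h' N N0) _; rewrite leq_mul2l leq_pexp2l ?leq_addl ?orbT.
Qed.

Lemma pb_mul F G : poly_bounded F -> poly_bounded G -> poly_bounded (fun N => F N * G N).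
Proof.
move=> [c [k h]] [c' [k' h']]; exists (c * c'), (k + k') => N N0.
by rewrite expnD mulnACA leq_mul ?h ?h'.
Qed.

Lemma pb_succ F : poly_bounded F -> poly_bounded (fun N => (F N).+1).
Proof. by move=> h; have := pb_add (pb_const 1) h. Qed.

Lemma prim_bound_poly : poly_bounded prim_bound.
Proof.
have hL : poly_bounded (fun N => (Lof N).+1).
  rewrite /Lof; do 2 apply: pb_succ.
  by repeat first [exact: pb_const | exact: pb_id | apply: pb_add | apply: pb_mul].
rewrite /prim_bound.
by repeat first [exact: hL | exact: pb_const | exact: pb_id | apply: pb_succ pb_id
  | apply: pb_add | apply: pb_mul].
Qed.

Definition sym_word (w : seq bool) : seq sym := rcons [seq (if x then B1 else B0) | x <- w] Sep.
Definition sym_words (ws : seq (seq bool)) : seq sym := flatten (map sym_word ws).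

Lemma sym_words_cat u v : sym_words (u ++ v) = sym_words u ++ sym_words v.
Proof. by rewrite /sym_words map_cat flatten_cat. Qed.

Lemma sym_words_flatten l : sym_words (flatten l) = flatten (map sym_words l).
Proof. by elim: l => //= u l IH; rewrite sym_words_cat IH. Qed.

Lemma sym_words_raws ws : sym_words ws = map (fun a => sym_of (Some a)) (raws ws).
Proof.
rewrite /sym_words /raws map_flatten -map_comp; congr flatten; apply: eq_map => w /=.
by rewrite /sym_word map_rcons -map_comp.
Qed.

Lemma enc_natE n : enc_nat n = sym_word (bits n).
Proof.
rewrite /enc_nat /sym_word cats1; congr rcons; rewrite /bits.
have H f m : bin_aux f m = [seq (if x then B1 else B0) | x <- bits_fuel f m].
  by elim: f m => //= f IH m; case: eqP => //= _; rewrite IH.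
exact: H.
Qed.

Lemma enc_intE z : enc_int z = sym_word ((z < 0)%R :: bits `|z|%N).
Proof. by rewrite /enc_int enc_natE. Qed.

Lemma enc_bitsE R : enc_bits R = sym_word R.
Proof. by rewrite /enc_bits /sym_word cats1. Qed.

Lemma dec_nats_word w s acc pw :
  dec_nats (sym_word w ++ s) acc pw = acc + pw * val2 w :: dec_nats s 0 1.
Proof.
elim: w acc pw => [|b w IH] acc pw /=; first by rewrite muln0 addn0.
by case: b; rewrite /= IH; congr (_ :: _); rewrite -mul2n; nia.
Qed.

Lemma dec_nats_encw l : dec_nats (map (fun a => sym_of (Some a)) (flatten (map encw l))) 0 1 = l.
Proof.
elim: l => //= v l IH; rewrite map_cat.
have -> : map (fun a => sym_of (Some a)) (encw v) = sym_word (bits v).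
  by rewrite /encw /sym_word map_rcons -map_comp.
by rewrite dec_nats_word mul1n add0n val2_bits IH.
Qed.

Section Words.
Variable I : instance.

Definition word_int (z : int) : seq bool := (z < 0)%R :: bits `|z|%N.

Definition instance_words : seq (seq bool) :=
  [:: bits (nA I); bits (nB I); bits (nr I)] ++
  flatten [seq flatten [seq [:: word_int (numq (prob a b)); word_int (denq (prob a b));
      word_int (numq (wt a b)); word_int (denq (wt a b))] | b <- buyers I] | a <- items I] ++
  flatten [seq [:: bits (tout b); bits (cnt b)] | b <- buyers I].

Definition round_words (r : round I) : seq (seq bool) :=
  let: (b, s, o) := r in
  [:: bits b, bits (size s) & map (fun a : 'I_(nA I) => bits a) s] ++
  [:: bits (if o is Some a then (a : nat).+1 else 0)].

Definition input_words (h : history I) (b : 'I_(nB I)) (R : seq bool) : seq (seq bool) :=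
  instance_words ++ (bits (size h) :: flatten (map round_words h)) ++ [:: bits b; R].

Lemma flatten_allpairs (X Y Z : Type) (F : X -> Y -> seq Z) s r :
  flatten [seq F a b | a <- s, b <- r] = flatten [seq flatten [seq F a b | b <- r] | a <- s].
Proof. by elim: s => //= a s IH; rewrite flatten_cat IH. Qed.

Lemma tm_inputE h b R : tm_input h b R = sym_words (input_words h b R).
Proof.
rewrite /tm_input /input_words /enc_instance /instance_words /enc_history !sym_words_cat.
rewrite !enc_natE enc_bitsE flatten_allpairs !sym_words_flatten -!map_comp.
have sw0 : sym_words [::] = [::] by [].
have sw_cons x s : sym_words (x :: s) = sym_word x ++ sym_words s by [].
rewrite !sw_cons !sw0 !cats0 -!catA; do 3 congr (_ ++ _).
congr (_ ++ _).
  congr flatten; apply: eq_map => a /=; rewrite sym_words_flatten -map_comp.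
  congr flatten; apply: eq_map => c.
  rewrite -[LHS]/(enc_rat (prob a c) ++ enc_rat (wt a c)) /enc_rat !enc_intE.
  by rewrite -[RHS]/(sym_words _) !sw_cons sw0 cats0 -(catA (sym_word _)).
congr (_ ++ _).
  by congr flatten; apply: eq_map => c /=; rewrite !enc_natE !sw_cons sw0 cats0.
do 2 congr (_ ++ _).
rewrite sym_words_flatten -map_comp; congr flatten.
apply: eq_map => -[[b' s] o]; rewrite /= /enc_round !enc_natE !sw_cons sym_words_cat.
rewrite sw_cons sw0 cats0; do 3 congr (_ ++ _).
rewrite /sym_words -map_comp; congr flatten; apply: eq_map => a; exact: enc_natE.
Qed.

Definition round_vals (h : history I) : seq nat := map val2 (flatten (map round_words h)).

Lemma val2_word_int z : val2 (word_int z) = wordval z.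
Proof. by rewrite /wordval /= val2_bits addnC. Qed.

Lemma map_val2_input h b R : map val2 (input_words h b R) =
  [:: size (items I), size (buyers I), nr I &
     allquads (@xn I) (@yn I) (@un I) (@wn I) (buyers I) (items I) ++
     tcs (@tout I) (@cnt I) (buyers I) ++ size h :: round_vals h] ++ [:: b : nat; val2 R].
Proof.
rewrite /input_words /instance_words !map_cat /= !val2_bits !size_enum_ord.
have mfm (X : Type) (F : X -> seq (seq bool)) l :
  map val2 (flatten (map F l)) = flatten [seq map val2 (F a) | a <- l].
  by rewrite map_flatten -map_comp.
rewrite !mfm -!catA; do 3 congr (_ :: _); congr (_ ++ _).
  congr flatten; apply: eq_map => a; rewrite mfm.
  by congr flatten; apply: eq_map => c; rewrite /quad /xn /yn /un /wn -!val2_word_int.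
congr (_ ++ _).
  by congr flatten; apply: eq_map => c /=; rewrite !val2_bits.
by rewrite /= /round_vals mfm.
Qed.
End Words.

Local Open Scope ring_scope.

Definition offer_machine : TM := toTM main_prog.

Lemma offer_machine_correct (I : instance) (h : history I) (b : 'I_(nB I)) (R : seq bool) (T : nat) :
  let N := (size (tm_input h b R) + nr I + 1)%N in
  (prim_bound N * (40 * (N + nstk + prim_bound N)) <= T)%N ->
  halts_within offer_machine T (tm_input h b R) /\
  exists out, dec_nats (tm_output offer_machine T (tm_input h b R)) 0 1 = out /\
   ((size h < nr I)%N -> out =
     plist (@xn I) (@yn I) (@un I) (@wn I) (@tout I) (nr I) (Sn I) (buyers I)
       (fun b' => nat_of_bool (b' == b)) (@nuf I (nr I - size h).-1) (rev (items I))).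
Proof.
move=> N hT; set ws := input_words h b R.
have szi : size (tm_input h b R) = size (raws ws).
  by rewrite tm_inputE sym_words_raws size_map.
have hw := map_val2_input h b R.
have hin v : v \in map val2 ws -> (v < 2 ^ N)%N.
  by move=> /val2_raws hv; apply: leq_trans hv _; rewrite leq_exp2l // /N szi; lia.
have hq a c : {subset quad (@xn I) (@yn I) (@un I) (@wn I) a c <= map val2 ws}.
  move=> v hv; rewrite hw mem_cat /= !inE !mem_cat; apply/orP; left; do 3 (apply/orP; right).
  apply/orP; left; apply/flattenP; exists (quads (@xn I) (@yn I) (@un I) (@wn I) a (buyers I)).
    by apply/mapP; exists a => //; rewrite mem_enum.
  by apply/flattenP; exists (quad (@xn I) (@yn I) (@un I) (@wn I) a c) => //; apply/mapP; exists c; rewrite ?mem_enum.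
have htc (c : 'I_(nB I)) : {subset [:: tout c; cnt c] <= map val2 ws}.
  move=> v hv; rewrite hw mem_cat /= !inE !mem_cat; apply/orP; left; do 3 (apply/orP; right).
  apply/orP; right; apply/orP; left.
  by apply/flattenP; exists [:: tout c; cnt c] => //; apply/mapP; exists c; rewrite ?mem_enum.
have eN : N = (size (raws ws) + nr I + 1)%N by rewrite /N szi.
have hb : size (buyers I) != 0%N by rewrite size_enum_ord; have := ltn_ord b; lia.
have hf : map (fun b' => nat_of_bool (b' == b)) (buyers I) =
    [seq nat_of_bool (i == b :> nat) | i <- iota 0 (size (buyers I))].
  by rewrite size_enum_ord -val_enum_ord -map_comp.
have hAB (a : 'I_(nA I)) (c : 'I_(nB I)) : all (fun z => z < 2 ^ (size (raws ws) + nr I + 1))%N [:: xn a c; yn a c; un a c; wn a c].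
  by rewrite -eN; apply/allP => z hz; apply: hin; apply: (hq a c).
have hBB (c : 'I_(nB I)) : all (fun z => z < 2 ^ (size (raws ws) + nr I + 1))%N
   [:: tout c; cnt c; nat_of_bool (c == b)].
  rewrite -eN; apply/and4P; split=> //.
  - by apply: hin; apply: (htc c); rewrite inE eqxx.
  - by apply: hin; apply: (htc c); rewrite !inE eqxx orbT.
  have h1 : (1 < 2 ^ N)%N by rewrite -{1}(expn0 2) ltn_exp2l // eN addn1.
  by case: (c == b); rewrite // expn_gt0.
have [out [s' [x [he hs ho]]]] := exec_main (items_uniq I) hb hf hw hAB hBB.
rewrite -eN in he.
have [] := @toTM_correct main_prog (raws ws) _ _ _ T he _ _.
- by rewrite /prim_bound addn_gt0 addn_gt0 orbT.
- apply: leq_trans hT; rewrite leq_mul2l leq_mul2l; apply/orP; right; apply/orP; right.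
  by rewrite leq_add2r leq_add2r eN; lia.
rewrite -sym_words_raws -tm_inputE hs => h1 h2; split=> //.
exists out; split; first by rewrite h2 dec_nats_encw.
by move=> hlt; rewrite ho.
Qed.

Lemma pmap_offer (I : instance) (b : 'I_(nB I)) (nu : 'I_(nA I) -> nat) q p :
  rev (items I) = q ++ p ->
  pmap (@insub nat (fun x => (x < nA I)%N) 'I_(nA I))
    (plist (@xn I) (@yn I) (@un I) (@wn I) (@tout I) (nr I) (Sn I) (buyers I)
       (fun b' => nat_of_bool (b' == b)) nu p) = offer nu b p.
Proof.
elim: p q => // a p IH q e /=; rewrite pmap_cat (IH (rcons q a)) ?cat_rcons //.
have ea : size p = a.
  have := congr1 (fun s => nth a s (size q)) e; rewrite nth_cat ltnn subnn /=.
  have hs := congr1 size e; rewrite size_rev size_enum_ord size_cat /= in hs.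
  rewrite nth_rev size_enum_ord; last lia.
  by move=> e2; rewrite -[in RHS]e2 nth_enum_ord; lia.
have -> : count (fun b' => (b' == b) * gk (@xn I) (@yn I) (@un I) (@wn I) (@tout I) (nr I)
    (Sn I) nu p a b' != 0)%N (buyers I) = (gkf nu p a b != 0)%N.
  have hc : count (pred1 b) (buyers I) = 1%N by rewrite count_uniq_mem ?enum_uniq ?mem_enum.
  case: eqP => g0 /=; last first.
    rewrite -hc; apply: eq_count => b' /=; case: (b' =P b) => [->|]; last by rewrite mul0n.
    by rewrite mul1n; apply/eqP.
  transitivity (count pred0 (buyers I)); last exact: count_pred0.
  apply: eq_count => b' /=.
  case: (b' =P b) => [->|_]; last by rewrite mul0n.
  by rewrite -/(gkf nu p a b) g0 muln0.
case: (_ != _) => //=.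
by rewrite ea; case: insubP => [u _ /val_inj -> //|]; rewrite ltn_ord.
Qed.

Lemma average_ge (m : nat) (F : m.-tuple bool -> rat) (v : rat) :
  (forall R, v <= F R) -> v <= (2%:R ^+ m)^-1 * \sum_(R : m.-tuple bool) F R.
Proof.
move=> hF; have p0 : (0 : rat) < 2%:R ^+ m by rewrite exprn_gt0.
rewrite mulrC ler_pdivlMr; last exact: p0.
have -> : v * 2%:R ^+ m = \sum_(R : m.-tuple bool) v.
  by rewrite sumr_const card_tuple card_bool -[RHS]mulr_natr natrX.
by apply: ler_sum => R _; apply: hF.
Qed.

Theorem theorem3 :
  exists (M : TM) (c k : nat),
    poly_time M c k /\
    forall I : instance, valid_instance I ->
    forall pol : rpolicy I, valid_rpolicy pol ->
      (245%:R / 1000%:R) * value pol <= tm_value M c k I.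
Proof.
have [c [k hck]] : poly_bounded (fun N => prim_bound N * (40 * (N + nstk + prim_bound N)))%N.
  have hp := prim_bound_poly.
  by repeat first [exact: hp | exact: pb_const | exact: pb_id | apply: pb_add | apply: pb_mul].
have hT (I : instance) (h : history I) b R : let m := size (tm_input h b R) in
  (prim_bound (m + nr I + 1) * (40 * (m + nr I + 1 + nstk + prim_bound (m + nr I + 1))) <=
    pbound c k I m)%N.
  by apply: hck; rewrite addn1.
exists offer_machine, c, k; split=> [I h b R|I hI pol hpol].
  by have [] := offer_machine_correct (hT I h b R).
have hR (R : seq bool) : 245%:R / 1000%:R * value pol <= value (@tm_policy offer_machine c k I R).
  apply: offer_ratio; [exact: hI | move=> h b hh | by move=> h b; rewrite /tm_policy big_seq1 | exact: hpol].
  have [_ [out [eo ho]]] := offer_machine_correct (hT I h b R).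
  by rewrite /tm_policy eo (ho hh) (@pmap_offer I b _ [::]).
exact: (average_ge (fun R => hR R)).
Qed.
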